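(* Let $\alpha f_1^{k_1}\cdots f_r^{k_r}$ be the numerical factorization of a polynomial $f$ within certain $\epsilon$, and let $g$ be sufficiently close to $f$ so that its numerical factorization within $\epsilon$ can be written as $\gamma g_1^{k_1}\cdots g_r^{k_r}$ with $\deg(g_j)=\deg(f_j)=\mathbf{m}_j$ for $j=1,2,\ldots,r$. Further assume that $\mathcal{J}(\cdot)$ is the Jacobian of the mapping $\phi$ associated with vectors $\mathbf{b}_1,\ldots,\mathbf{b}_r$, where $\mathbf{b}_j\in\mathbb{C}^{\langle\mathbf{m}_j\rangle}$ with $\|\mathbf{b}_j\|_2=1$ and $\mathbf{b}_j\cdot[\![f_j]\!]=1$ for $j=1,\ldots,r$. Then $$\limsup_{g\to f}\frac{\mathrm{dist}\big(\alpha f_1^{k_1}\cdots f_r^{k_r},\ \gamma g_1^{k_1}\cdots g_r^{k_r}\big)}{\|f-g\|}\ \le\ \eta\,\big\|\mathcal{J}(\alpha,[\![f_1]\!],\ldots,[\![f_r]\!])^+\big\|_2\ <\ \infty,$$ where $\eta$ is a constant associated with $f$ and $\mathbf{b}_1,\ldots,\mathbf{b}_r$.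
   Context: For $f\in\mathbb{C}[x_1,\ldots,x_\ell]$, $\deg(f)=(\deg_{x_1}f,\ldots,\deg_{x_\ell}f)$. $\mathbb{P}^{\mathbf{n}}$ is the vector space of polynomials of degree $\le\mathbf{n}$ (componentwise), $\langle\mathbf{n}\rangle=\dim\mathbb{P}^{\mathbf{n}}$, and $\mathscr{P}^{\mathbf{n}}$ is the set of polynomials of degree exactly $\mathbf{n}$. $[\![f]\!]\in\mathbb{C}^{\langle\mathbf{n}\rangle}$ is the coefficient vector in the monomial basis, and $\|f\|=\|[\![f]\!]\|_2$ makes $\mathbb{P}^{\mathbf{n}}$ a metric space. The dot product is $u\cdot v=u^{\mathsf H}v$. $A^+$ is the Moore–Penrose pseudo-inverse. Structures and manifolds. If $f$ has degree $\mathbf{m}$ and irreducible factorization $\alpha f_1^{k_1}\cdots f_r^{k_r}$ with $\alpha\in\mathbb{C}\setminus\{0\}$, $f_j$ irreducible and pairwise coprime, $k_j\ge1$, $\mathbf{m}_j=\deg(f_j)\neq\mathbf{0}$, then the factorization structure of $f$ is the formal product $\mathfrak{M}=\mathbf{m}_1^{k_1}\cdots\mathbf{m}_r^{k_r}$ (order irrelevant), and $\deg(\mathfrak{M})=\sum k_j\mathbf{m}_j=\mathbf{m}$. $\mathscr{F}^{\mathfrak{M}}$ is the set of all polynomials in $\mathscr{P}^{\mathbf{m}}$, $\mathbf{m}=\deg(\mathfrak{M})$, of the form $\alpha g_1^{k_1}\cdots g_r^{k_r}$ with $\alpha\in\mathbb{C}$ and $g_j\in\mathscr{P}^{\mathbf{m}_j}$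 irreducible and pairwise coprime. It is a complex analytic manifold in $\mathbb{P}^{\mathbf{m}}$ with $\mathrm{codim}(\mathscr{F}^{\mathfrak{M}})=\langle\mathbf{m}\rangle-(\langle\mathbf{m}_1\rangle+\cdots+\langle\mathbf{m}_r\rangle+1-r)$. $\mathrm{dist}(f,\mathscr{F}^{\mathfrak{M}})=\inf_{h\in\mathscr{F}^{\mathfrak{M}}}\|f-h\|$. Numerical factorization. For a polynomial $f$ and $\epsilon>0$, $\alpha f_1\cdots f_s$ is a numerical irreducible factorization of $f$ within $\epsilon$ if $\alpha f_1\cdots f_s\in\mathscr{F}^{\mathfrak{M}}$ is an irreducible factorization and $\min_{\gamma\in\mathbb{C}}\|f-\gamma f_1\cdots f_s\|=\min_{h\in\mathscr{F}^{\mathfrak{M}}}\|f-h\|=\mathrm{dist}(f,\mathscr{F}^{\mathfrak{M}})<\epsilon$, where $\mathfrak{M}$ is the factorization structure of degree $\mathbf{m}=\deg(f)$ such that $\mathrm{codim}(\mathscr{F}^{\mathfrak{M}})=\max\{\mathrm{codim}(\mathscr{F}^{\mathfrak{N}}):\deg(\mathfrak{N})=\mathbf{m},\ \mathrm{dist}(f,\mathscr{F}^{\mathfrak{N}})<\epsilon\}$. Written as a squarefree factorization $\alpha f_1^{k_1}\cdots f_r^{k_r}$ with $f_1,\ldots,f_r$ pairwise coprime, it is a numerical irreducible squarefree factorization; ''numerical factorization'' here refers to this form. Factorizations are considered up to order and nonzero constant multiples of the factors. Distance of factorizations: $\mathrm{dist}(\alpha f_1\cdots f_k,\gamma g_1\cdots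 g_m)=1$ if $m\ne k$, and $=\min_\sigma\max_j\sin(f_j,g_{\sigma_j})$ (minimum over permutations $\sigma$ of $1,\ldots,k$) if $m=k$, where for nonzero $p,q$, $\sin(p,q)=\Big\|\frac{p}{\|p\|}-\frac{[\![q]\!]\cdot[\![p]\!]}{\|q\|\,\|p\|}\frac{q}{\|q\|}\Big\|$; in $\alpha f_1^{k_1}\cdots f_r^{k_r}$ each $f_j$ is repeated $k_j$ times. With $\mathbf{m}=k_1\mathbf{m}_1+\cdots+k_r\mathbf{m}_r$, the mapping $\phi:\mathbb{C}\times\mathbb{C}^{\langle\mathbf{m}_1\rangle}\times\cdots\times\mathbb{C}^{\langle\mathbf{m}_r\rangle}\to\mathbb{C}^{\langle\mathbf{m}\rangle}\times\mathbb{C}^r$ is $(\gamma,[\![p_1]\!],\ldots,[\![p_r]\!])\mapsto([\![\gamma p_1^{k_1}\cdots p_r^{k_r}]\!],\mathbf{b}_1\cdot[\![p_1]\!],\ldots,\mathbf{b}_r\cdot[\![p_r]\!])$, and $\mathcal{J}(\cdot)$ is its complex Jacobian matrix.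
   Formalization: It is additionally assumed that every polynomial of degree at most m near f has a numerical factorization within ε of the same structure, unique up to order and constants; otherwise the claim fails, e.g. for f = x²+x/2+1, ε = 10, where the limsup is infinite. *)

(* Defs.v *)
From HB Require Import structures.
From mathcomp Require Import all_boot all_order all_algebra all_fingroup.
From mathcomp Require Import all_classical all_reals all_analysis.
From mathcomp Require Import complex.
(* [mpoly] is imported without its notations, which clash with those of the
   analysis library. *)
From mathcomp Require Import -(notations) mpoly.

Set Implicit Arguments.
Unset Strict Implicit.
Unset Printing Implicit Defensive.

Import Order.TTheory GRing.Theory Num.Theory.
Import numFieldNormedType.Exports.

Local Open Scope classical_set_scope.
Local Open Scope ring_scope.
Local Open Scope sesquilinear_scope.

Notation cpoly R l := (mpoly l R[i]).

Section LinearAlgebra.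
Variable R : realType.
Notation C := R[i].

Definition cmod (z : C) : R := ComplexField.Normc.normc z.

(* Euclidean norm; applied to row and column vectors only. *)
Definition vnorm p q (A : 'M[C]_(p, q)) : R :=
  Num.sqrt (\sum_i \sum_j cmod (A i j) ^+ 2).

Definition vdot n (u v : 'rV[C]_n) : C := \sum_i (u 0 i)^* * v 0 i.

Definition opnorm2 p q (A : 'M[C]_(p, q)) : \bar R :=
  ereal_sup [set (vnorm (A *m x))%:E | x in [set x : 'cV[C]_q | vnorm x <= 1]].

(* The Penrose conditions, which characterize the Moore-Penrose inverse (unlike
   [pinvmx], which is only a partial inverse). *)
Definition is_mp_pinv p q (A : 'M[C]_(p, q)) (X : 'M[C]_(q, p)) : Prop :=
  [/\ A *m X *m A = A, X *m A *m X = X,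
      (A *m X) ^t* = A *m X & (X *m A) ^t* = X *m A].

Definition mp_pinv p q (A : 'M[C]_(p, q)) : 'M[C]_(q, p) :=
  xget 0 [set X | is_mp_pinv A X].

End LinearAlgebra.

Section PolynomialSpaces.
Variables (R : realType) (l : nat).
Notation C := R[i].
Implicit Types (p q : cpoly R l) (n : multinom l).

Definition pdeg p : multinom l :=
  Multinom [tuple \max_(mu <- msupp p) mu i | i < l]%N.

Definition Pspace n : set (cpoly R l) :=
  [set p | forall i, (pdeg p i <= n i)%N].

(* The zero polynomial has no degree, although [pdeg 0] is the null
   multi-index. *)
Definition Pexact n : set (cpoly R l) := [set p | p != 0 /\ pdeg p = n].

(* Exponents of the monomial basis of [Pspace n]. *)
Definition mindex n := {dffun forall i : 'I_l, 'I_(n i).+1}.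

Definition mexp n (a : mindex n) : multinom l :=
  Multinom [tuple (a i : nat) | i < l].

Definition dimP n : nat := #|{: mindex n}|.

Definition coefv n p : 'rV[C]_(dimP n) :=
  \row_a mcoeff (mexp (enum_val a)) p.

Definition polyv n (v : 'rV[C]_(dimP n)) : cpoly R l :=
  \sum_a v 0 a *: mpolyX C (mexp (enum_val a)).

(* The norm and the dot product of coefficient vectors do not depend on the
   space [Pspace n] in which the polynomials are considered. *)
Definition pnorm p : R :=
  Num.sqrt (\sum_(mu <- msupp p) cmod (mcoeff mu p) ^+ 2).

Definition pdot p q : C :=
  \sum_(mu <- msupp p) (mcoeff mu p)^* * mcoeff mu q.

Definition psin p q : R :=
  pnorm ((pnorm p)^-1%:C%C *: p
         - (pdot q p / (pnorm q * pnorm p)%:C%C) *: ((pnorm q)^-1%:C%C *: q)).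

Definition irreducible_mpoly p : Prop :=
  [/\ p != 0, p \isn't a GRing.unit
    & forall q1 q2, p = q1 * q2 ->
        q1 \is a GRing.unit \/ q2 \is a GRing.unit].

Definition coprime_mpoly p q : Prop :=
  forall d, (exists e, p = e * d) -> (exists e, q = e * d) ->
    d \is a GRing.unit.

End PolynomialSpaces.

(* The formal product m_1^{k_1} ... m_r^{k_r}, with its factors listed in some
   order. *)
Record fstruct (l : nat) := FStruct {
  fs_r : nat;
  fs_m : 'I_fs_r -> multinom l;
  fs_k : 'I_fs_r -> nat;
  fs_m_neq0 : forall j, exists i, fs_m j i != 0%N;
  fs_k_gt0 : forall j, (0 < fs_k j)%N }.

Arguments fs_m {l} f j.
Arguments fs_k {l} f j.

Definition fs_deg l (M : fstruct l) : multinom l :=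
  Multinom [tuple \sum_j fs_k M j * fs_m M j i | i < l]%N.

Section Factorization.
Variables (R : realType) (l : nat).
Notation C := R[i].
Implicit Types (f g h : cpoly R l) (M N : fstruct l).

(* <m> minus the dimension of the manifold: r factors, each determined up to a
   constant, and one global constant. *)
Definition codim M : int :=
  (dimP (fs_deg M))%:Z
  - ((\sum_j dimP (fs_m M j))%N%:Z + 1 - (fs_r M)%:Z).

Definition prime_factors M (fs : 'I_(fs_r M) -> cpoly R l) : Prop :=
  (forall j, Pexact (fs_m M j) (fs j) /\ irreducible_mpoly (fs j)) /\
  (forall i j, i != j -> coprime_mpoly (fs i) (fs j)).
Arguments prime_factors : clear implicits.

Definition fact_prod M (alpha : C) (fs : 'I_(fs_r M) -> cpoly R l) : cpoly R l :=
  alpha *: \prod_j fs j ^+ fs_k M j.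
Arguments fact_prod : clear implicits.

Definition Fman M : set (cpoly R l) :=
  [set h | Pexact (fs_deg M) h /\
    exists alpha fs, prime_factors M fs /\ h = fact_prod M alpha fs].

Definition dist_Fman f M : \bar R :=
  ereal_inf [set (pnorm (f - h))%:E | h in Fman M].

Definition is_min (S : set R) (d : R) : Prop := S d /\ lbound S d.

Definition is_numfact f (eps : R) M (alpha : C)
    (fs : 'I_(fs_r M) -> cpoly R l) : Prop :=
  [/\ Pexact (fs_deg M) f,
      forall N, fs_deg N = fs_deg M -> (dist_Fman f N < eps%:E)%E ->
        codim N <= codim M,
      alpha != 0 /\ prime_factors M fs,
      Fman M (fact_prod M alpha fs)
    & exists d : R,
        [/\ is_min [set pnorm (f - fact_prod M gamma fs) | gamma in [set: C]] d,
            is_min [set pnorm (f - h) | h in Fman M] d,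
            dist_Fman f M = d%:E & d < eps]].
Arguments is_numfact : clear implicits.

(* Equality of factorizations up to the order and nonzero constant multiples
   of the factors. *)
Definition same_factors M (fs gs : 'I_(fs_r M) -> cpoly R l) : Prop :=
  exists s : 'S_(fs_r M), forall j,
    fs_k M (s j) = fs_k M j /\ exists2 c : C, c != 0 & gs j = c *: fs (s j).
Arguments same_factors : clear implicits.

(* Every polynomial sufficiently close to [f] has a numerical factorization
   within [eps] of structure [M], and only one: this is what it means to speak
   of "the" numerical factorization of the polynomials close to [f]. *)
Definition numfact_well_defined_near f (eps : R) M : Prop :=
  exists2 delta : R, 0 < delta &
    forall g, Pspace (fs_deg M) g -> pnorm (f - g) < delta ->
      (exists gamma gs, is_numfact g eps M gamma gs) /\
      (forall gamma gs gamma' gs',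
         is_numfact g eps M gamma gs ->
         is_numfact g eps M gamma' gs' -> same_factors M gs gs').

(* The list of factors with their multiplicities; the constant is left out, as
   the distance of factorizations does not involve it. *)
Definition factor_seq M (fs : 'I_(fs_r M) -> cpoly R l) : seq (cpoly R l) :=
  flatten [seq nseq (fs_k M j) (fs j) | j <- enum 'I_(fs_r M)].
Arguments factor_seq : clear implicits.

Definition max_sin (s t : seq (cpoly R l)) (sigma : 'S_(size s)) : R :=
  \big[Num.max/0]_(j < size s) psin s`_j t`_(sigma j).
Arguments max_sin : clear implicits.

(* The neutral element of the minimum is the value at the identity
   permutation. *)
Definition dist_fact (s t : seq (cpoly R l)) : R :=
  if size s == size t then
    \big[Num.min/max_sin s t 1%g]_(sigma : 'S_(size s)) max_sin s t sigma
  else 1.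

(* The limit superior, as g tends to f and g <> f, of the relative distance of
   the factorizations of g and f; g ranges over the polynomials that have a
   numerical factorization within [eps] of structure [M]. *)
Definition limsup_dist_ratio f (eps : R) M (fs : 'I_(fs_r M) -> cpoly R l)
    : \bar R :=
  ereal_inf [set ereal_sup
    [set x | exists g gamma gs,
       [/\ 0 < pnorm (f - g) < delta, is_numfact g eps M gamma gs
         & x = (dist_fact (factor_seq M fs) (factor_seq M gs)
                / pnorm (f - g))%:E]]
    | delta in [set delta : R | 0 < delta]].
Arguments limsup_dist_ratio : clear implicits.

Section Jacobian.
Variables (M : fstruct l)
  (b : forall j : 'I_(fs_r M), 'rV[C]_(dimP (fs_m M j))).

Definition phi_dom : nat := (1 + \sum_j dimP (fs_m M j))%N.
Definition phi_cod : nat := (dimP (fs_deg M) + fs_r M)%N.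

Definition phi_pack (gamma : C) (fs : 'I_(fs_r M) -> cpoly R l)
    : 'rV[C]_phi_dom :=
  row_mx gamma%:M (\mxrow_j coefv (fs_m M j) (fs j)).

Definition phi (z : 'rV[C]_phi_dom) : 'rV[C]_phi_cod :=
  let gamma := lsubmx z 0 0 in
  let p j := submxrow (rsubmx z) j in
  row_mx (coefv (fs_deg M) (fact_prod M gamma (fun j => polyv (p j))))
         (\row_j vdot (b j) (p j)).

(* [jacobian] acts on row vectors from the right, whence the transposition. *)
Definition phi_jacobian (z : 'rV[C]_phi_dom) : 'M[C]_(phi_cod, phi_dom) :=
  (jacobian phi z)^T.

End Jacobian.

End Factorization.

Arguments prime_factors {R l} M fs.
Arguments fact_prod {R l} M alpha fs.
Arguments is_numfact {R l} f eps M alpha fs.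
Arguments same_factors {R l} M fs gs.
Arguments factor_seq {R l} M fs.
Arguments limsup_dist_ratio {R l} f eps M fs.
Arguments phi_pack {R l} M gamma fs.
Arguments phi {R l} M b z.
Arguments phi_jacobian {R l} M b z.

(* Main.v *)
Require Import Defs.
From mathcomp Require Import all_boot all_order all_algebra.
From mathcomp Require Import all_classical all_reals all_analysis.
From mathcomp Require Import complex.
From HB Require Import structures.
From mathcomp Require Import all_fingroup.
From mathcomp Require Import -(notations) mpoly.
From mathcomp Require Import ring lra.

Set Implicit Arguments.
Unset Strict Implicit.
Unset Printing Implicit Defensive.

Import Order.TTheory GRing.Theory Num.Theory.
Import numFieldNormedType.Exports.

Local Open Scope classical_set_scope.
Local Open Scope ring_scope.
Local Open Scope sesquilinear_scope.

(** The relative change of the factors is controlled in two steps: from the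
    polynomial to its nearest point on the factorization manifold, and from
    that point to its factors.

    Nearest points. A numerical factorization of g yields the point of the
    manifold nearest to g. Uniqueness of the nearest point to f alone would not
    give a Lipschitz dependence: at a focal point of a parabola the nearest
    point is unique and moves like a cube root. The hypothesis is stronger: all
    polynomials near f have a nearest point, and only one. An idea of Federer
    then applies. The projection is continuous, so the distance to the manifold
    grows at unit speed in the direction away from the nearest point, so the
    segment from a nearest point a to x can be prolonged by a fixed length
    beyond x without a ceasing to be nearest ([ray_extension]). The manifold
    therefore stays outside a ball through a that is larger than the one
    centred at x, and the inequality expressing this for two points x and y
    gives the Lipschitz estimate ([projection_lipschitz_near]). The manifold
    need not be closed, but a point of its closure nearest to x would be the
    only nearest point to the points between them, hence it lies in the
    manifold ([closure_nearest]).

    Factors. The differential of phi at a factorization is injective: if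
    (gamma', p_1, ..., p_r) is in its kernel, then f_j divides p_j because
    irreducible polynomials are prime, the degrees make p_j a scalar multiple of
    f_j, and the normalization by b_j makes it zero. Primality of irreducible
    polynomials in several variables is proved by induction on the number of
    variables with Gauss's lemma. Injectivity bounds phi from below near a
    factorization ([local_estimate]), so products that are close have close
    factors once the factors are known to be near each other up to order and
    scaling. The latter is a compactness argument: a limit of normalized
    factorizations is a factorization of the limit, and this is unique
    ([factors_close], [factors_lipschitz]).

    The constant. The scalar alpha of a numerical factorization is arbitrary,
    so the norm of the pseudo-inverse must be bounded below independently of
    alpha. The Jacobian maps the direction of the scalar to the coefficients of
    the product of the f_j^(k_j), whatever alpha is, and its pseudo-inverse is a
    left inverse; hence the norm is at least the inverse of the norm of that
    product ([opnorm2_pinv_lower]). Finally the normalized factors of the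
    nearest point are determined up to a permutation, so that finitely many
    Lipschitz constants have to be dominated by eta, and none of them depends on
    the tolerance. *)

(** * Unique factorization of multivariate polynomials *)

Section Divisibility.
Variable R : idomainType.
Implicit Types a b d p : R.

Definition divides d p := exists e, p = e * d.

(** [irreducible_mpoly] in an arbitrary integral domain, as Gauss's lemma needs it
    for polynomials over a polynomial ring. *)
Definition irreducible_elt p : Prop :=
  [/\ p != 0, p \isn't a GRing.unit
    & forall q1 q2, p = q1 * q2 ->
        q1 \is a GRing.unit \/ q2 \is a GRing.unit].

Definition prime_elt p : Prop :=
  [/\ p != 0, p \isn't a GRing.unit
    & forall a b, divides p (a * b) -> divides p a \/ divides p b].

(** Kaplansky's form of factoriality: it contains both the existence of
    factorizations and, through the primality of the factors, their uniqueness. *)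
Definition factorial_ring : Prop := forall d, d != 0 ->
  exists u s, [/\ u \is a GRing.unit, {in s, forall x, prime_elt x}
                & d = u * \prod_(x <- s) x].

Lemma divides_mull d p a : divides d p -> divides d (a * p).
Proof. by case=> e ->; exists (a * e); rewrite mulrA. Qed.

Lemma divides_mulr d p a : divides d p -> divides d (p * a).
Proof. by rewrite mulrC; exact: divides_mull. Qed.

Lemma divides_refl d : divides d d.
Proof. by exists 1; rewrite mul1r. Qed.

Lemma divides0 d : divides d 0.
Proof. by exists 0; rewrite mul0r. Qed.

Lemma dividesD d p q : divides d p -> divides d q -> divides d (p + q).
Proof. by case=> e -> [e' ->]; exists (e + e'); rewrite mulrDl. Qed.

Lemma dividesB d p q : divides d p -> divides d q -> divides d (p - q).
Proof. by case=> e -> [e' ->]; exists (e - e'); rewrite mulrBl. Qed.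

Lemma prime_elt_unitM u p : u \is a GRing.unit -> prime_elt p ->
  prime_elt (u * p).
Proof.
move=> uU [p0 pU pP].
have dvdE x : divides (u * p) x -> divides p x.
  by case=> e ->; exists (e * u); rewrite mulrA.
have dvdE' x : divides p x -> divides (u * p) x.
  by case=> e ->; exists (e / u); rewrite mulrA mulrVK.
split.
- by rewrite mulf_neq0 //; apply: contraTneq uU => ->; rewrite unitr0.
- by rewrite unitrM uU.
- by move=> a b /dvdE/pP[/dvdE'|/dvdE']; [left|right].
Qed.

(** A factorization of an irreducible element into primes has a single prime
    factor, up to a unit. *)
Lemma factorial_irreducible_prime p :
  factorial_ring -> irreducible_elt p -> prime_elt p.
Proof.
move=> UR [p0 pU pI]; have [u [s [uU sP def_p]]] := UR p p0.
case: s => [|x s] in sP def_p; first by rewrite def_p big_nil mulr1 uU in pU.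
rewrite big_cons mulrCA in def_p.
have xP : prime_elt x by apply: sP; rewrite mem_head.
case: (pI _ _ def_p) => [xU|vU]; first by case: xP; rewrite xU.
by rewrite def_p mulrC; exact: prime_elt_unitM.
Qed.

(** Statements about nonzero constants are proved by cancelling their prime
    factors one at a time; this replaces the passage to the field of fractions. *)
Lemma factorial_ind (P : R -> Prop) : factorial_ring ->
  (forall u, u \is a GRing.unit -> P u) ->
  (forall x d, prime_elt x -> d != 0 -> P d -> P (x * d)) ->
  forall d, d != 0 -> P d.
Proof.
move=> UR Pu Px d /[dup] d0 /UR[u [s [uU sP def_d]]]; rewrite {}def_d in d0 *.
elim: s sP d0 => [|x s IHs] sP; first by rewrite big_nil mulr1 => _; exact: Pu.
rewrite big_cons mulrCA mulf_eq0 => /norP[x0 d0].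
apply: Px => //; first by apply: sP; rewrite mem_head.
by apply: IHs => // y ys; apply: sP; rewrite inE ys orbT.
Qed.

End Divisibility.

Section Gauss.
Variable R : idomainType.
Hypothesis UR : factorial_ring R.
Implicit Types (c d x : R) (p q a b g h : {poly R}).

(** A prime of the ring that divides a product divides one of the leading
    coefficients, and the corresponding leading term can be removed. *)
Lemma prime_polyC x : prime_elt x -> prime_elt x%:P.
Proof.
case=> x0 xU xP; split; first by rewrite polyC_eq0.
  by rewrite poly_unitE size_polyC x0 coefC eqxx.
have key a b n : (size a + size b <= n)%N ->
    divides x%:P (a * b) -> divides x%:P a \/ divides x%:P b.
  elim: n a b => [|n IHn] a b.
    rewrite leqn0 addn_eq0 => /andP[/eqP + _] _ => /eqP.
    by rewrite size_poly_eq0 => /eqP->; left; exact: divides0.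
  wlog xla : a b / divides x (lead_coef a) => [hw|].
    move=> sn xab; have [e e_ab] := xab.
    have: divides x (lead_coef a * lead_coef b).
      exists (lead_coef e).
      by rewrite -lead_coefM e_ab lead_coefM lead_coefC.
    case/xP => [xa|xb]; first exact: hw.
    by rewrite addnC in sn; rewrite mulrC in xab; case: (hw b a xb sn xab); auto.
  have [->|a0] := eqVneq a 0; first by left; exact: divides0.
  case: xla => e e_a sn xab.
  pose t := e%:P * 'X^((size a).-1) * x%:P.
  have xt : divides x%:P t by exists (e%:P * 'X^((size a).-1)).
  have t_E : t = lead_coef a *: 'X^((size a).-1).
    by rewrite /t mulrAC -polyCM -e_a mul_polyC.
  have sat : (size (a - t)%R < size a)%N.
    have sa0 : (0 < size a)%N by rewrite size_poly_gt0.
    rewrite -[ltnRHS](prednK sa0) ltnS; apply/leq_sizeP => j.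
    rewrite leq_eqVlt => /predU1P[<-|sj].
      by rewrite t_E coefB coefZ coefXn eqxx mulr1 subrr.
    rewrite t_E coefB coefZ coefXn gtn_eqF // mulr0 subr0.
    by rewrite nth_default // -(prednK sa0).
  have: divides x%:P ((a - t) * b).
    by rewrite mulrBl; apply: dividesB => //; exact: divides_mulr.
  case/IHn => [|xa|]; [|left|by right].
    by rewrite -ltnS; apply: leq_trans sn; rewrite ltn_add2r.
  by rewrite -[a](subrK t); exact: dividesD.
by move=> a b; exact: (key a b _ (leqnn _)).
Qed.

Lemma divides_cancel x p q e : x != 0 -> p * q = e * x%:P ->
  divides x%:P p -> exists2 p', p = p' * x%:P & p' * q = e.
Proof.
move=> x0 pqe [p' def_p]; exists p' => //.
apply: (@mulIf _ x%:P); first by rewrite polyC_eq0.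
by rewrite -pqe def_p mulrAC.
Qed.

(** Each prime factor of the constant divides one of the two polynomials and
    can be cancelled there, without changing any degree. *)
Lemma clear_constant c p g h : c != 0 -> c%:P * p = g * h ->
  exists g' h', [/\ p = g' * h', size g' = size g & size h' = size h].
Proof.
move=> c0; move: c c0 p g h; apply: (factorial_ind UR) => [u uU|x d xP d0 IHd] p g h.
  move=> def_p; exists (u^-1%:P * g), h; split => //.
    by rewrite -mulrA -def_p mulrA -polyCM mulVr // mul1r.
  rewrite mul_polyC size_scale // invr_eq0.
  by apply: contraTneq uU => ->; rewrite unitr0.
have [x0 _ _] := xP; rewrite polyCM => /esym ghE.
have {}ghE : g * h = d%:P * p * x%:P by rewrite ghE -mulrA mulrC.
have sizeX q : size (q * x%:P) = size q by rewrite mulrC mul_polyC size_scale.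
have [_ _ xPP] := prime_polyC xP.
case: (xPP g h); first by exists (d%:P * p).
- case/(divides_cancel x0 ghE) => g1 -> /esym/IHd[g' [h' [pE sg sh]]].
  by exists g', h'; rewrite sizeX.
- rewrite mulrC in ghE; case/(divides_cancel x0 ghE) => h1 ->.
  rewrite mulrC => /esym/IHd[g' [h' [pE sg sh]]].
  by exists g', h'; rewrite sizeX.
Qed.

(** A prime constant cannot divide a nonconstant irreducible polynomial, so it
    divides the cofactor and can be cancelled. *)
Lemma irreducible_poly_cancel c p b : irreducible_elt p -> (1 < size p)%N ->
  c != 0 -> divides p (c%:P * b) -> divides p b.
Proof.
move=> [p0 pU pI] sp c0; move: c c0 b; apply: (factorial_ind UR) => [u uU|x d xP d0 IHd] b.
  case=> e def_e; exists (u^-1%:P * e).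
  by rewrite -mulrA -def_e mulrA -polyCM mulVr // mul1r.
case=> e; rewrite polyCM => def_e.
have [x0 xU _] := xP; have [_ xPU xPP] := prime_polyC xP.
have {}def_e : e * p = d%:P * b * x%:P by rewrite -def_e -mulrA mulrC.
case: (xPP e p); first by exists (d%:P * b).
  by case/(divides_cancel x0 def_e) => e' _ /esym ?; apply: IHd; exists e'.
case=> q def_p; case: (pI _ _ def_p) => [qU|]; last by rewrite (negPf xPU).
move: sp; rewrite def_p mulrC mul_polyC size_scale //.
by move: qU; rewrite poly_unitE => /andP[/eqP->].
Qed.

(** Gauss's lemma. If p does not divide a, then the gcd of p and a over the
    fractions is constant, and Bezout's identity, cleared of denominators, shows
    that p divides a constant multiple of every b such that p divides a b. *)
Theorem gauss_irreducible_prime p : irreducible_elt p -> prime_elt p.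
Proof.
move=> /[dup] pIrr [p0 pU pI].
have [sp|sp] := leqP (size p) 1.
  have pE := size1_polyC sp; rewrite pE; apply: prime_polyC.
  apply: factorial_irreducible_prime => //.
  have c0 : p`_0 != 0 by rewrite -polyC_eq0 -pE.
  split=> // [|c d cdE].
    apply: contra pU => cU; rewrite pE poly_unitE size_polyC c0 coefC /=.
    exact: cU.
  have := pI c%:P d%:P; rewrite {1}pE cdE polyCM => /(_ erefl).
  by rewrite !poly_unitE !coefC /= => -[/andP[_ ?]|/andP[_ ?]]; [left|right].
split=> // a b pab.
pose g := gcdp p a.
have g0 : g != 0 by rewrite /g gcdp_eq0 (negPf p0).
have sg0 : (0 < size g)%N by rewrite size_poly_gt0.
have [sg|sg] := leqP (size g) 1.
  right; have [[u v] /= uvE] := Bezoutp p a.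
  have suv : size (u * p + v * a) = 1%N.
    by rewrite (eqp_size uvE); apply/eqP; rewrite eqn_leq sg.
  have /size_poly1P[d d0 dE] : size (u * p + v * a) == 1%N by rewrite suv.
  apply: (irreducible_poly_cancel pIrr sp d0); rewrite -dE mulrDl.
  apply: dividesD; first by rewrite mulrAC; exact/divides_mull/divides_refl.
  by rewrite -mulrA; exact: divides_mull.
left; have /Pdiv.Idomain.dvdpP[[c h] /= c0 cp] : g %| p by exact: dvdp_gcdl.
have /Pdiv.Idomain.dvdpP[[c' k] /= c'0 ca] : g %| a by exact: dvdp_gcdr.
rewrite -!mul_polyC in cp ca; rewrite [RHS]mulrC in cp.
have [g' [h' [pE sg' sh']]] := clear_constant c0 cp.
have h'U : h' \is a GRing.unit.
  case: (pI _ _ pE) => //; rewrite poly_unitE => /andP[/eqP sg1 _].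
  by rewrite -sg' sg1 in sg.
have /size_poly1P[h0 h00 hE] : size h == 1%N.
  by move: h'U; rewrite poly_unitE -sh' => /andP[].
apply: (irreducible_poly_cancel (c := h0 * c') pIrr sp).
  exact: mulf_neq0.
exists (c%:P * k); rewrite polyCM -hE -mulrA ca mulrCA [h * g]mulrC -cp.
by rewrite mulrCA mulrA.
Qed.

End Gauss.

Section MpolyFactorial.
Variable F : fieldType.

Section MuniIso.
Variable n : nat.
Implicit Types p q : (mpoly n.+1 F).

(** Inverse of [muni]: polynomials in n+1 variables are polynomials in the last
    one over those in the first n. *)
Definition muni_inv (p : {poly (mpoly n F)}) : (mpoly n.+1 F) :=
  (map_poly (@mwiden n F) p).[mpolyX F (mnm1 ord_max)].

Lemma muni_invD : {morph muni_inv : p q / p + q}.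
Proof. by move=> p q; rewrite /muni_inv rmorphD hornerD. Qed.

Lemma muni_invM : {morph muni_inv : p q / p * q}.
Proof. by move=> p q; rewrite /muni_inv rmorphM hornerM. Qed.

Lemma muniK : cancel (@muni n F) muni_inv.
Proof.
move=> p; rewrite muniE [RHS]mpolyE.
have multi0 : muni_inv 0 = 0 by rewrite /muni_inv rmorph0 horner0.
rewrite (big_morph muni_inv muni_invD multi0); apply: eq_bigr => m _.
rewrite -!mul_polyC muni_invM /muni_inv.
rewrite map_polyXn hornerXn map_polyC hornerC /= mwidenZ mwidenX -scalerAl.
rewrite mpolyXn -mpolyXD; congr (_ *: mpolyX F _).
apply/mnmP => i; rewrite mnmDE mulmnE mnmE.
have [j ->|->] := unliftP ord_max i.
  have -> : lift ord_max j = widen_ord (leqnSn n) j.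
    by apply: val_inj; rewrite /= /bump leqNgt ltn_ord.
  by rewrite mnmwiden_widen mnmE eqE /= gtn_eqF ?mul0n ?addn0.
by rewrite mnmwiden_ordmax eqxx mul1n.
Qed.

Lemma muniX m : muni (mpolyX F m) =
  mpolyX F (Multinom [tuple m (widen_ord (leqnSn n) i) | i < n]) *: 'X^(m ord_max)
  :> {poly (mpoly n F)}.
Proof. by rewrite muniE msuppX big_seq1 mcoeffX eqxx scale1r. Qed.

Lemma muni_mwiden (q : (mpoly n F)) : muni (mwiden q) = q%:P.
Proof.
rewrite (mpolyE q) (big_morph _ (@mwidenD n F) (@mwiden0 n F)).
rewrite (big_morph _ (@muniD n F) (@muni0 n F)).
rewrite (big_morph _ (@polyCD _) (@polyC0 _)); apply: eq_bigr => m _.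
rewrite mwidenZ mwidenX muniZ muniX mnmwiden_ordmax expr0 -mul_mpolyC polyCM.
rewrite mul_polyC alg_polyC; congr (_ *: _%:P).
by congr mpolyX; apply/mnmP => i; rewrite mnmE mnmwiden_widen.
Qed.

Lemma muni_invK : cancel muni_inv (@muni n F).
Proof.
move=> p; rewrite -[in RHS](coefK p) poly_def /muni_inv horner_coef.
rewrite size_map_inj_poly ?mwiden0 //; last exact: inj_mwiden.
rewrite rmorph_sum /=; apply: eq_bigr => i _.
rewrite coef_map_id0 ?mwiden0 // rmorphM rmorphXn /= -mul_polyC muni_mwiden.
congr (_ * _ ^+ _); rewrite muniX -[RHS]scale1r mnmE eqxx expr1.
congr (_ *: _); rewrite -mpolyX0; congr mpolyX.
by apply/mnmP => j; rewrite !mnmE eqE /= gtn_eqF.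
Qed.

Lemma muni_inv_unit (p : {poly (mpoly n F)}) : (muni_inv p \is a GRing.unit) = (p \is a GRing.unit).
Proof.
have multi1 : muni_inv 1 = 1 by rewrite /muni_inv rmorph1 hornerC.
apply/unitrP/unitrP => [[q [qp pq]]|[q [qp pq]]].
  exists (muni q); split.
    by have := muniM q (muni_inv p); rewrite qp muni_invK muni1 => <-.
  by have := muniM (muni_inv p) q; rewrite pq muni_invK muni1 => <-.
by exists (muni_inv q); split; rewrite -muni_invM ?qp ?pq.
Qed.

Lemma muni_unit (p : (mpoly n.+1 F)) :
  (muni p \is a GRing.unit) = (p \is a GRing.unit).
Proof. by rewrite -muni_inv_unit muniK. Qed.

Lemma prime_muni (p : (mpoly n.+1 F)) : prime_elt (muni p) -> prime_elt p.
Proof.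
case=> p0 pU pP; split.
- by apply: contraNneq p0 => ->; rewrite muni0.
- by rewrite -muni_unit.
- move=> a b [e abE]; case: (pP (muni a) (muni b)).
  + by exists (muni e); have := muniM e p; rewrite -abE muniM.
  + case=> q qE; left; exists (muni_inv q).
    by rewrite -[LHS]muniK qE muni_invM (muniK p).
  + case=> q qE; right; exists (muni_inv q).
    by rewrite -[LHS]muniK qE muni_invM (muniK p).
Qed.

Lemma irreducible_muni (p : (mpoly n.+1 F)) :
  irreducible_elt p -> irreducible_elt (muni p).
Proof.
case=> p0 pU pI; split.
- apply: contraNneq p0 => p0.
  by have := muniK p; rewrite p0 /muni_inv rmorph0 horner0 => <-.
- by rewrite muni_unit.
- move=> a b pE; have := pI (muni_inv a) (muni_inv b); rewrite !muni_inv_unit; apply.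
  by have := muni_invM a b; rewrite -pE muniK.
Qed.

End MuniIso.

Lemma mpoly_unitE n (p : (mpoly n F)) : (p \is a GRing.unit) = (msize p == 1).
Proof.
apply/idP/idP => [/andP[/eqP pE p0]|/eqP p1].
  by move: p0; rewrite unitfE {2}pE msizeC => ->.
have pE : p = mpolyC _ (mcoeff mnm0 p) by apply/msize1_polyC; rewrite p1.
apply/andP; split; first exact/eqP.
rewrite unitfE; apply: contra_eq_neq p1 => p0.
by rewrite pE p0 mpolyC0 msize0.
Qed.

(** Total degrees bound the length of factorizations into nonunits, so only the
    primality of irreducible polynomials is at stake. *)
Lemma mpoly_factorial_of_prime n :
  (forall p : (mpoly n F), irreducible_elt p -> prime_elt p) ->
  factorial_ring (mpoly n F).
Proof.
move=> irrP p; elim/ltn_ind: {p}(msize p) {-2}p (erefl (msize p)) => k IHk p sp p0.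
case: (boolP (p \is a GRing.unit)) => pU.
  by exists p, [::]; rewrite big_nil mulr1.
have [pI|] := pselect (irreducible_elt p).
  exists 1, [:: p]; rewrite unitr1 big_seq1 mul1r; split=> // x.
  by rewrite inE => /eqP->; exact: irrP.
move=> pNI.
have [a [b [pE aU bU]]] : exists a b, [/\ p = a * b,
    a \isn't a GRing.unit & b \isn't a GRing.unit].
  apply: contrapT => nE; apply: pNI; split=> // a b pE.
  case: (boolP (a \is a GRing.unit)) => aU; first by left.
  case: (boolP (b \is a GRing.unit)) => bU; first by right.
  by case: nE; exists a, b.
have [a0 b0] : a != 0 /\ b != 0.
  by apply/andP; move: p0; rewrite pE mulf_eq0 negb_or.
rewrite !mpoly_unitE in aU bU.
have sa : (1 < msize a)%N.
  by rewrite ltn_neqAle eq_sym aU lt0n msize_poly_eq0.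
have sb : (1 < msize b)%N.
  by rewrite ltn_neqAle eq_sym bU lt0n msize_poly_eq0.
have spE := sp; rewrite pE msizeM // in spE.
have [|u [s [uU sP aE]]] := IHk _ _ a erefl a0.
  by rewrite -spE; case: (msize b) sb => [|[|m]] // _; rewrite !addnS /= ltnS leq_addr.
have [|v [t [vU tP bE]]] := IHk _ _ b erefl b0.
  by rewrite -spE; case: (msize a) sa => [|[|m]] // _; rewrite !addSn /= ltnS leq_addl.
exists (u * v), (s ++ t); split.
- by rewrite unitrM uU vU.
- by move=> x; rewrite mem_cat => /orP[/sP|/tP].
- by rewrite pE {1}aE {1}bE big_cat /= mulrACA.
Qed.

(** Induction on the number of variables: primality is transported from
    univariate polynomials over the polynomials in one variable less. *)
Theorem mpoly_factorial n : factorial_ring (mpoly n F).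
Proof.
elim: n => [|n IHn].
  move=> p p0; exists p, [::]; rewrite big_nil mulr1; split=> //.
  rewrite mpoly_unitE; apply/eqP.
  have pE : p = mpolyC _ (mcoeff mnm0 p).
    apply/mpolyP => m; rewrite mcoeffC; have -> : m = mnm0 by apply/mnmP => -[].
    by rewrite eqxx mulr1.
  have c0 : mcoeff mnm0 p != 0 by apply: contraNneq p0 => c0; rewrite pE c0 mpolyC0.
  by rewrite pE msizeC c0.
apply: mpoly_factorial_of_prime => p /irreducible_muni.
by move/(gauss_irreducible_prime IHn)/prime_muni.
Qed.

Corollary mpoly_irreducible_prime n (p : (mpoly n F)) :
  irreducible_elt p -> prime_elt p.
Proof. exact/factorial_irreducible_prime/mpoly_factorial. Qed.

End MpolyFactorial.

Section DegreeInVariable.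
Variables (n : nat) (F : fieldType) (i : 'I_n).
Implicit Types p q : (mpoly n F).

(** The substitution of x_i T for x_i: the degree in T of the result is the
    degree in x_i, and degrees in T are additive over an integral domain. *)
Definition dilate p : {poly (mpoly n F)} :=
  mmap (polyC \o @mpolyC n F) (fun j => (mpolyX F (mnm1 j))%:P * 'X^(j == i)) p.

Lemma dilateM : {morph dilate : p q / p * q}.
Proof. by move=> p q; rewrite /dilate rmorphM. Qed.

Lemma coef_dilate p d m : mcoeff m (dilate p)`_d = mcoeff m p *+ (m i == d).
Proof.
have markE : dilate p = \sum_(m <- msupp p) (mcoeff m p *: mpolyX F m) *: 'X^(m i).
  apply: eq_bigr => m' _ /=; rewrite -mul_mpolyC -mul_polyC polyCM -mulrA.
  congr (_ * _); rewrite /mmap1.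
  under eq_bigr do rewrite exprMn -exprM.
  rewrite big_split /= mpolyXE_id rmorph_prod /=; congr (_ * _).
    by apply: eq_bigr => j _; rewrite rmorphXn.
  rewrite -expr_sum (bigD1 i) //= eqxx mul1n big1 ?addn0 // => j /negPf ->.
  by rewrite mul0n.
rewrite markE coef_sum raddf_sum /=.
under eq_bigr do rewrite coefZ coefXn mulr_natr mcoeffMn mcoeffZ mcoeffX.
have [mp|mp] := boolP (m \in msupp p).
  rewrite (bigD1_seq m) //= eqxx mulr1 big1 ?addr0 ?[d == _]eq_sym // => m' /negPf ->.
  by rewrite mulr0 mul0rn.
rewrite (memN_msupp_eq0 mp) mul0rn big_seq big1 // => m' m'p.
by rewrite (_ : (m' == m) = false) ?mulr0 ?mul0rn //; apply: contraNF mp => /eqP <-.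
Qed.

Lemma size_dilate_leq p d : reflect (forall m, m \in msupp p -> (m i <= d)%N)
  (size (dilate p) <= d.+1)%N.
Proof.
apply: (iffP idP) => [sp m|pd].
  rewrite leqNgt mcoeff_msupp; apply: contra => dm.
  have := coef_dilate p (m i) m; rewrite eqxx mulr1n => <-.
  by rewrite nth_default ?mcoeff0 // (leq_trans sp).
apply/leq_sizeP => e de; apply/mpolyP => m; rewrite coef_dilate mcoeff0.
case: eqP => [me|_]; last by rewrite mulr0n.
apply/eqP; rewrite mulr1n; apply: contraLR de; rewrite -mcoeff_msupp => /pd.
by rewrite me -ltnNge.
Qed.

Lemma dilate_eq0 p : (dilate p == 0) = (p == 0).
Proof.
apply/eqP/eqP => [p0|->]; last by rewrite /dilate raddf0.
apply/mpolyP => m; have := coef_dilate p (m i) m.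
by rewrite p0 coef0 !mcoeff0 eqxx mulr1n.
Qed.

End DegreeInVariable.

Section MpolyFactors.
Variables (n : nat) (F : fieldType).
Notation T := (mpoly n F).
Implicit Types p q e : T.

Lemma mpoly_unit_const p : p \is a GRing.unit -> exists2 c : F, c != 0 & p = mpolyC n c.
Proof. by case/andP => /eqP pE; rewrite unitfE => c0; exists (mcoeff mnm0 p). Qed.

Lemma mpolyC_unit (c : F) : c != 0 -> mpolyC n c \is a GRing.unit.
Proof. by move=> c0; rewrite mpoly_unitE msizeC c0. Qed.

Lemma const_of_degree0 p : (forall i m, m \in msupp p -> m i = 0%N) -> p = mpolyC _ (mcoeff mnm0 p).
Proof.
move=> p0; apply/mpolyP => m; rewrite mcoeffC.
case: eqP => [->|m0]; first by rewrite mulr1.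
rewrite mulr0 memN_msupp_eq0 //; apply: contra_notN m0 => mp.
by apply/mnmP => i; rewrite mnm0E (p0 i m mp).
Qed.

(** The cofactor has degree 0 in every variable, hence is constant. *)
Lemma scalar_multiple p q : p != 0 -> divides p q ->
  (forall i, (size (dilate i q) <= size (dilate i p))%N) -> exists c, q = c *: p.
Proof.
move=> p0 [e qE] qp; have [e0|e0] := eqVneq e 0.
  by exists 0; rewrite qE e0 mul0r scale0r.
exists (mcoeff mnm0 e); rewrite qE [e in LHS]const_of_degree0 ?mul_mpolyC // => i m me.
apply/eqP; rewrite -leqn0; move: m me; apply/size_dilate_leq.
have := qp i; rewrite qE dilateM size_mul ?dilate_eq0 //.
by rewrite -subn1 leq_subLR leq_add2r.
Qed.

Variables (I : finType) (k : I -> nat) (fs : I -> T).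
Hypothesis k_gt0 : forall i, (0 < k i)%N.
Hypothesis fs_irr : forall i, irreducible_elt (fs i).
Hypothesis fs_indep : forall i j, i != j -> ~ divides (fs i) (fs j).

Lemma fs_neq0 i : fs i != 0. Proof. by case: (fs_irr i). Qed.

Lemma prime_dvd_prod p (J : finType) (P : pred J) (a : J -> nat) (g : J -> T) :
  prime_elt p -> divides p (\prod_(j | P j) g j ^+ a j) ->
  exists2 j, P j & divides p (g j).
Proof.
move=> [p0 pU pP].
have notdvd1 : ~ divides p 1.
  by case=> e /esym ep1; case/negP: pU; apply/unitrP; exists e; rewrite [p * e]mulrC ep1.
have dvdX x m : divides p (x ^+ m) -> divides p x.
  by elim: m => [|m IHm]; [rewrite expr0 | rewrite exprS => /pP[|/IHm]].
move=> pdvd; apply: contrapT => nE; move: pdvd.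
apply: (big_ind (fun x => ~ divides p x)) => //.
  by move=> x y px py /pP[].
by move=> j Pj /dvdX pj; apply: nE; exists j.
Qed.

(** A higher power of [fs i] would divide the product of the other factors. *)
Lemma multiplicity_leq i c m e : c != 0 ->
  c *: \prod_j fs j ^+ k j = e * fs i ^+ m -> (m <= k i)%N.
Proof.
move=> c0; rewrite (bigD1 i) //= leqNgt => cE; apply/negP => ltkm.
have [p0 _ _] := fs_irr i.
have : c *: \prod_(j | j != i) fs j ^+ k j = e * fs i ^+ (m - k i).
  apply: (@mulIf _ (fs i ^+ k i)); first by rewrite expf_neq0.
  by rewrite -mulrA -exprD subnK 1?ltnW // -cE -scalerAl mulrC.
move=> {}cE; have : divides (fs i) (\prod_(j | j != i) fs j ^+ k j).
  exists (c^-1 *: (e * fs i ^+ (m - k i).-1)).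
  apply: (scalerI c0); rewrite cE -scalerAl scalerA divff // scale1r.
  by rewrite -mulrA -exprSr prednK // subn_gt0.
case/(prime_dvd_prod (mpoly_irreducible_prime (fs_irr i))) => j ji.
by apply: fs_indep; rewrite eq_sym.
Qed.

(** Every [hs j] has a prime factor, which is one of the [fs i]; sending j to such
    an i, the multiplicities received by i cannot exceed [k i]. As the sums of the
    multiplicities agree, the map is a bijection and the cofactors are units. *)
Lemma factorization_match (hs : I -> T) a c : a != 0 -> c != 0 ->
  (forall j, hs j != 0 /\ hs j \isn't a GRing.unit) ->
  a *: \prod_j fs j ^+ k j = c *: \prod_j hs j ^+ k j ->
  exists s : {perm I}, forall j,
    k (s j) = k j /\ exists2 b : F, b != 0 & hs j = b *: fs (s j).
Proof.
move=> a0 c0 hsP acE.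
have /choice[t tP] : forall j, exists i, divides (fs i) (hs j).
  move=> j; have [hj0 hjU] := hsP j.
  have [u [s [uU sP hE]]] := mpoly_factorial hj0.
  case: s => [|x s] in sP hE; first by rewrite hE big_nil mulr1 uU in hjU.
  have xP : prime_elt x by apply: sP; rewrite mem_head.
  have xh : divides x (hs j).
    by rewrite hE big_cons; exists (u * \prod_(y <- s) y); rewrite mulrAC mulrA.
  have xprod : divides x (\prod_j fs j ^+ k j).
    have -> : \prod_j fs j ^+ k j = (a^-1 * c) *: \prod_j hs j ^+ k j.
      by rewrite -scalerA -acE scalerA mulVf // scale1r.
    rewrite -mul_mpolyC; apply: divides_mull; rewrite (bigD1 j) //=.
    by apply: divides_mulr; rewrite -(prednK (k_gt0 j)) exprS; exact: divides_mulr.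
  have [i _ [e fE]] := prime_dvd_prod xP xprod; exists i.
  have [_ _ fI] := fs_irr i; have [x0 xU _] := xP.
  case: (fI _ _ fE) => [eU|]; last by rewrite (negPf xU).
  case: xh => d ->; exists (d / e).
  by rewrite fE mulrA divrK.
have /choice[e eP] : forall j, exists e, hs j = e * fs (t j) by exact: tP.
pose K i := (\sum_(j | t j == i) k j)%N.
have prodE : \prod_j hs j ^+ k j = \prod_j e j ^+ k j * \prod_i fs i ^+ K i.
  under eq_bigr do rewrite eP exprMn; rewrite big_split /=; congr (_ * _).
  rewrite (partition_big t xpredT) //=; apply: eq_bigr => i _.
  by rewrite /K expr_sum; apply: eq_bigr => j /eqP ->.
have K_le i : (K i <= k i)%N.
  apply: (@multiplicity_leq i a (K i)
    (c *: (\prod_j e j ^+ k j * \prod_(l | l != i) fs l ^+ K l))) => //.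
  rewrite acE prodE -scalerAl; congr (_ *: _).
  by rewrite [\prod_i fs i ^+ K i](bigD1 i) //= mulrCA mulrC.
have K_eq i : K i = k i.
  have sumE : (\sum_i K i = \sum_i k i)%N.
    by rewrite [RHS](partition_big t xpredT).
  apply/eqP; rewrite eqn_leq K_le /= leqNgt; apply/negP => Kk.
  have : (\sum_i K i < \sum_i k i)%N.
    by rewrite (bigD1 i) //= [ltnRHS](bigD1 i) //= -addSn leq_add ?leq_sum.
  by rewrite sumE ltnn.
have t_inj : injective t.
  have : {in I, forall i, i \in codom t}.
    move=> i _; have : (0 < K i)%N by rewrite K_eq.
    apply: contraLR => it; rewrite /K big_pred0 // => j.
    by apply: contraNF it => /eqP <-; exact: codom_f.
  move=> surj; apply/injectiveP/card_uniqP.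
  rewrite size_map -cardE; apply: eq_card => i; rewrite surj //.
exists (perm t_inj) => j; rewrite permE; split.
  by rewrite -K_eq /K (big_pred1 j) // => i; rewrite (inj_eq t_inj).
have eU : \prod_j e j ^+ k j \is a GRing.unit.
  have fprod0 : \prod_j fs j ^+ k j != 0.
    by apply/prodf_neq0 => i _; rewrite expf_neq0 // fs_neq0.
  have : (mpolyC n a - mpolyC n c * \prod_j e j ^+ k j) * \prod_j fs j ^+ k j = 0.
    rewrite mulrBl (mul_mpolyC a) acE prodE -mulrA (mul_mpolyC c).
    by under [X in _ * X]eq_bigr do rewrite K_eq; rewrite subrr.
  move/eqP; rewrite mulf_eq0 (negPf fprod0) orbF subr_eq0 => /eqP aE.
  have : mpolyC n c * \prod_j e j ^+ k j \is a GRing.unit by rewrite -aE mpolyC_unit.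
  by rewrite unitrM => /andP[].
have : e j \is a GRing.unit.
  move: eU; rewrite (bigD1 j) //= unitrM => /andP[+ _].
  by rewrite unitrX_pos.
case/mpoly_unit_const => b b0 eE; exists b => //.
by rewrite eP eE mul_mpolyC.
Qed.

(** The hypothesis is the vanishing of the differential of the product: modulo
    the power [k i] of [fs i], only the i-th summand survives. *)
Lemma kernel_divides (a g : F) (qs : I -> T) :
  (forall i, a * (k i)%:R != 0) ->
  g *: \prod_i fs i ^+ k i +
    a *: \sum_i (\prod_(j | j != i) fs j ^+ k j) * (qs i * fs i ^+ (k i).-1 *+ k i) = 0 ->
  forall i, divides (fs i) (qs i).
Proof.
move=> ak gaE i; have [p0 pU _] := fs_irr i.
have dvdp : divides (fs i ^+ k i)
    ((a * (k i)%:R) *: (\prod_(j | j != i) fs j ^+ k j * (qs i * fs i ^+ (k i).-1))).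
  move/eqP: gaE; rewrite [\sum_i _](bigD1 i) //= scalerDr addrCA addr_eq0 => /eqP gaE.
  rewrite -scalerA scaler_nat -mulrnAr gaE -mulN1r; apply: divides_mull.
  apply: dividesD.
    rewrite (bigD1 i) //= -mul_mpolyC; apply/divides_mull/divides_mulr/divides_refl.
  rewrite -mul_mpolyC; apply: divides_mull.
  apply: (big_ind (divides (fs i ^+ k i))); [exact: divides0|exact: dividesD|].
  move=> l li; apply: divides_mulr; rewrite (bigD1 i) 1?eq_sym //=.
  exact/divides_mulr/divides_refl.
have {dvdp}: divides (fs i) (\prod_(j | j != i) fs j ^+ k j * qs i).
  have [e eE] := dvdp; exists ((a * (k i)%:R)^-1 *: e).
  apply: (scalerI (ak i)); rewrite -scalerAl scalerA divff // scale1r.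
  apply: (@mulIf _ (fs i ^+ (k i).-1)); first by rewrite expf_neq0.
  by rewrite -scalerAl -mulrA eE -mulrA -exprS prednK.
have fP := mpoly_irreducible_prime (fs_irr i).
have [_ _ fPP] := fP; case/fPP => // /(prime_dvd_prod fP)[j ji fj].
by case: (fs_indep _ fj); rewrite eq_sym.
Qed.

End MpolyFactors.

(** * Euclidean spaces and their bounded sequences *)

Section BolzanoWeierstrass.
Variable R : realType.

(** Limit points, rather than convergent subsequences, are all that the
    compactness arguments need. *)
Lemma bolzano_weierstrass (I : finType) (u : nat -> I -> R) (B : R) :
  (forall n i, `|u n i| <= B) ->
  exists x : I -> R, forall e : R, 0 < e -> forall m, exists2 n, (m <= n)%N &
    forall i, `|u n i - x i| < e.
Proof.
move=> uB; pose v n : 'rV[R]_#|I| := \row_i u n (enum_val i).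
pose A := [set w : 'rV[R]_#|I| | forall i, `[- B, B]%classic (w ord0 i)].
have cA : compact A.
  by apply: (@rV_compact _ _ (fun=> `[- B, B]%classic)) => _; exact: segment_compact.
have [x [_ xcl]] : A `&` cluster (v @ \oo) !=set0.
  apply: cA; exists 0%N => // n _ i /=.
  by rewrite mxE in_itv /= -ler_norml.
exists (fun i => x ord0 (enum_rank i)) => e e0 m.
have Fm : (v @ \oo) (v @` [set n | (m <= n)%N]).
  by exists m => // n /= mn; exists n.
have [_ [[n /= mn <-]]] := xcl _ _ Fm (nbhsx_ballx x e e0).
case=> _ nx; exists n => // i; have := nx ord0 (enum_rank i).
by rewrite /ball /= mxE enum_rankK distrC.
Qed.

End BolzanoWeierstrass.

Section EuclideanSpace.
Variables (R : realType) (N : nat).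
Notation V := 'rV[R]_N.
Implicit Types (u v w x y z a b : V) (s t : R).

Definition dot u v : R := \sum_i u 0 i * v 0 i.
Definition enorm u : R := Num.sqrt (dot u u).

Lemma dotC u v : dot u v = dot v u.
Proof. by apply: eq_bigr => i _; rewrite mulrC. Qed.

Lemma dotDl u v w : dot (u + v) w = dot u w + dot v w.
Proof. by rewrite -big_split; apply: eq_bigr => i _; rewrite mxE mulrDl. Qed.

Lemma dotZl t u w : dot (t *: u) w = t * dot u w.
Proof. by rewrite mulr_sumr; apply: eq_bigr => i _; rewrite mxE mulrA. Qed.

Lemma dot0l w : dot 0 w = 0.
Proof. by rewrite -(scale0r w) dotZl mul0r. Qed.

Lemma dotNl u w : dot (- u) w = - dot u w.
Proof. by rewrite -scaleN1r dotZl mulN1r. Qed.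

Lemma dotDr u v w : dot w (u + v) = dot w u + dot w v.
Proof. by rewrite ![dot w _]dotC dotDl. Qed.

Lemma dotZr t u w : dot w (t *: u) = t * dot w u.
Proof. by rewrite ![dot w _]dotC dotZl. Qed.

Lemma dotNr u w : dot w (- u) = - dot w u.
Proof. by rewrite ![dot w _]dotC dotNl. Qed.

Definition dotE := (dotDl, dotDr, dotNl, dotNr, dotZl, dotZr).

Lemma dot_ge0 u : 0 <= dot u u.
Proof. by apply: sumr_ge0 => i _; rewrite -expr2 sqr_ge0. Qed.

Lemma dot_le0_eq0 u : dot u u <= 0 -> u = 0.
Proof.
move=> u0; have /eqP : dot u u = 0 by apply/le_anti; rewrite u0 dot_ge0.
rewrite psumr_eq0 => [/allP ui0|i _]; last by rewrite -expr2 sqr_ge0.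
apply/rowP => i; rewrite mxE; apply/eqP.
by have := ui0 i (mem_index_enum i); rewrite mulf_eq0 orbb.
Qed.

Lemma enorm_ge0 u : 0 <= enorm u. Proof. exact: sqrtr_ge0. Qed.

Lemma sqr_enorm u : enorm u ^+ 2 = dot u u.
Proof. by rewrite sqr_sqrtr ?dot_ge0. Qed.

Lemma enormN u : enorm (- u) = enorm u.
Proof. by rewrite /enorm !dotE opprK. Qed.

Lemma enormB u v : enorm (u - v) = enorm (v - u).
Proof. by rewrite -enormN opprB. Qed.

Lemma enorm0 : enorm 0 = 0.
Proof. by rewrite /enorm dot0l sqrtr0. Qed.

Lemma enorm_eq0 u : enorm u = 0 -> u = 0.
Proof. by move=> u0; apply: dot_le0_eq0; rewrite -sqr_enorm u0 expr0n. Qed.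

Lemma enormZ t u : enorm (t *: u) = `|t| * enorm u.
Proof.
by rewrite /enorm !dotE mulrA -expr2 sqrtrM ?sqr_ge0 // sqrtr_sqr.
Qed.

Lemma enorm_le u t : 0 <= t -> dot u u <= t ^+ 2 -> enorm u <= t.
Proof. by move=> t0 ut; rewrite -(@ler_pXn2r _ 2) ?nnegrE ?enorm_ge0 // sqr_enorm. Qed.

Lemma enorm_ge u t : 0 <= t -> t ^+ 2 <= dot u u -> t <= enorm u.
Proof. by move=> t0 ut; rewrite -(@ler_pXn2r _ 2) ?nnegrE ?enorm_ge0 // sqr_enorm. Qed.

Lemma cauchy_schwarz u v : dot u v <= enorm u * enorm v.
Proof.
have [u0|u0] := eqVneq (enorm u) 0.
  by rewrite (enorm_eq0 u0) dot0l enorm0 mul0r.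
have uP : 0 < enorm u by rewrite lt_neqAle eq_sym u0 enorm_ge0.
have := dot_ge0 (enorm u ^+ 2 *: v - (dot u v) *: u).
rewrite !dotE -!sqr_enorm [dot v u]dotC => H.
have {}H : 0 <= enorm u ^+ 2 * ((enorm u * enorm v) ^+ 2 - dot u v ^+ 2) by lra.
rewrite pmulr_rge0 ?exprn_gt0 // subr_ge0 in H.
apply: le_trans (ler_norm _) _.
rewrite -(@ler_pXn2r _ 2) ?nnegrE ?normr_ge0 ?mulr_ge0 ?enorm_ge0 //.
by rewrite real_normK ?num_real.
Qed.

Lemma enormD u v : enorm (u + v) <= enorm u + enorm v.
Proof.
apply: enorm_le; first by rewrite addr_ge0 ?enorm_ge0.
rewrite !dotE [dot v u]dotC -!sqr_enorm; have := cauchy_schwarz u v; nra.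
Qed.

Lemma enorm_triangle w u v : enorm (u - v) <= enorm (u - w) + enorm (w - v).
Proof. by rewrite -{1}(subrK w u) -addrA enormD. Qed.

Lemma enorm_coord u i : `|u 0 i| <= enorm u.
Proof.
apply: enorm_ge => //; rewrite real_normK ?num_real //.
rewrite /dot (bigD1 i) //= -expr2 lerDl sumr_ge0 // => j _.
by rewrite -expr2 sqr_ge0.
Qed.

Lemma enorm_le_coord u (e : R) : 0 <= e -> (forall i, `|u 0 i| <= e) -> enorm u <= N%:R * e.
Proof.
move=> e0 ue; apply: enorm_le; first by rewrite mulr_ge0.
have : dot u u <= \sum_(i < N) e ^+ 2.
  apply: ler_sum => i _; rewrite -expr2 -(real_normK (num_real _)).
  by rewrite ler_pXn2r ?nnegrE.
rewrite sumr_const card_ord => /le_trans; apply.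
rewrite -[_ *+ N]mulr_natl.
rewrite exprMn ler_wpM2r ?sqr_ge0 // -natrX ler_nat.
by case: N => // n; rewrite leq_pmulr.
Qed.

(** The parallelogram identity. *)
Lemma midpoint_strict_convexity x y t : dot x x = t -> dot y y = t ->
  t <= dot (2^-1 *: (x + y)) (2^-1 *: (x + y)) -> x = y.
Proof.
move=> xt yt; rewrite !dotE [dot y x]dotC xt yt => H.
by apply/subr0_eq/dot_le0_eq0; rewrite !dotE [dot y x]dotC xt yt; lra.
Qed.

Lemma bolzano_weierstrass_enorm (y : nat -> V) (B : R) :
  (forall n, enorm (y n) <= B) ->
  exists x, forall e : R, 0 < e -> forall m, exists2 n, (m <= n)%N & enorm (y n - x) < e.
Proof.
move=> yB.
have [|x xP] := @bolzano_weierstrass R 'I_N (fun n i => y n 0 i) B.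
  by move=> n i; exact: le_trans (enorm_coord _ _) (yB n).
exists (\row_i x i) => e e0 m.
have N0 : 0 < N.+1%:R :> R by rewrite ltr0n.
have [n mn nx] := xP (e / N.+1%:R) (divr_gt0 e0 N0) m.
exists n => //; apply: (@le_lt_trans _ _ (N%:R * (e / N.+1%:R))).
  apply: enorm_le_coord; first by rewrite divr_ge0 ?ltW.
  by move=> i; rewrite !mxE ltW.
by rewrite mulrCA gtr_pMr // ltr_pdivrMr // mul1r ltr_nat.
Qed.

End EuclideanSpace.

(** * Regularity of the metric projection *)

Section MetricProjection.
Variables (R : realType) (N : nat).
Notation V := 'rV[R]_N.
Implicit Types (u v w x y z a b : V) (s t : R) (S : set V).

Definition nearest S x a := S a /\ forall b, S b -> enorm (x - a) <= enorm (x - b).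

Lemma le_of_eps s t : (forall e : R, 0 < e -> s <= t + e) -> s <= t.
Proof. by move=> h; apply/ler_addgt0Pr => e; apply: h. Qed.

Lemma small_inv (e : R) : 0 < e -> exists m, forall n, (m <= n)%N -> n.+1%:R^-1 < e.
Proof.
move=> e0; have e1 : 0 <= e^-1 by rewrite invr_ge0 ltW.
exists (Num.bound e^-1) => n mn.
rewrite -[e]invrK ltf_pV2 ?posrE ?invr_gt0 ?ltr0n //.
apply: lt_le_trans (archi_boundP e1) _; rewrite ler_nat.
exact: leq_trans (leqnSn n).
Qed.

(** A limit point of a maximizing sequence is a maximum. *)
Lemma lipschitz_max_ball (G : V -> R) x (T : R) : 0 <= T ->
  (forall y z, enorm (y - x) <= T -> enorm (z - x) <= T ->
    `|G y - G z| <= 2 * enorm (y - z)) ->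
  exists2 y, enorm (y - x) <= T &
    forall z, enorm (z - x) <= T -> G z <= G y.
Proof.
move=> T0 GL; pose E := [set G y | y in [set y | enorm (y - x) <= T]].
have xT : enorm (x - x) <= T by rewrite subrr enorm0.
have supE : has_sup E.
  split; first by exists (G x), x.
  exists (G x + 2 * T) => _ [y /= yT <-].
  have := GL y x yT xT; rewrite ler_norml => /andP[_]; nra.
have /choice[y yP] : forall n : nat, exists y,
    enorm (y - x) <= T /\ sup E - n.+1%:R^-1 < G y.
  move=> n; have [] := sup_adherent (_ : 0 < n.+1%:R^-1) supE.
    by rewrite invr_gt0 ltr0n.
  by move=> _ [y /= yT <-] ny; exists y.
have [|l lP] := @bolzano_weierstrass_enorm _ _ y (enorm x + T).
  move=> n; have [yT _] := yP n.
  by have := enormD (y n - x) x; rewrite subrK; lra.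
have lT : enorm (l - x) <= T.
  apply: le_of_eps => e e0; have [n _ nl] := lP e e0 0%N.
  have := enorm_triangle (y n) l x; rewrite (enormB l (y n)).
  have [yT _] := yP n; lra.
exists l => // z zT.
have zE : G z <= sup E by apply: (ub_le_sup supE.2); exists z.
apply: (le_trans zE); apply: le_of_eps => e e0.
have e3 : 0 < e / 3 by rewrite divr_gt0.
have [m mP] := small_inv e3; have [n mn nl] := lP _ e3 m.
have [yT yE] := yP n; have := GL _ _ yT lT; rewrite ler_norml => /andP[_].
move: (mP n mn) yE; move: (_^-1) => i; lra.
Qed.

Variables (S : set V) (x0 : V) (d : R).
Hypothesis nearest_ex : forall x, enorm (x - x0) < d -> exists a, nearest S x a.
Hypothesis nearest_uniq : forall x a b, enorm (x - x0) < d ->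
  nearest S x a -> nearest S x b -> a = b.

(** Move x slightly towards a: by strict convexity of the ball, a becomes the
    only point of the closure nearest to the new point, so the nearest point in
    S that exists by hypothesis must be a. *)
Lemma closure_nearest x a : enorm (x - x0) < d ->
  (forall e : R, 0 < e -> exists2 b, S b & enorm (b - a) < e) ->
  (forall b, S b -> enorm (x - a) <= enorm (x - b)) ->
  nearest S x a.
Proof.
move=> xd aS xa; split=> //; have [q0|q0] := eqVneq (enorm (x - a)) 0.
  have [c [Sc cP]] := nearest_ex xd.
  suff -> : a = c by [].
  have /enorm_eq0/subr0_eq xE := q0; rewrite -xE; apply/subr0_eq/enorm_eq0.
  apply/le_anti; rewrite enorm_ge0 andbT; apply: le_of_eps => e /aS[b Sb ab].
  by apply: le_trans (cP b Sb) _; rewrite xE enormB add0r ltW.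
set q := enorm (x - a) in q0 xa.
have qP : 0 < q by rewrite lt_neqAle eq_sym q0 enorm_ge0.
(* small enough for the moved point to stay in the ball of radius d *)
pose t := Num.min (2^-1) ((d - enorm (x - x0)) / (2 * q)).
have t0 : 0 < t by rewrite lt_min invr_gt0 ltr0n divr_gt0 ?subr_gt0 ?mulr_gt0.
have t1 : t < 1 by rewrite /t gt_min; apply/orP; left; lra.
have tq : t * q < d - enorm (x - x0).
  have : t <= (d - enorm (x - x0)) / (2 * q) by rewrite /t ge_min lexx orbT.
  by rewrite ler_pdivlMr ?mulr_gt0 //; nra.
pose x' := x - t *: (x - a).
have x'd : enorm (x' - x0) < d.
  have x'x : enorm (x' - x) = t * q.
    by rewrite /x' addrAC subrr add0r enormN enormZ gtr0_norm.
  have := enorm_triangle x x' x0; lra.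
have [c [Sc cP]] := nearest_ex x'd.
have x'a : enorm (x' - a) = (1 - t) * q.
  have -> : x' - a = (1 - t) *: (x - a) by rewrite scalerBl scale1r /x' addrAC.
  by rewrite enormZ gtr0_norm // subr_gt0.
have x'c : enorm (x' - c) <= (1 - t) * q.
  apply: le_of_eps => e /aS[b Sb ba].
  apply: le_trans (cP b Sb) _; apply: le_trans (enorm_triangle a _ _) _.
  by rewrite x'a enormB lerD2l ltW.
suff -> : a = c by [].
have [w wE] : exists w, w = x - c by exists (x - c).
have [v vE] : exists v, v = x - a by exists (x - a).
have {}x'c : enorm (w - t *: v) <= (1 - t) * q.
  by rewrite wE vE addrAC.
have vq : enorm v = q by rewrite vE.
have wq : q <= enorm w by rewrite wE; exact: xa.
have wq2 : enorm w <= q.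
  have := enormD (w - t *: v) (t *: v); rewrite subrK enormZ gtr0_norm // vq; lra.
have {wq wq2}wq : enorm w = q by apply/le_anti; rewrite wq wq2.
have vw : q ^+ 2 <= dot w v.
  have H : dot (w - t *: v) (w - t *: v) <= ((1 - t) * q) ^+ 2.
    have tq0 : 0 <= (1 - t) * q by rewrite mulr_ge0 ?subr_ge0 ?ltW.
    by rewrite -sqr_enorm ler_pXn2r ?nnegrE ?enorm_ge0.
  move: H; rewrite !dotE [dot v w]dotC -!sqr_enorm wq vq => H.
  have {}H : 0 <= t * (dot w v - q ^+ 2) by nra.
  by rewrite pmulr_rge0 // subr_ge0 in H.
have : w - v = 0.
  by apply: dot_le0_eq0; rewrite !dotE [dot v w]dotC -!sqr_enorm wq vq; nra.
by rewrite wE vE opprB addrC addrA subrK => /subr0_eq.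
Qed.

Lemma projection_exists : exists p : V -> V,
  forall x, enorm (x - x0) < d -> nearest S x (p x).
Proof.
have /choice[p pP] : forall x, exists a, enorm (x - x0) < d -> nearest S x a.
  move=> x; have [xd|xd] := pselect (enorm (x - x0) < d); last by exists 0.
  by have [a] := nearest_ex xd; exists a.
by exists p.
Qed.

(** A limit point of the nearest points of a sequence tending to x realizes the
    distance from x to the closure of S, so it is the nearest point to x. *)
Lemma projection_continuous (p : V -> V) :
  (forall x, enorm (x - x0) < d -> nearest S x (p x)) ->
  forall x, enorm (x - x0) < d -> forall e : R, 0 < e ->
  exists2 eta : R, 0 < eta &
    forall y, enorm (y - x) < eta ->
      enorm (y - x0) < d /\ enorm (p y - p x) < e.
Proof.
move=> pP x xd e e0; apply: contrapT => nE.
have r0 : 0 < d - enorm (x - x0) by rewrite subr_gt0.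
have yd y : enorm (y - x) < d - enorm (x - x0) -> enorm (y - x0) < d.
  by have := enorm_triangle x y x0; lra.
have /choice[y yP] : forall n : nat, exists y,
    [/\ enorm (y - x) < n.+1%:R^-1, enorm (y - x0) < d & e <= enorm (p y - p x)].
  move=> n; apply: contrapT => nn; apply: nE.
  exists (Num.min n.+1%:R^-1 (d - enorm (x - x0))).
    by rewrite lt_min r0 invr_gt0 ltr0n.
  move=> y; rewrite lt_min => /andP[yn /yd yxd]; split=> //.
  by rewrite ltNge; apply/negP => ye; apply: nn; exists y.
have [|a aP] := @bolzano_weierstrass_enorm _ _ (p \o y) (2 + enorm x + enorm (x - p x)).
  move=> n /=; have [yn yxd _] := yP n; have [_ pmin] := pP _ yxd.
  have yn1 : enorm (y n - x) < 1.
    by apply: lt_le_trans yn _; rewrite invf_le1 ?ltr0n // ler1n.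
  have := pmin (p x) (pP _ xd).1.
  have := enorm_triangle x (y n) (p x).
  have := enorm_triangle (y n) (p (y n)) x; rewrite (enormB (p _) (y n)).
  have := enormD (p (y n) - x) x; rewrite subrK; lra.
have aE : a = p x.
  apply: (nearest_uniq xd _ (pP _ xd)); apply: closure_nearest => // [f f0|b Sb].
    have [n _ nf] := aP f f0 0%N; have [_ yxd _] := yP n.
    by exists (p (y n)); [exact: (pP _ yxd).1|].
  apply: le_of_eps => f f0; have f3 : 0 < f / 3 by rewrite divr_gt0.
  have [m mP] := small_inv f3; have [n mn nf] := aP _ f3 m.
  have [yn yxd _] := yP n; have [_ pmin] := pP _ yxd.
  have := enorm_triangle (y n) x a; have := enorm_triangle (p (y n)) (y n) a.
  have := enorm_triangle x (y n) b; have := pmin b Sb.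
  have := lt_trans yn (mP n mn); rewrite (enormB x (y n)); move: nf => /=; lra.
have [n _ nf] := aP e e0 0%N; have [_ _] := yP n.
by rewrite -aE leNgt nf.
Qed.

Section Ray.
Variable p : V -> V.
Hypothesis pP : forall x, enorm (x - x0) < d -> nearest S x (p x).
Let D x := enorm (x - p x).

Lemma distance_lipschitz x y : enorm (x - x0) < d -> enorm (y - x0) < d ->
  `|D x - D y| <= enorm (x - y).
Proof.
move=> xd yd; rewrite ler_norml; apply/andP; split.
  have := (pP yd).2 _ (pP xd).1; have := enorm_triangle x y (p x).
  rewrite (enormB y x) /D; lra.
have := (pP xd).2 _ (pP yd).1; have := enorm_triangle y x (p y); rewrite /D; lra.
Qed.

(** The distance to S grows at unit speed in the direction away from the nearest
    point. Moving x by v, the new distance squared is at least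
    D x ^ 2 + 2 <v, x - p y> + |v| ^ 2, where p y tends to p x by continuity. *)
Lemma distance_slope x (k : R) : enorm (x - x0) < d -> 0 < D x -> 0 < k -> k < 1 ->
  exists2 eta : R, 0 < eta & forall h : R, 0 < h -> h < eta ->
    let y := x + (h / D x) *: (x - p x) in
    enorm (y - x0) < d /\ D x + k * h <= D y.
Proof.
move=> xd; set q := D x => q0 k0 k1.
have e0 : 0 < q * (1 - k) / 2 by rewrite divr_gt0 // mulr_gt0 ?subr_gt0.
have [eta eta0 etaP] := projection_continuous pP xd e0.
exists eta => // h h0 heta.
set v := (h / q) *: (x - p x); move=> y.
have nv : enorm v = h.
  by rewrite /v enormZ gtr0_norm ?divr_gt0 // -/q divfK // gt_eqF.
have [|yd yx] := etaP y; first by rewrite /y addrC addKr nv.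
have [u uE] : exists u, u = x - p x by exists (x - p x).
have uq : enorm u = q by rewrite uE.
have [w wE] : exists w, w = p y - p x by exists (p y - p x).
split=> //; apply: enorm_ge; first by rewrite addr_ge0 ?ltW ?mulr_gt0.
have -> : y - p y = (u - w) + v.
  by rewrite uE wE /y [p y - _]addrC opprD opprK addrA subrK addrAC.
have -> : v = (h / q) *: u by rewrite uE.
have qy : q ^+ 2 <= dot (u - w) (u - w).
  have -> : u - w = x - p y by rewrite uE wE [p y - _]addrC opprD opprK addrA subrK.
  have := (pP xd).2 _ (pP yd).1; rewrite -/(D x) -/q -sqr_enorm => qy.
  by rewrite ler_pXn2r ?nnegrE ?enorm_ge0 // ltW.
have wu : dot w u <= q * (1 - k) / 2 * q.
  apply: le_trans (cauchy_schwarz _ _) _.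
  by rewrite uq ler_wpM2r ?ltW // wE.
have hq0 : 0 < h / q by rewrite divr_gt0.
have hqE : h = h / q * q by rewrite divfK // gt_eqF.
have uu : dot u u = q ^+ 2 by rewrite -uq sqr_enorm.
move: hqE hq0; move: (h / q) => c hE c0.
have : c * dot w u <= c * (q * (1 - k) / 2 * q) by rewrite ler_pM2l.
have k2 : 0 <= 1 - k ^+ 2 by nra.
have k3 : 0 <= 1 - k by rewrite subr_ge0 ltW.
have := mulr_ge0 (sqr_ge0 (c * q)) k2.
have := mulr_ge0 (mulr_ge0 (ltW c0) (sqr_ge0 q)) k3.
have tu : dot (u - w) u = q ^+ 2 - dot w u by rewrite dotDl dotNl uu.
move: (u - w) tu qy => t tu qy.
rewrite hE !(dotDl, dotDr, dotZl, dotZr) [dot u t]dotC tu uu; lra.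
Qed.

(** Maximize D y - k |y - x| on the ball of radius T about x, with k < 1: by the
    slope estimate the maximum is not interior, so the distance D x + k T is
    reached on the sphere. As k tends to 1 a point of the ball at distance
    D x + T appears, and equality in the triangle inequality puts it on the ray
    from p x through x. *)
Lemma ray_extension x (T : R) : 0 < T -> enorm (x - x0) + T < d -> 0 < D x ->
  forall b, S b -> D x + T <= enorm (x + (T / D x) *: (x - p x) - b).
Proof.
move=> T0 xTd; set q := D x => q0.
have xd : enorm (x - x0) < d by lra.
have inB y : enorm (y - x) <= T -> enorm (y - x0) < d.
  by have := enorm_triangle x y x0; lra.
have far k : 0 < k -> k < 1 -> exists2 y, enorm (y - x) <= T & q + k * T <= D y.
  move=> k0 k1.
  have [|y z yT zT|y yT ymax] := @lipschitz_max_ball (fun y => D y - k * enorm (y - x)) x T.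
  - exact: ltW.
  - have := distance_lipschitz (inB y yT) (inB z zT).
    have := enorm_triangle z y x; have := enorm_triangle y z x.
    rewrite (enormB z y) !ler_norml => H1 H2 /andP[H3 H4].
    by apply/andP; split; nra.
  exists y => //; have xT : enorm (x - x) <= T by rewrite subrr enorm0 ltW.
  have := ymax x xT; rewrite subrr enorm0 mulr0 subr0 -/q => qy.
  have [Ty|yT'] := leP T (enorm (y - x)); first by nra.
  exfalso; have Dy0 : 0 < D y.
    by have := mulr_ge0 (ltW k0) (enorm_ge0 (y - x)); lra.
  have [||eta eta0] := @distance_slope y ((1 + k) / 2) (inB y yT) Dy0; try lra.
  pose h := Num.min (eta / 2) (T - enorm (y - x)).
  have h0 : 0 < h by rewrite lt_min divr_gt0 //= subr_gt0.
  have h1 : h < eta by rewrite gt_min; apply/orP; left; lra.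
  have h2 : h <= T - enorm (y - x) by rewrite ge_min lexx orbT.
  case/(_ h h0 h1); set z := y + _ => zd Dz.
  have zy : enorm (z - y) = h.
    rewrite /z addrC addKr enormZ gtr0_norm ?divr_gt0 // -/(D y) divfK // gt_eqF //.
  have zx := enorm_triangle y z x; rewrite zy in zx.
  have /ymax : enorm (z - x) <= T by lra.
  nra.
have [|y z yT zT|y yT ymax] := @lipschitz_max_ball D x T.
- exact: ltW.
- have := distance_lipschitz (inB y yT) (inB z zT); have := enorm_ge0 (y - z); lra.
have {ymax far}qTD : q + T <= D y.
  apply: le_of_eps => e e0.
  (* chosen so that k T is at least T - e *)
  pose k : R := Num.max (2^-1) (1 - e / T).
  have k0 : 0 < k by rewrite lt_max invr_gt0 ltr0n.
  have k1 : k < 1.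
    by rewrite gt_max; apply/andP; split; [lra|rewrite gtrBl divr_gt0].
  have [z zT qz] := far k k0 k1.
  have kT : T - e <= k * T.
    have : 1 - e / T <= k by rewrite le_max lexx orbT.
    rewrite -(ler_pM2r T0) mulrBl divfK ?gt_eqF // mul1r; lra.
  have := ymax z zT; lra.
have qTy : q + T <= enorm (y - p x).
  by apply: le_trans qTD ((pP (inB y yT)).2 _ (pP xd).1).
have [u uE] : exists u, u = x - p x by exists (x - p x).
have [w wE] : exists w, w = y - x by exists (y - x).
have uq : enorm u = q by rewrite uE.
have wT : enorm w <= T by rewrite wE.
have uu : dot u u = q ^+ 2 by rewrite -uq sqr_enorm.
have yE : y = x + (T / q) *: (x - p x).
  rewrite -uE; suff : w - (T / q) *: u = 0.
    by move=> /subr0_eq <-; rewrite wE addrC subrK.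
  have wu : q * T <= dot w u.
    have : (q + T) ^+ 2 <= dot (w + u) (w + u).
      have qT0 : 0 <= q + T by lra.
      by rewrite -sqr_enorm ler_pXn2r ?nnegrE ?enorm_ge0 // wE uE addrA subrK.
    rewrite !dotE [dot u w]dotC uu -(sqr_enorm w).
    have : enorm w ^+ 2 <= T ^+ 2 by rewrite ler_pXn2r ?nnegrE ?enorm_ge0 ?(ltW T0).
    lra.
  apply: dot_le0_eq0; rewrite !dotE [dot u w]dotC uu -(sqr_enorm w).
  have qE : T = T / q * q by rewrite divfK // gt_eqF.
  have c0 : 0 < T / q by rewrite divr_gt0.
  have : enorm w ^+ 2 <= T ^+ 2 by rewrite ler_pXn2r ?nnegrE ?enorm_ge0 ?(ltW T0).
  move: qE c0; move: (T / q) => c qE c0.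
  have : c * (q * T) <= c * dot w u by rewrite ler_pM2l.
  rewrite qE; nra.
by rewrite -yE => b Sb; apply: le_trans qTD ((pP (inB y yT)).2 _ Sb).
Qed.

(** S lies outside the ball of radius D x + T that touches it at the projection
    of x; this is the squared form of [ray_extension]. *)
Lemma normal_inequality x (T : R) b : 0 < T -> enorm (x - x0) + T < d -> S b ->
  2 * (D x + T) * dot (x - p x) (b - p x) <= D x * dot (b - p x) (b - p x).
Proof.
move=> T0 xTd Sb; have [q0|q0] := eqVneq (D x) 0.
  by rewrite q0 mul0r (enorm_eq0 q0) dot0l mulr0.
have qP : 0 < D x by rewrite lt_neqAle eq_sym q0 enorm_ge0.
have := ray_extension T0 xTd qP Sb; set q := D x in qP q0 *.
have [u uE] : exists u, u = x - p x by exists (x - p x).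
have [w wE] : exists w, w = b - p x by exists (b - p x).
have uu : dot u u = q ^+ 2 by rewrite uE -sqr_enorm.
rewrite -uE -wE => H.
have {}H : (q + T) ^+ 2 <= dot ((1 + T / q) *: u - w) ((1 + T / q) *: u - w).
  have qT0 : 0 <= q + T by lra.
  rewrite -sqr_enorm ler_pXn2r ?nnegrE ?enorm_ge0 //.
  suff -> : (1 + T / q) *: u - w = x + (T / q) *: u - b by [].
  rewrite scalerDl scale1r wE; transitivity (u + p x + (T / q) *: u - b).
    by rewrite opprB addrA [u + _ + p x]addrAC.
  by rewrite {1}uE subrK.
move: H; rewrite !dotE [dot w u]dotC uu.
have cE : (1 + T / q) * q = q + T by rewrite mulrDl mul1r divfK.
move: cE; move: (1 + T / q) => c cE.
rewrite -cE; nra.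
Qed.

End Ray.

(** Adding the normal inequalities at x and y, each applied to the projection of
    the other point, bounds |a - b| ^ 2 by a fixed multiple of <x - y, a - b>; the
    prolongation T, uniform near the base point, keeps the multiple finite. *)
Theorem projection_lipschitz_near : 0 < d -> exists2 C : R, 0 < C &
  forall x y a b, enorm (x - x0) < d / 2 -> enorm (y - x0) < d / 2 ->
    nearest S x a -> nearest S y b -> enorm (a - b) <= C * enorm (x - y).
Proof.
move=> d0; have [p pP] := projection_exists.
have x0d : enorm (x0 - x0) < d by rewrite subrr enorm0.
(* Q bounds the distances to S, and T the length of the prolongations *)
pose Q := enorm (x0 - p x0) + d; pose T := d / 2.
have T0 : 0 < T by rewrite divr_gt0.
have Q0 : 0 < Q by rewrite ltr_wpDl ?enorm_ge0.
exists ((Q + T) / T); first by rewrite divr_gt0 // addr_gt0.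
move=> x y a b xd yd xa yb.
have x1 : enorm (x - x0) < d by lra.
have y1 : enorm (y - x0) < d by lra.
rewrite (nearest_uniq x1 xa (pP _ x1)) (nearest_uniq y1 yb (pP _ y1)) {a b xa yb}.
have DQ z : enorm (z - x0) < d -> enorm (z - p z) <= Q.
  by move=> zd; have := (pP _ zd).2 _ (pP _ x0d).1;
     have := enorm_triangle x0 z (p x0); rewrite /Q; lra.
have half z b : enorm (z - x0) < T -> S b ->
    2 * (Q + T) * dot (z - p z) (b - p z) <= Q * dot (b - p z) (b - p z).
  move=> zd Sb; have zTd : enorm (z - x0) + T < d by rewrite /T in zd *; lra.
  have z1 : enorm (z - x0) < d by lra.
  have := normal_inequality pP T0 zTd Sb; have := DQ z z1.
  have := enorm_ge0 (z - p z); have := dot_ge0 (b - p z).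
  move: (enorm _) (dot _ (b - p z)) (dot _ _) => q s n n0 q0 qQ H.
  have {}H : 2 * s * (q + T) <= q * n by lra.
  have : 2 * s * (q + T) * (Q + T) <= Q * n * (q + T).
    apply: (@le_trans _ _ (q * n * (Q + T))).
      by rewrite ler_pM2r // addr_gt0.
    have Qq : 0 <= Q - q by lra.
    have := mulr_ge0 (mulr_ge0 Qq n0) (ltW T0); lra.
  have qT : 0 < q + T by lra.
  by rewrite mulrAC (ler_pM2r qT); lra.
have Sx := (pP _ x1).1; have Sy := (pP _ y1).1.
have := half x _ xd Sy; have := half y _ yd Sx.
have [u uE] : exists u, u = x - y by exists (x - y).
have [w wE] : exists w, w = p x - p y by exists (p x - p y).
have -> : p y - p x = - w by rewrite wE opprB.
rewrite -wE -uE.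
have -> : x - p x = u + (y - p y) - w.
  by rewrite uE wE opprB !addrA !subrK.
rewrite !dotE => H1 H2.
have {H1 H2}H : 2 * (Q + T) * (dot w w - dot u w) <= 2 * Q * dot w w by nra.
have H2 : T * dot w w <= (Q + T) * dot u w by nra.
have [w0|w0] := eqVneq (enorm w) 0.
  by rewrite w0 mulr_ge0 ?enorm_ge0 // ltW // divr_gt0 // addr_gt0.
have wP : 0 < enorm w by rewrite lt_neqAle eq_sym w0 enorm_ge0.
rewrite mulrAC ler_pdivlMr // -(ler_pM2r wP).
have := cauchy_schwarz u w; rewrite -sqr_enorm in H2.
have : 0 < Q + T by rewrite addr_gt0.
nra.
Qed.

End MetricProjection.

(** * Coefficient vectors of polynomials *)

Section Modulus.
Variable R : realType.
Notation C := R[i].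
Implicit Types z w : C.

Lemma normr_cmod z : `|z| = (cmod z)%:C%C. Proof. by []. Qed.

Lemma cmod_ge0 z : 0 <= cmod z.
Proof. by case: z => a b; exact: sqrtr_ge0. Qed.

Lemma cmodM z w : cmod (z * w) = cmod z * cmod w.
Proof. exact: ComplexField.Normc.normcM. Qed.

Lemma cmod0 : cmod (0 : C) = 0.
Proof. exact: ComplexField.Normc.normc0. Qed.

Lemma cmod1 : cmod (1 : C) = 1.
Proof. exact: ComplexField.Normc.normc1. Qed.

Lemma cmodV z : cmod z^-1 = (cmod z)^-1.
Proof. exact: ComplexField.Normc.normcV. Qed.

Lemma cmod_eq0 z : (cmod z == 0) = (z == 0).
Proof.
apply/eqP/eqP => [|->]; last exact: cmod0.
exact: ComplexField.Normc.eq0_normc.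
Qed.

Lemma cmod_gt0 z : (0 < cmod z) = (z != 0).
Proof. by rewrite lt_neqAle cmod_ge0 andbT eq_sym cmod_eq0. Qed.

Lemma cmodD z w : cmod (z + w) <= cmod z + cmod w.
Proof. exact: le_normcD. Qed.

Lemma cmodN z : cmod (- z) = cmod z.
Proof. exact: normcN. Qed.

Lemma cmodB z w : cmod (z - w) = cmod (w - z).
Proof. by rewrite -cmodN opprB. Qed.

Lemma sqr_cmod z : cmod z ^+ 2 = complex.Re z ^+ 2 + complex.Im z ^+ 2.
Proof. by case: z => a b; rewrite sqr_sqrtr // addr_ge0 ?sqr_ge0. Qed.

Lemma cmod_real (t : R) : cmod t%:C%C = `|t|.
Proof. by rewrite /cmod /= expr0n addr0 sqrtr_sqr. Qed.

Lemma cmod_triangle (x z w : C) : cmod (z - w) <= cmod (z - x) + cmod (x - w).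
Proof. by have := cmodD (z - x) (x - w); rewrite addrA subrK. Qed.

Lemma cmod_conj z : cmod z^* = cmod z.
Proof.
case: z => a b; have -> : (a +i* b)%C^* = (a -i* b)%C by [].
by rewrite /cmod /= sqrrN.
Qed.

End Modulus.

Section RealCoordinates.
Variables (R : realType) (D : nat).
Notation C := R[i].
Implicit Types v w : 'rV[C]_D.

(** Real coordinates, so that the real Euclidean geometry above applies. *)
Definition rvec v : 'rV[R]_(D + D) :=
  row_mx (map_mx (@complex.Re R) v) (map_mx (@complex.Im R) v).

Definition cvec (u : 'rV[R]_(D + D)) : 'rV[C]_D :=
  \row_i (u 0 (lshift D i) +i* u 0 (rshift D i))%C.

Lemma rvecK : cancel rvec cvec.
Proof.
move=> v; apply/rowP => i; rewrite mxE row_mxEl row_mxEr !mxE.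
by case: (v 0 i).
Qed.

Lemma cvecK : cancel cvec rvec.
Proof.
by move=> u; apply/rowP => i; rewrite mxE; case: splitP => j ij; rewrite !mxE /=;
  congr (u 0 _); apply: val_inj; rewrite /= ij.
Qed.

Lemma rvecB v w : rvec (v - w) = rvec v - rvec w.
Proof.
rewrite /rvec opp_row_mx add_row_mx; congr row_mx; apply/rowP => i; rewrite !mxE;
  by case: (v 0 i) (w 0 i) => [? ?] [? ?].
Qed.

Lemma vnormE v : vnorm v = Num.sqrt (\sum_i cmod (v 0 i) ^+ 2).
Proof. by rewrite /vnorm big_ord1. Qed.

Lemma enorm_rvec v : enorm (rvec v) = vnorm v.
Proof.
rewrite vnormE /enorm /dot big_split_ord /= -big_split /=; congr Num.sqrt.
by apply: eq_bigr => i _; rewrite row_mxEl row_mxEr !mxE sqr_cmod.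
Qed.

End RealCoordinates.

Section PolynomialNorm.
Variables (R : realType) (l : nat).
Notation C := R[i].
Notation T := (cpoly R l).
Implicit Types (p q : T) (n mu : multinom l).

Lemma PspaceP n p : Pspace n p <->
  forall mu, mu \in msupp p -> forall i, (mu i <= n i)%N.
Proof.
have pdegE i : pdeg p i = (\max_(mu <- msupp p) mu i)%N by rewrite mnmE.
split=> [pn mu mup i|pn i].
  by apply: leq_trans (pn i); rewrite pdegE; exact: (leq_bigmax_seq (F := fun m : multinom l => m i) mu mup).
by rewrite pdegE; apply/bigmax_leqP_seq => mu mup _; exact: pn.
Qed.

Lemma Pspace_coef n p mu i : Pspace n p -> (n i < mu i)%N -> mcoeff mu p = 0.
Proof.
move=> /PspaceP pn nmu; apply: memN_msupp_eq0; apply: contraL nmu => /pn/(_ i).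
by rewrite -leqNgt.
Qed.

Lemma PspaceC n p : (forall mu i, (n i < mu i)%N -> mcoeff mu p = 0) -> Pspace n p.
Proof.
move=> h; apply/PspaceP => mu mup i; rewrite leqNgt; apply: contraL mup => /h.
by rewrite mcoeff_msupp => ->; rewrite eqxx.
Qed.

Lemma Pspace0 n : Pspace n (0 : T).
Proof. by apply: PspaceC => mu i _; rewrite mcoeff0. Qed.

Lemma PspaceD n p q : Pspace n p -> Pspace n q -> Pspace n (p + q).
Proof.
by move=> pn qn; apply: PspaceC => mu i imu; rewrite mcoeffD !(@Pspace_coef n _ mu i) ?addr0.
Qed.

Lemma PspaceZ n c p : Pspace n p -> Pspace n (c *: p).
Proof.
by move=> pn; apply: PspaceC => mu i imu; rewrite mcoeffZ (@Pspace_coef n _ mu i) ?mulr0.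
Qed.

Lemma PspaceN n p : Pspace n p -> Pspace n (- p).
Proof. by rewrite -scaleN1r; exact: PspaceZ. Qed.

Lemma PspaceB n p q : Pspace n p -> Pspace n q -> Pspace n (p - q).
Proof. by move=> pn /PspaceN; exact: PspaceD. Qed.

Lemma PspaceM n (m k : multinom l) p q : (forall i, k i = n i + m i)%N ->
  Pspace n p -> Pspace m q -> Pspace k (p * q).
Proof.
move=> kE /PspaceP pn /PspaceP qm; apply/PspaceP => mu.
move/msuppM_le/allpairsP => [[a b] /= [ap bq ->]] i.
by rewrite kE mnmDE leq_add ?pn ?qm.
Qed.

Lemma Pspace1 n : Pspace n (1 : T).
Proof.
apply/PspaceP => mu; rewrite msupp1 inE => /eqP -> i.
by rewrite mnm0E.
Qed.

Lemma Pexact_Pspace n p : Pexact n p -> Pspace n p.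
Proof. by case=> _ <- i. Qed.

Lemma Pspace_expr n e p : Pspace n p -> Pspace (mnm_muln n e) (p ^+ e).
Proof.
move=> pn; elim: e => [|e IHe]; first by rewrite expr0; exact: Pspace1.
by rewrite exprS; apply: (PspaceM _ pn IHe) => i; rewrite !mulmnE mulnS.
Qed.

Lemma Pspace_prod (I : finType) (P : pred I) (k : I -> nat) (m : I -> multinom l)
    n (ps : I -> T) :
  (forall i, n i = \sum_(j | P j) k j * m j i)%N -> (forall j, Pspace (m j) (ps j)) ->
  Pspace n (\prod_(j | P j) ps j ^+ k j).
Proof.
move=> nE pm.
pose N (r : seq I) : multinom l := Multinom [tuple (\sum_(j <- r | P j) k j * m j i)%N | i < l].
have -> : n = N (index_enum I) by apply/mnmP => i; rewrite mnmE nE.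
elim: (index_enum I) => [|j r IHr]; first by rewrite big_nil; exact: Pspace1.
rewrite big_cons; case: ifP => Pj; last first.
  suff -> : N (j :: r) = N r by [].
  by apply/mnmP => i; rewrite !mnmE big_cons Pj.
apply: (PspaceM _ (Pspace_expr (k j) (pm j)) IHr) => i.
by rewrite mulmnE !mnmE big_cons Pj mulnC.
Qed.

Lemma Pspace_sum (I : Type) (r : seq I) (P : pred I) n (ps : I -> T) :
  (forall j, P j -> Pspace n (ps j)) -> Pspace n (\sum_(j <- r | P j) ps j).
Proof. by move=> h; apply: big_ind => //; [exact: Pspace0|exact: PspaceD]. Qed.

Lemma PspaceMn n e p : Pspace n p -> Pspace n (p *+ e).
Proof. by rewrite -scaler_nat; exact: PspaceZ. Qed.

Lemma mexp_inj n : injective (@mexp l n).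
Proof.
move=> a b /mnmP ab; apply/ffunP => i; apply: val_inj.
by have := ab i; rewrite !mnmE.
Qed.

Lemma mexp_surj n (mu : multinom l) : (forall i, mu i <= n i)%N ->
  exists a : 'I_(dimP n), mexp (enum_val a) = mu.
Proof.
move=> mun; pose a : mindex n := [ffun i => inord (mu i)].
exists (enum_rank a); rewrite enum_rankK; apply/mnmP => i.
by rewrite mnmE ffunE inordK // ltnS mun.
Qed.

Lemma mexp_leq n (a : mindex n) i : (mexp a i <= n i)%N.
Proof. by rewrite mnmE -ltnS. Qed.

(** Sums over the support, as in the definitions of the norm and of the dot
    product, are sums over the monomial basis of any space containing p. *)
Lemma big_msupp (A : nmodType) (F : multinom l -> A) n p : Pspace n p ->
  (forall mu, mu \notin msupp p -> F mu = 0) ->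
  \sum_(mu <- msupp p) F mu = \sum_(a < dimP n) F (mexp (enum_val a)).
Proof.
move=> pn F0; pose s := [seq mexp (enum_val a) | a : 'I_(dimP n)].
have us : uniq s.
  by rewrite map_inj_uniq ?enum_uniq // => a b /mexp_inj/enum_val_inj.
transitivity (\sum_(mu <- s) F mu); last by rewrite big_map big_enum.
rewrite [RHS](bigID (mem (msupp p))) /= [X in _ + X]big1 ?addr0 //.
rewrite -[RHS]big_filter; apply: perm_big; apply: uniq_perm.
- exact: msupp_uniq.
- exact: filter_uniq.
- move=> mu; rewrite mem_filter andb_idr // => mup.
  have [a <-] := mexp_surj ((PspaceP n p).1 pn mu mup).
  by rewrite /s; apply/mapP; exists a; rewrite ?mem_enum.
Qed.

Lemma pnorm_coefv n p : Pspace n p -> pnorm p = vnorm (coefv n p).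
Proof.
move=> pn; rewrite vnormE /pnorm; congr Num.sqrt.
under [RHS]eq_bigr do rewrite mxE.
by apply: big_msupp => // mu /memN_msupp_eq0 ->; rewrite cmod0 expr0n.
Qed.

Lemma pdot_coefv n p q : Pspace n p -> pdot p q = vdot (coefv n p) (coefv n q).
Proof.
move=> pn; rewrite /vdot; under [RHS]eq_bigr do rewrite !mxE.
apply: (big_msupp (F := fun mu => (mcoeff mu p)^* * mcoeff mu q)) => // mu.
by move/memN_msupp_eq0 ->; rewrite rmorph0 mul0r.
Qed.

Lemma coefvB n p q : coefv n (p - q) = coefv n p - coefv n q.
Proof. by apply/rowP => a; rewrite !mxE mcoeffB. Qed.

Lemma coefvD n p q : coefv n (p + q) = coefv n p + coefv n q.
Proof. by apply/rowP => a; rewrite !mxE mcoeffD. Qed.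

Lemma coefvZ n c p : coefv n (c *: p) = c *: coefv n p.
Proof. by apply/rowP => a; rewrite !mxE mcoeffZ. Qed.

Lemma coefv_polyv n (v : 'rV[C]_(dimP n)) : coefv n (polyv v) = v.
Proof.
apply/rowP => a; rewrite mxE /polyv raddf_sum /= (bigD1 a) //=.
rewrite mcoeffZ mcoeffX eqxx mulr1 big1 ?addr0 // => b ba.
rewrite mcoeffZ mcoeffX (_ : (_ == _) = false) ?mulr0 //.
by apply: contra_neqF ba => /eqP/mexp_inj/enum_val_inj.
Qed.

Lemma coefv_inj n p q : Pspace n p -> Pspace n q -> coefv n p = coefv n q -> p = q.
Proof.
move=> pn qn pq; apply/mpolyP => mu.
have [mun|/existsNP[i /negP]] := pselect (forall i, mu i <= n i)%N.
  have [a <-] := mexp_surj mun; move/rowP/(_ a): pq; by rewrite !mxE.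
by rewrite -ltnNge => mui; rewrite !(@Pspace_coef n _ mu i).
Qed.

Lemma polyv_Pspace n (v : 'rV[C]_(dimP n)) : Pspace n (polyv v).
Proof.
apply: PspaceC => mu i imu; rewrite /polyv raddf_sum /= big1 // => a _.
rewrite mcoeffZ mcoeffX; case: eqP => [am|_]; last by rewrite mulr0.
by move: imu; rewrite -am ltnNge mexp_leq.
Qed.

Lemma polyv_coefv n p : Pspace n p -> polyv (coefv n p) = p.
Proof.
by move=> pn; apply: (coefv_inj (polyv_Pspace _) pn); rewrite coefv_polyv.
Qed.

Definition pvec n p := rvec (coefv n p).

Lemma pvecB n p q : pvec n (p - q) = pvec n p - pvec n q.
Proof. by rewrite /pvec coefvB rvecB. Qed.

Lemma pvecD n (p q : T) : pvec n (p + q) = pvec n p + pvec n q.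
Proof.
rewrite /pvec coefvD /rvec add_row_mx; congr row_mx; apply/rowP => a;
  by rewrite !mxE; case: (mcoeff _ p) (mcoeff _ q) => [? ?] [? ?].
Qed.

Lemma pvecZ n (t : R) (p : T) : pvec n (t%:C%C *: p) = t *: pvec n p.
Proof.
rewrite /pvec coefvZ /rvec scale_row_mx; congr row_mx; apply/rowP => a;
  rewrite !mxE; case: (mcoeff _ _) => x y /=; ring.
Qed.

Lemma enorm_pvec n p : Pspace n p -> enorm (pvec n p) = pnorm p.
Proof. by move=> pn; rewrite enorm_rvec (pnorm_coefv pn). Qed.

Lemma pvec_surj n u : exists2 p, Pspace n p & pvec n p = u.
Proof.
exists (polyv (cvec u)); first exact: polyv_Pspace.
by rewrite /pvec coefv_polyv cvecK.
Qed.

Lemma pvec_inj n p q : Pspace n p -> Pspace n q -> pvec n p = pvec n q -> p = q.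
Proof. by move=> pn qn /(can_inj (@rvecK _ _))/coefv_inj; apply. Qed.

Lemma Pspace_common p q : exists n, Pspace n p /\ Pspace n q.
Proof.
exists (mnm_add (pdeg p) (pdeg q)); split=> i; rewrite mnmDE; [exact: leq_addr|exact: leq_addl].
Qed.

Lemma pnorm_ge0 p : 0 <= pnorm p. Proof. exact: sqrtr_ge0. Qed.

Lemma pnorm_dist_triangle (r p q : T) : pnorm (p - q) <= pnorm (p - r) + pnorm (r - q).
Proof.
have [n [pn qn]] := Pspace_common p q.
have [m [nm rm]] : exists m : multinom l, (forall i, n i <= m i)%N /\ Pspace m r.
  exists (mnm_add n (pdeg r)); split=> i; rewrite mnmDE; [exact: leq_addr|exact: leq_addl].
have pm : Pspace m p by move=> i; exact: leq_trans (nm i).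
have qm : Pspace m q by move=> i; exact: leq_trans (nm i).
rewrite -!(@enorm_pvec m); try exact: PspaceB.
by rewrite !pvecB enorm_triangle.
Qed.

Lemma pnorm_coef mu p : cmod (mcoeff mu p) <= pnorm p.
Proof.
have [mup|mup] := boolP (mu \in msupp p); last first.
  by rewrite memN_msupp_eq0 // cmod0 pnorm_ge0.
rewrite -(@ler_pXn2r _ 2) ?nnegrE ?cmod_ge0 ?pnorm_ge0 //.
rewrite sqr_sqrtr; last by apply: sumr_ge0 => i _; exact: sqr_ge0.
rewrite (bigD1_seq mu) ?msupp_uniq //= lerDl sumr_ge0 // => i _.
exact: sqr_ge0.
Qed.

Lemma pnorm0 : pnorm (0 : T) = 0.
Proof. by rewrite /pnorm msupp0 big_nil sqrtr0. Qed.

Lemma pnorm_eq0 p : (pnorm p == 0) = (p == 0).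
Proof.
apply/eqP/eqP => [p0|->]; last exact: pnorm0.
apply/mpolyP => mu; rewrite mcoeff0; apply/eqP; rewrite -cmod_eq0.
by apply/eqP/le_anti; rewrite cmod_ge0 -p0 pnorm_coef.
Qed.

Lemma pnorm_gt0 p : (0 < pnorm p) = (p != 0).
Proof. by rewrite lt_neqAle pnorm_ge0 andbT eq_sym pnorm_eq0. Qed.

Lemma pnormZ c p : pnorm (c *: p) = cmod c * pnorm p.
Proof.
have pn : Pspace (pdeg p) p by [].
rewrite (pnorm_coefv pn) (pnorm_coefv (PspaceZ c pn)) !vnormE.
rewrite -(ger0_norm (cmod_ge0 c)) -sqrtr_sqr -sqrtrM ?sqr_ge0 // mulr_sumr.
by congr Num.sqrt; apply: eq_bigr => i _; rewrite !mxE mcoeffZ cmodM exprMn.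
Qed.

Lemma pnormB p q : pnorm (p - q) = pnorm (q - p).
Proof. by rewrite -[p - q]opprB -scaleN1r pnormZ cmodN cmod1 mul1r. Qed.

Lemma pnormD p q : pnorm (p + q) <= pnorm p + pnorm q.
Proof. by have := pnorm_dist_triangle 0 p (- q); rewrite opprK subr0 add0r. Qed.

End PolynomialNorm.

(** * Complex vectors and pseudo-inverses of injective matrices *)

Section PseudoInverse.
Variable R : realType.
Notation C := R[i].

Lemma adjointM p q r (A : 'M[C]_(p, q)) (B : 'M[C]_(q, r)) :
  (A *m B) ^t* = B ^t* *m A ^t*.
Proof. by rewrite trmx_mul map_mxM. Qed.

Lemma adjoint_eq0 q (y : 'cV[C]_q) : y ^t* *m y = 0 -> y = 0.
Proof.
move=> /matrixP/(_ 0 0); rewrite !mxE => /eqP.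
rewrite psumr_eq0 => [/allP y0|i _]; last by rewrite !mxE -normCKC exprn_ge0.
apply/colP => i; rewrite mxE; apply/eqP.
have := y0 i (mem_index_enum i).
by rewrite !mxE /= -normCKC expf_eq0 normr_eq0.
Qed.

(** For an injective A the matrix (A^* A)^-1 A^* satisfies the Penrose conditions,
    so [mp_pinv A] satisfies them too; the first one, A X A = A, then gives
    X A = 1. *)
Lemma mp_pinv_injective p q (A : 'M[C]_(p, q)) :
  (forall x : 'cV[C]_q, A *m x = 0 -> x = 0) -> mp_pinv A *m A = 1%:M.
Proof.
move=> A_inj; pose G := A ^t* *m A.
have G_unit : G \in unitmx.
  rewrite -unitmx_tr -row_free_unit -kermx_eq0; apply/rowV0P => v /sub_kermxP vG.
  apply: trmx_inj; rewrite trmx0; apply/A_inj/adjoint_eq0.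
  by rewrite adjointM mulmxA -(mulmxA (_ ^t*)) -/G -mulmxA -[G]trmxK -trmx_mul vG trmx0 mulmx0.
have GH : G ^t* = G by rewrite adjointM trmxCK.
pose X := invmx G *m A ^t*.
have XA : X *m A = 1%:M by rewrite -mulmxA mulVmx.
have XP : is_mp_pinv A X.
  split.
  - by rewrite -mulmxA XA mulmx1.
  - by rewrite XA mul1mx.
  - by rewrite mulmxA 2!adjointM trmxCK trmx_inv map_invmx GH mulmxA.
  - by rewrite XA trmx1 map_mx1.
have [AYA _ _ _] : is_mp_pinv A (mp_pinv A).
  by apply: (@xgetPex _ 0 [set X | is_mp_pinv A X]); exists X.
by rewrite -[LHS]mul1mx -XA -mulmxA [A *m _]mulmxA AYA.
Qed.

Lemma opnorm2_lower p q (A : 'M[C]_(p, q)) (x : 'cV[C]_q) : x != 0 ->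
  ((vnorm (A *m x) / vnorm x)%:E <= opnorm2 A)%E.
Proof.
move=> x0; have vnormZ m n (B : 'M[C]_(m, n)) (t : R) : 0 <= t ->
    vnorm (t%:C%C *: B) = t * vnorm B.
  move=> t0; rewrite /vnorm -{2}(ger0_norm t0) -sqrtr_sqr -sqrtrM ?sqr_ge0 // mulr_sumr.
  congr Num.sqrt; apply: eq_bigr => i _; rewrite mulr_sumr; apply: eq_bigr => j _.
  by rewrite mxE cmodM cmod_real exprMn real_normK ?num_real.
have xP : 0 < vnorm x.
  rewrite lt_neqAle sqrtr_ge0 andbT eq_sym; apply: contra x0 => /eqP xE.
  apply/eqP/colP => i; rewrite mxE; apply/eqP; rewrite -cmod_eq0 -sqrf_eq0.
  have S0 (k : 'I_q) : 0 <= \sum_(j < 1) cmod (x k j) ^+ 2.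
    by apply: sumr_ge0 => j _; exact: sqr_ge0.
  have /eqP : \sum_i \sum_(j < 1) cmod (x i j) ^+ 2 = 0.
    apply/le_anti; rewrite sumr_ge0 // andbT -sqrtr_eq0; exact/eqP.
  rewrite psumr_eq0 // => /allP/(_ i (mem_index_enum i)).
  by rewrite /= big_ord1.
apply: ereal_sup_ubound; exists ((vnorm x)^-1%:C%C *: x) => /=.
  by rewrite vnormZ ?invr_ge0 ?(ltW xP) // mulVf // gt_eqF.
by rewrite -scalemxAr vnormZ ?invr_ge0 ?(ltW xP) // mulrC.
Qed.

(** The sum of the moduli of the entries is an upper bound. *)
Lemma opnorm2_lt_pinfty p q (A : 'M[C]_(p, q)) : (opnorm2 A < +oo)%E.
Proof.
pose B := \sum_i \sum_j cmod (A i j).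
apply: (@le_lt_trans _ _ B%:E); last exact: ltry.
apply: ge_ereal_sup => _ [x /= x1 <-]; rewrite lee_fin.
have B0 : 0 <= B by apply: sumr_ge0 => i _; apply: sumr_ge0 => j _; exact: cmod_ge0.
have xi i : cmod (x i 0) <= 1.
  apply: le_trans x1; rewrite -[leLHS]ger0_norm ?cmod_ge0 // -sqrtr_sqr.
  apply: ler_wsqrtr; rewrite (bigD1 i) //= big_ord1 lerDl sumr_ge0 // => j _.
  by rewrite sumr_ge0 // => k _; exact: sqr_ge0.
rewrite -(@ler_pXn2r _ 2) ?nnegrE ?sqrtr_ge0 // sqr_sqrtr; last first.
  by rewrite sumr_ge0 // => i _; rewrite sumr_ge0 // => j _; exact: sqr_ge0.
have sumsq (s : seq 'I_p) (F : 'I_p -> R) : (forall i, 0 <= F i) ->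
    \sum_(i <- s) F i ^+ 2 <= (\sum_(i <- s) F i) ^+ 2.
  move=> F0; elim: s => [|i s IHs]; first by rewrite !big_nil expr0n.
  rewrite !big_cons; have := F0 i; have : 0 <= \sum_(j <- s) F j by rewrite sumr_ge0.
  nra.
have Ci i : cmod ((A *m x) i 0) <= \sum_j cmod (A i j).
  rewrite mxE; elim/big_ind2 : _ => [|z a w b za wb|j _]; first by rewrite cmod0.
    exact: le_trans (cmodD _ _) (lerD za wb).
  by rewrite cmodM ler_piMr ?cmod_ge0.
under eq_bigr do rewrite big_ord1.
apply: le_trans (sumsq _ _ _) _; first by move=> i; exact: cmod_ge0.
rewrite ler_pXn2r ?nnegrE //; first by apply: ler_sum => i _; exact: Ci.
by apply: sumr_ge0 => i _; exact: cmod_ge0.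
Qed.

End PseudoInverse.

Section HermitianProduct.
Variables (R : realType) (n : nat).
Notation C := R[i].
Implicit Types u v w : 'rV[C]_n.

Lemma vdotDr u v w : vdot u (v + w) = vdot u v + vdot u w.
Proof. by rewrite /vdot -big_split; apply: eq_bigr => i _; rewrite mxE mulrDr. Qed.

Lemma vdotZr u v c : vdot u (c *: v) = c * vdot u v.
Proof. by rewrite /vdot mulr_sumr; apply: eq_bigr => i _; rewrite mxE mulrCA. Qed.

Lemma vdotB u v w : vdot u (v - w) = vdot u v - vdot u w.
Proof. by rewrite /vdot -sumrB; apply: eq_bigr => i _; rewrite !mxE mulrBr. Qed.

Lemma vdotC u v : vdot v u = (vdot u v)^*.
Proof.
rewrite /vdot rmorph_sum /=; apply: eq_bigr => i _.
by rewrite rmorphM /= conjCK mulrC.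
Qed.

Lemma vdot_vnorm u : vdot u u = (vnorm u ^+ 2)%:C%C.
Proof.
rewrite vnormE sqr_sqrtr; last by apply: sumr_ge0 => i _; exact: sqr_ge0.
rewrite rmorph_sum /=; apply: eq_bigr => i _.
by rewrite rmorphXn /= -normr_cmod normCKC.
Qed.

(** Pythagoras: the difference of the two vectors is orthogonal to the residue of
    the projection onto the line of v. *)
Lemma vnorm_projection u v c : vnorm v = 1 ->
  vnorm (u - vdot v u *: v) <= vnorm (u - c *: v).
Proof.
move=> v1; have [w wE] : exists w, w = u - vdot v u *: v by eexists.
have [d dE] : exists d, d = vdot v u - c by eexists.
have vw : vdot v w = 0.
  by rewrite wE vdotDr -scaleNr vdotZr vdot_vnorm v1 expr1n mulr1 subrr.
have wv : vdot w v = 0 by rewrite vdotC vw rmorph0.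
rewrite -wE; have -> : u - c *: v = w + d *: v by rewrite wE dE scalerBl addrA subrK.
suff E : vnorm (w + d *: v) ^+ 2 = vnorm w ^+ 2 + cmod d ^+ 2.
  by rewrite -(@ler_pXn2r _ 2) ?nnegrE ?sqrtr_ge0 // E lerDl sqr_ge0.
apply: complexI; rewrite -vdot_vnorm rmorphD /= -vdot_vnorm vdotDr vdotZr.
rewrite (vdotC w (w + _)) (vdotC v (w + _)) !vdotDr !vdotZr vw wv (vdot_vnorm v) v1.
rewrite expr1n mulr1 !mulr0 addr0 add0r -(vdotC w w) -normCK normr_cmod.
by rewrite rmorphXn.
Qed.

End HermitianProduct.

Section MatrixNorm.
Variable K : numFieldType.

Lemma coord_le_mx_norm m n (x : 'M[K]_(m, n)) i j : `|x i j| <= `|x|.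
Proof.
rewrite [leRHS]/Num.Def.normr /= mx_normE.
have -> : `|x i j| = ((`|x i j|)%:nng)%:num by [].
by rewrite num_le; exact: (le_bigmax _ (fun ij => `|x ij.1 ij.2|%:nng) (i, j)).
Qed.

(** The norm of matrices is a maximum taken in a type of nonnegative elements, so
    it is 0 when there are no entries. *)
Lemma mx_norm_attained m n (x : 'M[K]_(m, n)) :
  `|x| = 0 \/ exists i j, `|x| = `|x i j|.
Proof.
have [x0|x0] := eqVneq `|x| 0; first by left.
by right; have [[i j] /= xE] := mx_norm_neq0 x0; exists i, j.
Qed.

End MatrixNorm.

Section ComplexRows.
Variables (R : realType).
Notation C := R[i].

Lemma vnorm_ge0 m n (A : 'M[C]_(m, n)) : 0 <= vnorm A.
Proof. exact: sqrtr_ge0. Qed.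

Lemma vnorm_triangle n (u v w : 'rV[C]_n) : vnorm (u - v) <= vnorm (u - w) + vnorm (w - v).
Proof. by rewrite -!enorm_rvec !rvecB enorm_triangle. Qed.

Lemma vnorm0 m n : vnorm (0 : 'M[C]_(m, n)) = 0.
Proof.
rewrite /vnorm big1 ?sqrtr0 // => i _; rewrite big1 // => j _.
by rewrite mxE cmod0 expr0n.
Qed.

Lemma vnormN n (u : 'rV[C]_n) : vnorm (- u) = vnorm u.
Proof. by rewrite !vnormE; congr Num.sqrt; apply: eq_bigr => i _; rewrite mxE cmodN. Qed.

Lemma vnormD n (u v : 'rV[C]_n) : vnorm (u + v) <= vnorm u + vnorm v.
Proof. by have := vnorm_triangle u (- v) 0; rewrite opprK subr0 add0r. Qed.

Lemma cmod_le_vnorm n (u : 'rV[C]_n) i : cmod (u 0 i) <= vnorm u.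
Proof.
rewrite -[leLHS]ger0_norm ?cmod_ge0 // -sqrtr_sqr vnormE; apply: ler_wsqrtr.
by rewrite (bigD1 i) //= lerDl sumr_ge0 // => k _; exact: sqr_ge0.
Qed.

Lemma vnorm_le_coord n (u : 'rV[C]_n) (e : R) : 0 <= e ->
  (forall i, cmod (u 0 i) <= e) -> vnorm u <= n%:R * e.
Proof.
move=> e0 ue; rewrite -(@ler_pXn2r _ 2) ?nnegrE ?vnorm_ge0 ?mulr_ge0 //.
rewrite vnormE sqr_sqrtr; last by rewrite sumr_ge0 // => i _; exact: sqr_ge0.
have : \sum_i cmod (u 0 i) ^+ 2 <= \sum_(i < n) e ^+ 2.
  by apply: ler_sum => i _; rewrite ler_pXn2r ?nnegrE ?cmod_ge0.
rewrite sumr_const card_ord => /le_trans; apply.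
rewrite -[_ *+ n]mulr_natl exprMn ler_wpM2r ?sqr_ge0 // -natrX ler_nat.
by case: (n) => // k; rewrite leq_pmulr.
Qed.

Lemma vnorm_tr m n (A : 'M[C]_(m, n)) : vnorm A^T = vnorm A.
Proof.
rewrite /vnorm exchange_big /=; congr Num.sqrt.
by apply: eq_bigr => i _; apply: eq_bigr => j _; rewrite mxE.
Qed.

Lemma vnorm_eq0 m n (A : 'M[C]_(m, n)) : vnorm A = 0 -> A = 0.
Proof.
move/eqP; rewrite sqrtr_eq0 => A0; apply/matrixP => i j; rewrite mxE.
have S0 k : 0 <= \sum_j cmod (A k j) ^+ 2 by rewrite sumr_ge0 // => t _; exact: sqr_ge0.
have /eqP : \sum_i \sum_j cmod (A i j) ^+ 2 = 0.
  by apply/le_anti; rewrite A0 sumr_ge0.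
rewrite psumr_eq0 // => /allP/(_ i (mem_index_enum i))/=.
rewrite psumr_eq0 => [/allP/(_ j (mem_index_enum j))|t _]; last exact: sqr_ge0.
by rewrite /= sqrf_eq0 cmod_eq0 => /eqP.
Qed.

Lemma mulmx_bounded p q (A : 'M[C]_(p, q)) : exists2 B : R, 0 < B &
  forall x : 'cV[C]_q, vnorm (A *m x) <= B * vnorm x.
Proof.
have := opnorm2_lt_pinfty A; have := @opnorm2_lower _ p q A.
case: (opnorm2 A) => [B||] // BP _.
  exists (Num.max B 1); first by rewrite lt_max ltr01 orbT.
  move=> x; have [->|x0] := eqVneq x 0.
    by rewrite mulmx0 !vnorm0 mulr0.
  have xP : 0 < vnorm x.
    by rewrite lt_neqAle vnorm_ge0 andbT eq_sym; apply: contra x0 => /eqP/vnorm_eq0 ->.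
  rewrite -ler_pdivrMr // le_max; apply/orP; left.
  by have := BP x x0; rewrite lee_fin.
exists 1 => // x; have [->|x0] := eqVneq x 0.
  by rewrite mulmx0 !vnorm0 mulr0.
by have := BP x x0.
Qed.

Lemma mx_norm_vnorm n (h : 'rV[(R[i] : numFieldType)]_n) :
  `|h| <= (vnorm h)%:C%C.
Proof.
have [->|[i [j ->]]] := mx_norm_attained h; first by rewrite ler0c vnorm_ge0.
by rewrite ord1 normr_cmod lecR cmod_le_vnorm.
Qed.

Lemma bolzano_weierstrass_vnorm n (y : nat -> 'rV[C]_n) (B : R) :
  (forall k, vnorm (y k) <= B) ->
  exists x, forall e : R, 0 < e -> forall m, exists2 k, (m <= k)%N & vnorm (y k - x) < e.
Proof.
move=> yB; have [|x xP] := @bolzano_weierstrass_enorm _ _ (fun k => rvec (y k)) B.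
  by move=> k; rewrite enorm_rvec.
exists (cvec x) => e e0 m; have [k mk kx] := xP e e0 m.
by exists k => //; rewrite -enorm_rvec rvecB cvecK.
Qed.

Lemma vnorm_row_mx m n (u : 'rV[C]_m) (v : 'rV[C]_n) :
  vnorm (row_mx u v) ^+ 2 = vnorm u ^+ 2 + vnorm v ^+ 2.
Proof.
rewrite !vnormE !sqr_sqrtr; try by apply: sumr_ge0 => i _; exact: sqr_ge0.
by rewrite big_split_ord /=; congr (_ + _); apply: eq_bigr => i _;
  rewrite ?row_mxEl ?row_mxEr.
Qed.

Lemma vnorm_lsub m n (u : 'rV[C]_m) (v : 'rV[C]_n) : vnorm u <= vnorm (row_mx u v).
Proof.
rewrite -(@ler_pXn2r _ 2) ?nnegrE ?vnorm_ge0 // vnorm_row_mx lerDl.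
exact: sqr_ge0.
Qed.

Lemma vnorm_rsub m n (u : 'rV[C]_m) (v : 'rV[C]_n) : vnorm v <= vnorm (row_mx u v).
Proof.
rewrite -(@ler_pXn2r _ 2) ?nnegrE ?vnorm_ge0 // vnorm_row_mx lerDr.
exact: sqr_ge0.
Qed.

Lemma vnorm_row_le m n (u : 'rV[C]_m) (v : 'rV[C]_n) :
  vnorm (row_mx u v) <= vnorm u + vnorm v.
Proof.
rewrite -(@ler_pXn2r _ 2) ?nnegrE ?vnorm_ge0 ?addr_ge0 ?vnorm_ge0 // vnorm_row_mx.
by have := mulr_ge0 (vnorm_ge0 u) (vnorm_ge0 v); nra.
Qed.

Lemma vdot_bound n (u v : 'rV[C]_n) : vnorm u = 1 -> cmod (vdot u v) <= n%:R * vnorm v.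
Proof.
move=> u1; rewrite /vdot.
have : cmod (\sum_i (u 0 i)^* * v 0 i) <= \sum_(i < n) vnorm v.
  elim/big_ind2 : _ => [|x y x' y' xy xy'|i _]; first by rewrite cmod0.
    exact: le_trans (cmodD _ _) (lerD xy xy').
  rewrite cmodM cmod_conj; apply: le_trans (cmod_le_vnorm v i).
  by rewrite ler_piMl ?cmod_ge0 // -u1 cmod_le_vnorm.
by rewrite sumr_const card_ord -[_ *+ n]mulr_natl.
Qed.

End ComplexRows.

(** * The differential of the factorization map *)

Section DifferentialSums.
Variables (K : numFieldType) (V W : normedModType K) (z : V).

Lemma is_diff_bigsum (I : Type) (r : seq I) (P : pred I) (F dF : I -> V -> W) :
  (forall i, P i -> is_diff z (F i) (dF i)) ->
  is_diff z (fun v => \sum_(i <- r | P i) F i v) (fun h => \sum_(i <- r | P i) dF i h).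
Proof.
move=> FP; elim: r => [|i r IHr].
  have -> : (fun v => \sum_(i <- [::] | P i) F i v) = cst 0.
    by apply/funext => v; rewrite big_nil.
  have -> : (fun v => \sum_(i <- [::] | P i) dF i v) = 0.
    by apply/funext => v; rewrite big_nil.
  exact: is_diff_cst.
case Pi: (P i); last first.
  have -> : (fun v => \sum_(j <- i :: r | P j) F j v) = (fun v => \sum_(j <- r | P j) F j v).
    by apply/funext => v; rewrite big_cons Pi.
  suff -> : (fun v => \sum_(j <- i :: r | P j) dF j v) = (fun v => \sum_(j <- r | P j) dF j v).
    by [].
  by apply/funext => v; rewrite big_cons Pi.
have -> : (fun v => \sum_(j <- i :: r | P j) F j v) = F i + (fun v => \sum_(j <- r | P j) F j v).
  by apply/funext => v; rewrite big_cons Pi.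
have -> : (fun v => \sum_(j <- i :: r | P j) dF j v) = dF i + (fun v => \sum_(j <- r | P j) dF j v).
  by apply/funext => v; rewrite big_cons Pi.
by apply: is_diffD => //; exact: FP.
Qed.

End DifferentialSums.

Section DifferentialCoordinates.
Variables (K : numFieldType) (n : nat).
Implicit Types z : 'rV[K]_n.

Lemma is_diff_coord z i : is_diff z (fun v : 'rV[K]_n => v 0 i : K) (fun h => h 0 i).
Proof.
pose f := fun v : 'rV[K]_n => v 0 i : K.
have flin : linear f by move=> a u v; rewrite /f !mxE.
pose fM := GRing.isLinear.Build _ _ _ _ _ flin.
pose fL : {linear 'rV[K]_n -> K} := HB.pack f fM.
have fC : continuous fL by exact: coord_continuous.
by apply: DiffDef; [exact: (linear_differentiable z fC)|exact: (diff_lin z fC)].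
Qed.

Lemma is_diff_mul z (f g df dg : 'rV[K]_n -> K) :
  is_diff z f df -> is_diff z g dg ->
  is_diff z (fun v => f v * g v) (fun h => df h * g z + f z * dg h).
Proof.
move=> fP gP; have := is_diffM fP gP.
suff -> : f z *: dg + g z *: df = (fun h => df h * g z + f z * dg h) by [].
by apply/funext => h; rewrite addrC [df h * _]mulrC.
Qed.

Lemma is_diff_mulr z (f df : 'rV[K]_n -> K) c : is_diff z f df ->
  is_diff z (fun v => f v * c) (fun h => df h * c).
Proof.
move=> fP; have := is_diff_mul fP (is_diff_cst c z).
suff -> : (fun h => df h * c + f z * 0) = (fun h => df h * c) by [].
by apply/funext => h; rewrite mulr0 addr0.
Qed.

Lemma is_diff_row m z (F dF : 'rV[K]_n -> 'rV[K]_m) :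
  (forall j, is_diff z (fun v => F v 0 j : K) (fun h => dF h 0 j)) -> is_diff z F dF.
Proof.
move=> FP.
have FE (G : 'rV[K]_n -> 'rV[K]_m) : G = fun v => \sum_j G v 0 j *: delta_mx 0 j.
  by apply/funext => v; rewrite [LHS]row_sum_delta.
rewrite (FE F) (FE dF); apply: is_diff_bigsum => j _.
apply: DiffDef; first exact/differentiableZl/ex_diff.
by rewrite diffZl; [rewrite diff_val|exact: ex_diff].
Qed.

End DifferentialCoordinates.

Section PolynomialValued.
Variables (K : numFieldType) (l N : nat).
Notation C := K.
Notation T := (mpoly l K).
Notation V := 'rV[K]_N.
Implicit Types (z h : V) (F G DF DG : V -> T).

(** Differentiation coefficient by coefficient, which reduces the product rule
    for polynomials to that for scalar functions. *)
Definition is_pdiff z F DF := forall mu : multinom l,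
  is_diff z (fun v => mcoeff mu (F v) : C) (fun h => mcoeff mu (DF h)).

Lemma is_pdiff_mul z F G DF DG : is_pdiff z F DF -> is_pdiff z G DG ->
  is_pdiff z (fun v => F v * G v) (fun h => DF h * G z + F z * DG h).
Proof.
move=> FP GP mu.
have -> : (fun v => mcoeff mu (F v * G v)) = fun v =>
    \sum_(k : bmultinom l (mdeg mu).+1 * bmultinom l (mdeg mu).+1 | mu == mnm_add k.1 k.2)
      (mcoeff k.1 (F v) * mcoeff k.2 (G v)).
  by apply/funext => v; rewrite mcoeffM.
have -> : (fun h => mcoeff mu (DF h * G z + F z * DG h)) = fun h =>
    \sum_(k : bmultinom l (mdeg mu).+1 * bmultinom l (mdeg mu).+1 | mu == mnm_add k.1 k.2)
      (mcoeff k.1 (DF h) * mcoeff k.2 (G z) + mcoeff k.1 (F z) * mcoeff k.2 (DG h)).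
  by apply/funext => h; rewrite mcoeffD !mcoeffM -big_split.
by apply: is_diff_bigsum => k _; apply: is_diff_mul.
Qed.

Lemma is_pdiff_cst z p : is_pdiff z (fun=> p) (fun=> 0).
Proof.
move=> mu; have -> : (fun=> mcoeff mu (0 : T)) = 0 :> (V -> C).
  by apply/funext => h; rewrite mcoeff0.
exact: is_diff_cst.
Qed.

Lemma is_pdiff_scale z (g dg : V -> C) F DF : is_diff z g dg -> is_pdiff z F DF ->
  is_pdiff z (fun v => g v *: F v) (fun h => dg h *: F z + g z *: DF h).
Proof.
move=> gP FP mu.
have -> : (fun v => mcoeff mu (g v *: F v)) = fun v => g v * mcoeff mu (F v).
  by apply/funext => v; rewrite mcoeffZ.
have -> : (fun h => mcoeff mu (dg h *: F z + g z *: DF h)) =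
    fun h => dg h * mcoeff mu (F z) + g z * mcoeff mu (DF h).
  by apply/funext => h; rewrite mcoeffD !mcoeffZ.
exact: is_diff_mul.
Qed.

Lemma is_pdiff_eq z F DF DG : is_pdiff z F DF -> DF =1 DG -> is_pdiff z F DG.
Proof. by move=> FP /funext <-. Qed.

Lemma is_pdiff_expr z F DF k : is_pdiff z F DF ->
  is_pdiff z (fun v => F v ^+ k) (fun h => DF h * F z ^+ k.-1 *+ k).
Proof.
move=> FP; elim: k => [|k IHk].
  apply: (@is_pdiff_eq _ _ (fun=> 0)) => [|h]; last by rewrite mulr0n.
  exact: is_pdiff_cst.
have -> : (fun v => F v ^+ k.+1) = fun v => F v * F v ^+ k.
  by apply/funext => v; rewrite exprS.
apply: (is_pdiff_eq (is_pdiff_mul FP IHk)) => h /=.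
rewrite mulrS -!mulrnAr mulrCA; congr (_ + _ * _).
by case: k {IHk} => [|k]; rewrite ?mulr0n ?mulr0 // mulrnAr -exprS.
Qed.

Lemma is_pdiff_prod z (I : finType) (F DF : I -> V -> T) :
  (forall i, is_pdiff z (F i) (DF i)) ->
  is_pdiff z (fun v => \prod_i F i v)
    (fun h => \sum_i (\prod_(j | j != i) F j z) * DF i h).
Proof.
move=> FP; have : uniq (index_enum I) by exact: index_enum_uniq.
elim: (index_enum I) => [|a r IHr] /=.
  move=> _; have -> : (fun v => \prod_(i <- [::]) F i v) = fun=> 1.
    by apply/funext => v; rewrite big_nil.
  apply: (is_pdiff_eq (is_pdiff_cst z _)) => h.
  by rewrite big_nil.
case/andP => ar /IHr {}IHr.
have -> : (fun v => \prod_(i <- a :: r) F i v) = fun v => F a v * \prod_(i <- r) F i v.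
  by apply/funext => v; rewrite big_cons.
apply: (is_pdiff_eq (is_pdiff_mul (FP a) IHr)) => h /=.
rewrite big_cons big_cons eqxx /= mulrC; congr (_ * _ + _).
  rewrite big_seq [RHS]big_seq_cond; apply: eq_bigl => j.
  by rewrite andb_idr // => jr; apply: contraNneq ar => <-.
rewrite mulr_sumr big_seq [RHS]big_seq; apply: eq_bigr => i ir.
rewrite mulrA; congr (_ * _); rewrite big_cons ifT //.
by apply: contraNneq ar => ->.
Qed.

End PolynomialValued.

Section PhiDifferential.
Variables (R : realType) (l : nat) (M : fstruct l).
Notation C := R[i].
Notation T := (cpoly R l).
Variable b : forall j : 'I_(fs_r M), 'rV[C]_(dimP (fs_m M j)).
Notation K := (R[i] : numFieldType).
Notation V := 'rV[K]_(phi_dom M).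
Implicit Types (z h : V) (gs : 'I_(fs_r M) -> T).

(** The inverse of [phi_pack]: scalar, coefficient vectors and factors read off
    from a point of the domain of phi. *)
Definition pack_scalar z : C := lsubmx z 0 0.
Definition pack_coefs z j : 'rV[C]_(dimP (fs_m M j)) := submxrow (rsubmx z) j.
Definition pack_factor z j : T := polyv (pack_coefs z j).

Lemma pack_scalarE g gs : pack_scalar (phi_pack M g gs) = g.
Proof. by rewrite /pack_scalar /phi_pack row_mxKl mxE eqxx mulr1n. Qed.

Lemma pack_coefsE g gs j : pack_coefs (phi_pack M g gs) j = coefv (fs_m M j) (gs j).
Proof. by rewrite /pack_coefs /phi_pack row_mxKr mxrowK. Qed.

Lemma pack_factorE g gs j : Pspace (fs_m M j) (gs j) -> pack_factor (phi_pack M g gs) j = gs j.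
Proof. by move=> gm; rewrite /pack_factor pack_coefsE polyv_coefv. Qed.

Lemma coefv_pack_factor z j : coefv (fs_m M j) (pack_factor z j) = pack_coefs z j.
Proof. exact: coefv_polyv. Qed.

Lemma phi_packK z : phi_pack M (pack_scalar z) (pack_factor z) = z.
Proof.
rewrite -[RHS](hsubmxK z) /phi_pack; congr row_mx.
  by apply/rowP => i; rewrite !ord1 mxE eqxx mulr1n.
by rewrite -[RHS]submxrowK; apply/eq_mxrowP => j; rewrite coefv_pack_factor.
Qed.

(** The differential of (gamma, p) |-> gamma prod_j p_j^(k_j). *)
Definition dfact z h : T := pack_scalar h *: \prod_j pack_factor z j ^+ fs_k M j +
  pack_scalar z *: \sum_i (\prod_(j | j != i) pack_factor z j ^+ fs_k M j) *
     (pack_factor h i * pack_factor z i ^+ (fs_k M i).-1 *+ fs_k M i).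

Definition dphi z h : 'rV[C]_(phi_cod M) :=
  row_mx (coefv (fs_deg M) (dfact z h)) (\row_j vdot (b j) (pack_coefs h j)).

Lemma is_diff_pack_scalar z : is_diff z (pack_scalar : V -> K) pack_scalar.
Proof.
have -> : pack_scalar = fun v => v 0 (lshift _ 0).
  by apply/funext => v; rewrite /pack_scalar mxE.
exact: is_diff_coord.
Qed.

Lemma is_diff_pack_coefs z j a : is_diff z (fun v => pack_coefs v j 0 a : K) (fun h => pack_coefs h j 0 a).
Proof.
have -> : (fun h => pack_coefs h j 0 a) = fun v => v 0 (rshift 1 (tagnat.Rank j a)).
  by apply/funext => v; rewrite /pack_coefs !mxE.
exact: is_diff_coord.
Qed.

Lemma is_pdiff_pack_factor z j : is_pdiff z (pack_factor^~ j) (pack_factor^~ j).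
Proof.
move=> mu.
have -> : (fun v => mcoeff mu (pack_factor v j)) =
   fun v => \sum_a pack_coefs v j 0 a * mcoeff mu (mpolyX C (mexp (enum_val a))).
  by apply/funext => v; rewrite raddf_sum /=; apply: eq_bigr => a _; rewrite mcoeffZ.
by apply: is_diff_bigsum => a _; apply: is_diff_mulr; exact: is_diff_pack_coefs.
Qed.

Lemma is_diff_phi z : is_diff z (phi M b : V -> 'rV[K]_(phi_cod M)) (dphi z).
Proof.
apply: is_diff_row => c; rewrite -[c](@fintype.splitK (dimP (fs_deg M)) (fs_r M)); case: (fintype.split _) => a /=.
  have -> : (fun v => phi M b v 0 (lshift _ a)) =
      fun v => mcoeff (mexp (enum_val a)) (pack_scalar v *: \prod_j pack_factor v j ^+ fs_k M j).
    by apply/funext => v; rewrite row_mxEl mxE.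
  have -> : (fun h => dphi z h 0 (lshift _ a)) =
      fun h => mcoeff (mexp (enum_val a)) (dfact z h).
    by apply/funext => v; rewrite row_mxEl mxE.
  apply: is_pdiff_scale; first exact: is_diff_pack_scalar.
  by apply: is_pdiff_prod => j; apply: is_pdiff_expr; exact: is_pdiff_pack_factor.
have -> : (fun v => phi M b v 0 (rshift _ a)) =
    fun v => \sum_d pack_coefs v a 0 d * (b a 0 d)^*.
  by apply/funext => v; rewrite row_mxEr mxE; apply: eq_bigr => d _; rewrite mulrC.
have -> : (fun h => dphi z h 0 (rshift _ a)) =
    fun v => \sum_d pack_coefs v a 0 d * (b a 0 d)^*.
  by apply/funext => v; rewrite row_mxEr mxE; apply: eq_bigr => d _; rewrite mulrC.
by apply: is_diff_bigsum => d _; apply: is_diff_mulr; exact: is_diff_pack_coefs.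
Qed.

(** The transposition in [phi_jacobian] turns the action on row vectors into the
    usual action on column vectors. *)
Lemma phi_jacobianE z (x : 'cV[C]_(phi_dom M)) : phi_jacobian M b z *m x = (dphi z x^T)^T.
Proof.
have <- := @diff_val _ _ _ _ _ _ _ (is_diff_phi z).
by rewrite -[x in LHS]trmxK -trmx_mul mul_rV_lin1.
Qed.

Section AtFactorization.
Variables (alpha : C) (fs : 'I_(fs_r M) -> T).
Hypothesis alpha0 : alpha != 0.
Hypothesis fsP : prime_factors M fs.
Hypothesis fs_b : forall j, vdot (b j) (coefv (fs_m M j) (fs j)) = 1.
Let z := phi_pack M alpha fs.

Lemma prime_factors_Pspace j : Pspace (fs_m M j) (fs j).
Proof. by have [/(_ j)[/Pexact_Pspace]] := fsP. Qed.

Lemma prime_factors_irr j : irreducible_elt (fs j).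
Proof. by have [/(_ j)[]] := fsP. Qed.

Lemma prime_factors_indep i j : i != j -> ~ divides (fs i) (fs j).
Proof.
move=> ij fij; have [_ /(_ _ _ ij) fcop] := fsP.
have := fcop (fs i) (divides_refl _) fij.
by have [_ /negPf ->] := prime_factors_irr i.
Qed.

Lemma prime_factors_prod_neq0 : \prod_j fs j ^+ fs_k M j != 0.
Proof.
apply/prodf_neq0 => j _; apply/expf_neq0; exact: (fs_neq0 prime_factors_irr j).
Qed.

Lemma dfact_Pspace y h : Pspace (fs_deg M) (dfact y h).
Proof.
have facP v j : Pspace (fs_m M j) (pack_factor v j) by exact: polyv_Pspace.
apply: PspaceD; apply: PspaceZ.
  by apply: Pspace_prod (facP y) => i; rewrite mnmE.
apply: Pspace_sum => i _.
pose n1 : multinom l := Multinom [tuple (\sum_(j | j != i) fs_k M j * fs_m M j t)%N | t < l].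
apply: (@PspaceM _ _ n1 (mnm_muln (fs_m M i) (fs_k M i))).
- by move=> t; rewrite mulmnE !mnmE (bigD1 i) //= mulnC addnC.
- by apply: Pspace_prod (facP y) => t; rewrite mnmE.
- apply: PspaceMn; rewrite -{1}(prednK (fs_k_gt0 i)).
  apply: (PspaceM _ (facP h i) (Pspace_expr _ (facP y i))) => t.
  by rewrite !mulmnE mulnS.
Qed.

(** An exact degree is attained by a monomial in each variable. *)
Lemma size_dilate_Pexact n (p q : T) i : Pspace n q -> Pexact n p ->
  (size (dilate i q) <= size (dilate i p))%N.
Proof.
move=> /PspaceP qn [p0 pn]; apply: (@leq_trans (n i).+1).
  by apply/size_dilate_leq => mu /qn.
rewrite ltnNge; apply/negP => sp.
case E: (n i) sp => [|d] sp.
  by move: sp; rewrite leqn0 size_poly_eq0 dilate_eq0 (negPf p0).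
move/size_dilate_leq: sp => pd.
have : (pdeg p i <= d)%N.
  by rewrite mnmE; apply/bigmax_leqP_seq => mu mup _; exact: pd.
by rewrite pn E ltnn.
Qed.

(** The j-th component is divisible by [fs j] and of no larger degree, hence a
    scalar multiple of it, and the condition on b_j makes the scalar vanish. *)
Lemma dphi_injective h : dphi z h = 0 -> h = 0.
Proof.
move/eqP; rewrite -row_mx0 => /eqP/eq_row_mx[d0 b0].
have faczE j : pack_factor z j = fs j by rewrite pack_factorE //; exact: prime_factors_Pspace.
have {}b0 j : vdot (b j) (pack_coefs h j) = 0.
  by move/rowP/(_ j): b0; rewrite !mxE.
have {}d0 : dfact z h = 0.
  apply: (@coefv_inj _ _ (fs_deg M)); [exact: dfact_Pspace|exact: Pspace0|].
  by rewrite d0; apply/rowP => a; rewrite !mxE mcoeff0.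
have dvd j : divides (fs j) (pack_factor h j).
  apply: (@kernel_divides _ _ _ (fs_k M) fs _ prime_factors_irr
    prime_factors_indep alpha (pack_scalar h) (pack_factor h)).
  - by move=> t; exact: fs_k_gt0.
  - by move=> t; rewrite mulf_neq0 // pnatr_eq0 -lt0n fs_k_gt0.
  - move: d0; rewrite /dfact pack_scalarE.
    under eq_bigr do rewrite faczE.
    under [X in _ + _ *: X = _ -> _]eq_bigr => t _.
      under eq_bigr do rewrite faczE.
      rewrite faczE; over.
    exact.
have comp0 j : pack_coefs h j = 0.
  have fj : Pexact (fs_m M j) (fs j) by have [/(_ j)[]] := fsP.
  have [|c hE] := scalar_multiple (fs_neq0 prime_factors_irr j) (dvd j).
    by move=> t; apply: (size_dilate_Pexact _ _ fj); exact: polyv_Pspace.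
  have cE : pack_coefs h j = c *: coefv (fs_m M j) (fs j).
    by rewrite -coefv_pack_factor hE coefvZ.
  by have := b0 j; rewrite cE vdotZr fs_b mulr1 => ->; rewrite scale0r.
have fac0 j : pack_factor h j = 0.
  by apply: (@coefv_inj _ _ (fs_m M j)); [exact: polyv_Pspace|exact: Pspace0|];
    rewrite coefv_pack_factor comp0; apply/rowP => a; rewrite !mxE mcoeff0.
have gam0 : pack_scalar h = 0.
  move: d0; rewrite /dfact; under eq_bigr do rewrite faczE.
  rewrite [X in _ + _ *: X]big1; last by move=> t _; rewrite fac0 mul0r mul0rn mulr0.
  rewrite scaler0 addr0 => /eqP; rewrite scaler_eq0 => /orP[/eqP//|].
  by rewrite (negPf prime_factors_prod_neq0).
rewrite -(phi_packK h) /phi_pack gam0; apply/eqP; rewrite -row_mx0; apply/eqP.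
congr row_mx; first by apply/rowP => a; rewrite !mxE mul0rn.
apply/rowP => a; rewrite !mxE.
by have := comp0 (tagnat.sig1 a); rewrite -coefv_pack_factor => /rowP/(_ (tagnat.sig2 a));
  rewrite !mxE.
Qed.

Lemma phi_jacobian_injective (x : 'cV[C]_(phi_dom M)) :
  phi_jacobian M b z *m x = 0 -> x = 0.
Proof.
rewrite phi_jacobianE => /(congr1 trmx); rewrite trmxK trmx0 => /dphi_injective.
by move/(congr1 trmx); rewrite trmxK trmx0.
Qed.

(** The image under the Jacobian of the unit vector in the direction of the scalar
    does not depend on alpha, and the pseudo-inverse brings it back. *)
Lemma opnorm2_pinv_lower :
  (((pnorm (\prod_j fs j ^+ fs_k M j))^-1)%:E
     <= opnorm2 (mp_pinv (phi_jacobian M b z)))%E.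
Proof.
set J := phi_jacobian M b z; set P := \prod_j _.
pose e : 'cV[C]_(phi_dom M) := (phi_pack M 1 (fun=> 0))^T.
have fac0 j : pack_factor (phi_pack M 1 (fun=> 0)) j = 0 by rewrite pack_factorE //; exact: Pspace0.
have PP : Pspace (fs_deg M) P.
  by apply: Pspace_prod prime_factors_Pspace => i; rewrite mnmE.
have JE : J *m e = (row_mx (coefv (fs_deg M) P) 0)^T.
  rewrite phi_jacobianE trmxK /dphi /dfact pack_scalarE scale1r; congr (row_mx _ _)^T.
    rewrite [X in _ + _ *: X]big1; last by move=> t _; rewrite fac0 mul0r mul0rn mulr0.
    rewrite scaler0 addr0; congr coefv; apply: eq_bigr => j _.
    by rewrite pack_factorE //; exact: prime_factors_Pspace.
  apply/rowP => j; rewrite !mxE pack_coefsE /vdot big1 // => a _.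
  by rewrite mxE mcoeff0 mulr0.
have XJ : mp_pinv J *m (J *m e) = e.
  by rewrite mulmxA mp_pinv_injective ?mul1mx //; exact: phi_jacobian_injective.
have e1 : vnorm e = 1.
  rewrite /vnorm /e; under eq_bigr do rewrite big_ord1 mxE.
  rewrite big_split_ord /= big_ord1 row_mxEl !mxE eqxx mulr1n cmod1 expr1n.
  rewrite big1 ?addr0 ?sqrtr1 // => a _.
  by rewrite row_mxEr !mxE mcoeff0 cmod0 expr0n.
have Je : vnorm (J *m e) = pnorm P.
  rewrite JE (pnorm_coefv PP) vnormE /vnorm; congr Num.sqrt.
  under eq_bigr do rewrite big_ord1 mxE.
  rewrite big_split_ord /= [X in _ + X]big1 ?addr0; last first.
    by move=> a _; rewrite row_mxEr mxE cmod0 expr0n.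
  by apply: eq_bigr => a _; rewrite row_mxEl.
have Je0 : J *m e != 0.
  apply/eqP => J0; have := e1; rewrite -XJ J0 mulmx0 /vnorm big1 ?sqrtr0 => [/esym/eqP|i _].
    by rewrite oner_eq0.
  by rewrite big1 // => j _; rewrite mxE cmod0 expr0n.
by have := opnorm2_lower (mp_pinv J) Je0; rewrite XJ e1 Je mul1r.
Qed.

End AtFactorization.
End PhiDifferential.

(** * Local inversion of the factorization map *)

Section LocalEstimate.
Variables (R : realType) (l : nat) (M : fstruct l).
Notation C := R[i].
Notation T := (cpoly R l).
Notation K := (R[i] : numFieldType).
Variable b : forall j : 'I_(fs_r M), 'rV[C]_(dimP (fs_m M j)).
Notation V := 'rV[K]_(phi_dom M).
Implicit Types (z h : V).

(** Differentiability of phi in terms of the real Euclidean norm, whereas the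
    normed module of matrices carries the maximum norm with complex values. *)
Lemma phi_expansion z (e : R) : 0 < e -> exists2 rho : R, 0 < rho &
  forall h, vnorm h < rho ->
    vnorm (phi M b (z + h) - phi M b z - dphi b z h) <= e * vnorm h.
Proof.
move=> e0; pose n := phi_cod M.
have e'0 : 0 < e / n.+1%:R by rewrite divr_gt0.
have dP := is_diff_phi b z.
have := @diff_locallyxC K V 'rV[K]_(phi_cod M) z (phi M b) (@ex_diff _ _ _ _ _ _ _ dP).
rewrite (@diff_val _ _ _ _ _ _ _ dP) => /funext/eqaddoP.
move=> /(_ (e / n.+1%:R)%:C%C); rewrite ltcR => /(_ e'0) /nbhs_ballP[d /= d0 dP'].
exists (complex.Re d).
  by move: d0; rewrite ltcE => /andP[].
move=> h hd.
have /dP' : ball (0 : V) d h.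
  split=> // i j; rewrite /ball /= ord1 mxE sub0r normrN normr_cmod.
  have -> : d = (complex.Re d)%:C%C.
    by case: (d) d0 => u v; rewrite ltcE /= => /andP[/eqP-> _].
  by rewrite ltcR; apply: le_lt_trans hd; exact: cmod_le_vnorm.
set X := (_ - _) => Xh.
have XE : phi M b (z + h) - phi M b z - dphi b z h = X h.
  by rewrite /X /= opprD addrA.
rewrite XE; apply: (@le_trans _ _ (n%:R * (e / n.+1%:R * vnorm h))).
  apply: vnorm_le_coord; first by rewrite mulr_ge0 ?vnorm_ge0 // ltW.
  move=> i; rewrite -lecR -normr_cmod; apply: le_trans (coord_le_mx_norm _ _ _) _.
  apply: le_trans Xh _; rewrite [leRHS]rmorphM /=.
  by apply: ler_wpM2l; [rewrite ler0c ltW|exact: mx_norm_vnorm].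
rewrite mulrA ler_wpM2r ?vnorm_ge0 // mulrCA ger_pMr //.
by rewrite ler_pdivrMr ?ltr0n // mul1r ler_nat.
Qed.
End LocalEstimate.

Section LocalInverse.
Variables (R : realType) (l : nat) (M : fstruct l).
Notation C := R[i].
Notation T := (cpoly R l).
Variable b : forall j : 'I_(fs_r M), 'rV[C]_(dimP (fs_m M j)).
Notation V := 'rV[C]_(phi_dom M).
Implicit Types (z h : V) (gs us : 'I_(fs_r M) -> T).

Lemma phi_continuous z (e : R) : 0 < e -> exists2 rho : R, 0 < rho &
  forall h, vnorm h < rho -> vnorm (phi M b (z + h) - phi M b z) < e.
Proof.
move=> e0; have [B B0 BP] := mulmx_bounded (phi_jacobian M b z).
have [rho rho0 rhoP] := phi_expansion b z (ltr01 : 0 < 1 :> R).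
exists (Num.min rho (e / (1 + B))).
  by rewrite lt_min rho0 divr_gt0 // addr_gt0.
move=> h; rewrite lt_min => /andP[/rhoP hrho]; rewrite ltr_pdivlMr ?addr_gt0 // => he.
have dB : vnorm (dphi b z h) <= B * vnorm h.
  by have := BP h^T; rewrite phi_jacobianE trmxK !vnorm_tr.
have := vnormD (phi M b (z + h) - phi M b z - dphi b z h) (dphi b z h).
rewrite subrK => /le_lt_trans; apply.
by apply: le_lt_trans (lerD hrho dB) _; rewrite -mulrDl mulrC.
Qed.

Lemma phi_fact (z : V) : phi M b z =
  row_mx (coefv (fs_deg M) (Defs.fact_prod M (pack_scalar z) (pack_factor z))) (\row_j vdot (b j) (pack_coefs z j)).
Proof. by []. Qed.

Lemma fact_prod_Pspace a gs : (forall j, Pspace (fs_m M j) (gs j)) ->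
  Pspace (fs_deg M) (Defs.fact_prod M a gs).
Proof. by move=> gP; apply/PspaceZ/(Pspace_prod _ gP) => i; rewrite mnmE. Qed.

Lemma vnorm_pack_coefs z j : vnorm (pack_coefs z j) <= (dimP (fs_m M j))%:R * vnorm z.
Proof.
apply: vnorm_le_coord; first exact: vnorm_ge0.
by move=> a; rewrite /pack_coefs !mxE; exact: cmod_le_vnorm.
Qed.

Lemma cmod_pack_scalar z : cmod (pack_scalar z) <= vnorm z.
Proof. by rewrite /pack_scalar mxE; exact: cmod_le_vnorm. Qed.

Lemma vnorm_dom_le z (e : R) : 0 <= e -> cmod (pack_scalar z) <= e ->
  (forall j, vnorm (pack_coefs z j) <= e) -> vnorm z <= (phi_dom M)%:R * e.
Proof.
move=> e0 ge ce; apply: vnorm_le_coord => // c.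
rewrite -(phi_packK z) /phi_pack mxE.
case: splitP => a _; first by rewrite mxE ord1 eqxx mulr1n.
rewrite !mxE; have := cmod_le_vnorm (pack_coefs z (tagnat.sig1 a)) (tagnat.sig2 a).
by rewrite -{1}coefv_pack_factor mxE => /le_trans; apply.
Qed.

Lemma pack_coefsB y z j : pack_coefs (y - z) j = pack_coefs y j - pack_coefs z j.
Proof. by apply/rowP => a; rewrite !mxE. Qed.

Lemma pack_scalarB y z : pack_scalar (y - z) = pack_scalar y - pack_scalar z.
Proof. by rewrite /pack_scalar !mxE. Qed.

(** The product of the factors is the first block of phi. *)
Lemma fact_prod_continuous z (e : R) : 0 < e -> exists2 rho : R, 0 < rho &
  forall y, vnorm (y - z) < rho ->
    pnorm (Defs.fact_prod M (pack_scalar y) (pack_factor y) - Defs.fact_prod M (pack_scalar z) (pack_factor z)) < e.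
Proof.
move=> /(phi_continuous z)[rho rho0 rhoP]; exists rho => // y /rhoP.
rewrite addrCA subrr addr0 !phi_fact opp_row_mx add_row_mx -coefvB.
apply: le_lt_trans; rewrite (@pnorm_coefv _ _ (fs_deg M)); first exact: vnorm_lsub.
by apply: PspaceB; apply: fact_prod_Pspace => j; exact: polyv_Pspace.
Qed.

Section AtFactorization.
Variables (alpha : C) (fs : 'I_(fs_r M) -> T).
Hypothesis alpha0 : alpha != 0.
Hypothesis fsP : prime_factors M fs.
Let z := phi_pack M alpha fs.

(** A left inverse bounds the differential below, and the remainder of the
    expansion absorbs at most half of that bound. *)
Lemma local_estimate : (forall j, vdot (b j) (coefv (fs_m M j) (fs j)) = 1) ->
  exists2 K : R, 0 < K & exists2 rho : R, 0 < rho &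
  forall h, vnorm h < rho -> vnorm h <= K * vnorm (phi M b (z + h) - phi M b z).
Proof.
move=> fs_b; set J := phi_jacobian M b z.
have [B B0 BP] := mulmx_bounded (mp_pinv J).
have XJ : mp_pinv J *m J = 1%:M.
  by apply: mp_pinv_injective; exact: phi_jacobian_injective.
have hB h : vnorm h <= B * vnorm (dphi b z h).
  have := BP (J *m h^T); rewrite mulmxA XJ mul1mx phi_jacobianE trmxK.
  by rewrite !vnorm_tr.
have e0 : 0 < (2 * B)^-1 by rewrite invr_gt0 mulr_gt0.
have [rho rho0 rhoP] := phi_expansion b z e0.
exists (2 * B); first by rewrite mulr_gt0.
exists rho => // h hrho; have := rhoP h hrho; have := hB h.
set D := phi M b (z + h) - phi M b z.
have := vnormD (dphi b z h - D) D; rewrite subrK -(vnormN (_ - D)) opprB => H1 H2 H3.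
have H4 : B * vnorm (D - dphi b z h) <= vnorm h / 2.
  have -> : vnorm h / 2 = B * ((2 * B)^-1 * vnorm h).
    by rewrite invfM mulrA mulrCA divff ?gt_eqF // mulr1 mulrC.
  by rewrite ler_pM2l.
move: H2 H4 (ler_wpM2l (ltW B0) H1).
move: (vnorm h) (vnorm (dphi b z h)) (vnorm (D - _)) (vnorm D) => x y u v; lra.
Qed.

End AtFactorization.
End LocalInverse.

(** * Convergence of factorizations *)

Section Convergence.
Variables (R : realType) (l : nat) (M : fstruct l).
Notation C := R[i].
Notation T := (cpoly R l).
Notation V := 'rV[C]_(phi_dom M).
Implicit Types (gs us : 'I_(fs_r M) -> T).

Lemma prod_scale (c : 'I_(fs_r M) -> C) gs :
  \prod_j (c j *: gs j) ^+ fs_k M j =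
  (\prod_j c j ^+ fs_k M j) *: \prod_j gs j ^+ fs_k M j.
Proof. by rewrite -scaler_prod; apply: eq_bigr => j _; rewrite exprZn. Qed.

Lemma pnorm_chain (x y z w : T) (e : R) : pnorm (x - y) < e / 3 ->
  pnorm (x - z) < e / 3 -> pnorm (z - w) <= e / 3 -> pnorm (y - w) <= e.
Proof.
have := pnorm_dist_triangle x y w; have := pnorm_dist_triangle z x w.
rewrite (pnormB y x); lra.
Qed.

Variables (alpha : C) (fs : 'I_(fs_r M) -> T).
Hypothesis alpha0 : alpha != 0.
Hypothesis fsP : prime_factors M fs.
Let fhat := Defs.fact_prod M alpha fs.
Hypothesis fhat_deg : Pexact (fs_deg M) fhat.

(** Degrees are only bounded above in the limit. If some [hs j] became constant,
    the degree of the product would drop below that of [fhat]; so unique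
    factorization applies, and summing the degrees forces them to be exact. *)
Lemma limit_factorization a c (hs : 'I_(fs_r M) -> T) :
  (forall j, hs j != 0) -> (forall j, Pspace (fs_m M j) (hs j)) ->
  a != 0 \/ c != 0 -> a *: \prod_j hs j ^+ fs_k M j = c *: fhat ->
  exists s : 'S_(fs_r M), forall j,
    [/\ fs_k M (s j) = fs_k M j, fs_m M (s j) = fs_m M j &
      exists2 d : C, d != 0 & hs j = d *: fs (s j)].
Proof.
move=> hs0 hsm ac acE; have [fhat0 fhatE] := fhat_deg.
have prod0 : \prod_j hs j ^+ fs_k M j != 0.
  by apply/prodf_neq0 => j _; rewrite expf_neq0.
have [a0 c0] : a != 0 /\ c != 0.
  case: ac => [a0|c0]; split=> //.
    apply/eqP => c0; move/eqP: acE.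
    by rewrite c0 scale0r scaler_eq0 (negPf a0) (negPf prod0).
  apply/eqP => a0; move/esym/eqP: acE.
  by rewrite a0 scale0r scaler_eq0 (negPf c0) (negPf fhat0).
have hsU j : hs j \isn't a GRing.unit.
  apply/negP => /mpoly_unit_const[d d0 hE].
  have [i mi] := fs_m_neq0 j.
  pose n1 : multinom l := Multinom [tuple (\sum_(t | t != j) fs_k M t * fs_m M t i)%N | i < l].
  have : Pspace n1 (c *: fhat).
    rewrite -acE (bigD1 j) //= hE -rmorphXn /= mul_mpolyC; do 2!apply: PspaceZ.
    by apply: Pspace_prod hsm => t; rewrite mnmE.
  move=> /(PspaceZ c^-1); rewrite scalerA mulVf // scale1r => /(_ i).
  rewrite fhatE !mnmE (bigD1 j) //= -[leqRHS]add0n leq_add2r leqn0 muln_eq0.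
  by rewrite (negPf mi) orbF -leqn0 leqNgt fs_k_gt0.
have [||||s sP] := @factorization_match l _ _ (fs_k M) fs _
    (prime_factors_irr fsP) (prime_factors_indep fsP) hs (c * alpha) a _ a0 _ _.
- by move=> t; exact: fs_k_gt0.
- by rewrite mulf_neq0.
- by move=> j; split.
- by rewrite acE -scalerA.
exists s.
have mle j i : (fs_m M (s j) i <= fs_m M j i)%N.
  have [_ [d d0 hE]] := sP j; have [/(_ (s j))[[_ <-] _] _] := fsP.
  suff : Pspace (fs_m M j) (fs (s j)) by apply.
  rewrite -[fs _]scale1r -(mulVf d0) -scalerA -hE; exact: PspaceZ.
have meq j : fs_m M (s j) = fs_m M j.
  apply/mnmP => i; apply/eqP; rewrite eqn_leq mle /= leqNgt; apply/negP => lt.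
  have : (\sum_j fs_m M (s j) i < \sum_j fs_m M j i)%N.
    rewrite (bigD1 j) //= [ltnRHS](bigD1 j) //= -addSn leq_add // leq_sum //.
  by rewrite [ltnRHS](reindex_inj (@perm_inj _ s)) ltnn.
by move=> j; have [? ?] := sP j.
Qed.

(** Otherwise there are factorizations without this property whose products tend
    to [fhat]. Their factors are scaled to norm 1. The scalar g might be unbounded,
    so the pair (g, 1) is divided by the maximum of |g| and 1: in the limit it is
    not (0, 0), and [limit_factorization] applies. *)
Lemma factors_close (rho : R) : 0 < rho -> exists2 delta : R, 0 < delta &
  forall g gs, prime_factors M gs ->
    pnorm (Defs.fact_prod M g gs - fhat) < delta ->
    exists (s : 'S_(fs_r M)) (c : 'I_(fs_r M) -> C), forall j,
      [/\ fs_k M (s j) = fs_k M j, fs_m M (s j) = fs_m M j, c j != 0 &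
        pnorm (c j *: gs (s j) - fs j) < rho].
Proof.
move=> rho0; apply: contrapT => nE.
pose Q gs := exists (s : 'S_(fs_r M)) (c : 'I_(fs_r M) -> C), forall j,
      [/\ fs_k M (s j) = fs_k M j, fs_m M (s j) = fs_m M j, c j != 0 &
        pnorm (c j *: gs (s j) - fs j) < rho].
have /choice[w wP] : forall n : nat, exists w : C * ('I_(fs_r M) -> T),
    [/\ prime_factors M w.2, pnorm (Defs.fact_prod M w.1 w.2 - fhat) < n.+1%:R^-1 &
      ~ Q w.2].
  move=> n; apply: contrapT => nn; apply: nE; exists n.+1%:R^-1.
    by rewrite invr_gt0 ltr0n.
  move=> g gs gsP gd; apply: contrapT => nQ; apply: nn.
  by exists (g, gs).
pose p n j := (w n).2 j.
have p0 n j : p n j != 0 by have [/prime_factors_irr/(_ j)[]] := wP n.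
have pN n j : 0 < pnorm (p n j) by rewrite pnorm_gt0.
pose u n j := (pnorm (p n j))^-1%:C%C *: p n j.
have uN n j : pnorm (u n j) = 1.
  by rewrite pnormZ cmod_real gtr0_norm ?invr_gt0 // mulVf // gt_eqF.
have uP n j : Pspace (fs_m M j) (u n j).
  by apply: PspaceZ; have [/prime_factors_Pspace/(_ j)] := wP n.
pose g n := (w n).1 * \prod_j (pnorm (p n j))%:C%C ^+ fs_k M j.
have guE n : g n *: \prod_j u n j ^+ fs_k M j = Defs.fact_prod M (w n).1 (w n).2.
  rewrite prod_scale scalerA /g -mulrA -big_split /= big1 ?mulr1 // => j _.
  by rewrite -exprMn -rmorphM /= divff ?gt_eqF // rmorph1 expr1n.
(* common divisor of the pair (g n, 1) *)
pose W n : R := Num.max (cmod (g n)) 1.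
have W0 n : 0 < W n by rewrite lt_max ltr01 orbT.
have W1 n : 1 <= W n by rewrite le_max lexx orbT.
have WV n : 0 <= (W n)^-1 <= 1.
  by rewrite invr_ge0 (ltW (W0 n)) /= invf_le1.
pose a n : C := (W n)^-1%:C%C * g n.
pose c n : C := (W n)^-1%:C%C.
have cmod_c n : cmod (c n) = (W n)^-1 by rewrite cmod_real ger0_norm //; case/andP: (WV n).
have cmod_a n : cmod (a n) = (W n)^-1 * cmod (g n) by rewrite cmodM -/(c n) cmod_c.
have a1 n : cmod (a n) <= 1.
  by rewrite cmod_a mulrC ler_pdivrMr // mul1r le_max lexx.
pose y n : 'rV[C]_(phi_dom M + 1) := row_mx (phi_pack M (a n) (u n)) (c n)%:M.
have scal1 (t : C) : vnorm (t%:M : 'rV_1) = cmod t.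
  by rewrite vnormE big_ord1 mxE eqxx mulr1n sqrtr_sqr ger0_norm // cmod_ge0.
have [|x xP] := @bolzano_weierstrass_vnorm _ _ y ((phi_dom M)%:R * 1 + 1).
  move=> n; apply: le_trans (vnorm_row_le _ _) (lerD _ _).
    apply: vnorm_dom_le => //; first by rewrite pack_scalarE.
    by move=> j; rewrite pack_coefsE -(pnorm_coefv (uP n j)) uN.
  by rewrite scal1 cmod_c; case/andP: (WV n).
pose z := lsubmx x; pose c' := rsubmx x 0 0.
have yx (e : R) : 0 < e -> exists n, [/\ n.+1%:R^-1 < e,
    vnorm (phi_pack M (a n) (u n) - z) < e & cmod (c n - c') < e].
  move=> e0; have [m mP] := small_inv e0; have [n mn nx] := xP e e0 m.
  have yE : y n - x = row_mx (phi_pack M (a n) (u n) - z) (c n - c')%:M.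
    rewrite -{1}(hsubmxK x) opp_row_mx add_row_mx; congr row_mx.
    by apply/rowP => i; rewrite !ord1 /c' !mxE eqxx !mulr1n.
  rewrite yE in nx; exists n; split; first exact: mP.
    exact: le_lt_trans (vnorm_lsub _ _) nx.
  by rewrite -scal1; exact: le_lt_trans (vnorm_rsub _ _) nx.
have compz n j : vnorm (coefv (fs_m M j) (u n j) - pack_coefs z j) <=
    (dimP (fs_m M j))%:R * vnorm (phi_pack M (a n) (u n) - z).
  by rewrite -(pack_coefsE (a n)) -pack_coefsB; exact: vnorm_pack_coefs.
have faczu n j : pnorm (u n j - pack_factor z j) <=
    (dimP (fs_m M j))%:R * vnorm (phi_pack M (a n) (u n) - z).
  rewrite (@pnorm_coefv _ _ (fs_m M j)); last exact: PspaceB (uP n j) (polyv_Pspace _).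
  by rewrite coefvB coefv_pack_factor.
have fac0 j : pack_factor z j != 0.
  apply/eqP => z0; pose D : R := (dimP (fs_m M j))%:R.
  have D0 : 0 <= D by [].
  have [|n [_ nz _]] := yx (1 + D)^-1; first by rewrite invr_gt0; lra.
  have := faczu n j; rewrite z0 subr0 uN -/D => D1.
  have : D * vnorm (phi_pack M (a n) (u n) - z) <= D * (1 + D)^-1.
    by rewrite ler_wpM2l // ltW.
  have : D * (1 + D)^-1 < 1 by rewrite ltr_pdivrMr; lra.
  lra.
have ac : pack_scalar z != 0 \/ c' != 0.
  apply/orP; rewrite -negb_and; apply/negP => /andP[/eqP a0 /eqP c0].
  have e0 : 0 < 2^-1 :> R by rewrite invr_gt0.
  have [n [_ nz nc]] := yx _ e0.
  rewrite c0 subr0 cmod_c in nc.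
  have := le_lt_trans (cmod_pack_scalar _) nz; rewrite pack_scalarB pack_scalarE a0 subr0 cmod_a.
  have := mulVf (lt0r_neq0 (W0 n)).
  move: nc; rewrite /W; case: (leP (cmod (g n)) 1) => _; last by lra.
  by rewrite invr1; lra.
have acE : pack_scalar z *: \prod_j pack_factor z j ^+ fs_k M j = c' *: fhat.
  apply/eqP; rewrite -subr_eq0 -pnorm_eq0; apply/eqP/le_anti; rewrite pnorm_ge0 andbT.
  apply: le_of_eps => e e0; rewrite add0r.
  have e3 : 0 < e / 3 by rewrite divr_gt0.
  have [r r0 rP] := fact_prod_continuous (fun=> 0) z e3.
  have P0 : 0 < 1 + pnorm fhat by have := pnorm_ge0 fhat; lra.
  have [|n [n1 n2 n3]] := yx (Num.min (Num.min (e / 3) r) (e / 3 / (1 + pnorm fhat))).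
    by rewrite !lt_min e3 r0 divr_gt0.
  move: n1 n2 n3; rewrite !lt_min => /andP[/andP[n1 _] _] /andP[/andP[_ /rP n2] _].
  case/andP=> _; rewrite ltr_pdivlMr // => n3.
  rewrite pack_scalarE in n2; have {}n2 : pnorm (a n *: \prod_j u n j ^+ fs_k M j -
     pack_scalar z *: \prod_j pack_factor z j ^+ fs_k M j) < e / 3.
    move: n2; rewrite /Defs.fact_prod.
    by under eq_bigr do rewrite pack_factorE //.
  have H1 : pnorm (a n *: \prod_j u n j ^+ fs_k M j - c n *: fhat) < e / 3.
    rewrite /a -scalerA guE -scalerBr pnormZ cmod_c.
    have [_ wn _] := wP n; have /andP[WV0 WV1] := WV n.
    apply: le_lt_trans (lt_trans wn n1); apply: ler_piMl => //; exact: pnorm_ge0.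
  have H2 : pnorm (c n *: fhat - c' *: fhat) <= e / 3.
    rewrite -scalerBl pnormZ; have := mulr_ge0 (cmod_ge0 (c n - c')) (pnorm_ge0 fhat).
    move: (cmod_ge0 (c n - c')) n3; rewrite mulrDr mulr1.
    move: (cmod _) (_ * _) => u1 u2 *; lra.
  exact: pnorm_chain n2 H1 H2.
have [s sP] := limit_factorization fac0 (fun j => polyv_Pspace (pack_coefs z j)) ac acE.
have /choice[d dP] : forall j, exists d : C, d != 0 /\ pack_factor z j = d *: fs (s j).
  by move=> j; have [_ _ [d]] := sP j; exists d.
pose t := (s^-1)%g.
(* B bounds the effect of rescaling each factor by the inverse of d j *)
pose B : R := 1 + \sum_j cmod (d j)^-1 * (dimP (fs_m M j))%:R.
have sum0 (P : pred 'I_(fs_r M)) : 0 <= \sum_(j | P j) cmod (d j)^-1 * (dimP (fs_m M j))%:R.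
  by apply: sumr_ge0 => j _; rewrite mulr_ge0 ?cmod_ge0.
have B0 : 0 < B by have := sum0 xpredT; rewrite /B; lra.
have [|n [_ nz _]] := yx (rho / B); first by rewrite divr_gt0.
have [_ _ []] := wP n; exists t, (fun j => (d (t j))^-1 * (pnorm (p n (t j)))^-1%:C%C) => j.
have [kt mt _] := sP (t j); have [dt facE] := dP (t j).
rewrite /t permKV -/t in kt mt facE.
split=> //.
  by rewrite mulf_neq0 ?invr_eq0 // -cmod_eq0 cmod_real normr_eq0 invr_eq0 gt_eqF.
rewrite -scalerA -/(p n (t j)) -/(u n (t j)).
have -> : (d (t j))^-1 *: u n (t j) - fs j = (d (t j))^-1 *: (u n (t j) - pack_factor z (t j)).
  have -> : fs j = (d (t j))^-1 *: pack_factor z (t j) by rewrite facE scalerA mulVf // scale1r.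
  by rewrite scalerBr.
rewrite pnormZ.
have : cmod (d (t j))^-1 * pnorm (u n (t j) - pack_factor z (t j)) <=
   cmod (d (t j))^-1 * ((dimP (fs_m M (t j)))%:R * vnorm (phi_pack M (a n) (u n) - z)).
  by rewrite ler_wpM2l ?cmod_ge0.
move/le_lt_trans; apply; rewrite mulrA.
have BB : cmod (d (t j))^-1 * (dimP (fs_m M (t j)))%:R <= B - 1.
  rewrite /B (bigD1 (t j)) //=; have := sum0 (fun i => i != t j); lra.
have : B * vnorm (phi_pack M (a n) (u n) - z) < rho.
  by move: nz; rewrite ltr_pdivlMr // mulrC.
have := vnorm_ge0 (phi_pack M (a n) (u n) - z).
move: (vnorm _) BB => v BB v0; have := mulr_ge0 v0 v0; nra.
Qed.

End Convergence.

Section Lipschitz.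
Variables (R : realType) (l : nat) (M : fstruct l).
Notation C := R[i].
Notation T := (cpoly R l).
Notation V := 'rV[C]_(phi_dom M).
Implicit Types (gs us qs : 'I_(fs_r M) -> T).
Variable b : forall j : 'I_(fs_r M), 'rV[C]_(dimP (fs_m M j)).
Hypothesis b1 : forall j, vnorm (b j) = 1.
Variables (alpha : C) (fs : 'I_(fs_r M) -> T).
Hypothesis alpha0 : alpha != 0.
Hypothesis fsP : prime_factors M fs.
Hypothesis fs_b : forall j, vdot (b j) (coefv (fs_m M j) (fs j)) = 1.
Let fhat := Defs.fact_prod M alpha fs.
Hypothesis fhat_deg : Pexact (fs_deg M) fhat.
Let fsm j : Pspace (fs_m M j) (fs j) := prime_factors_Pspace fsP j.

Lemma pack_dist (a a' : C) gs gs' (e : R) : 0 <= e ->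
  (forall j, Pspace (fs_m M j) (gs j)) -> (forall j, Pspace (fs_m M j) (gs' j)) ->
  cmod (a - a') <= e -> (forall j, pnorm (gs j - gs' j) <= e) ->
  vnorm (phi_pack M a gs - phi_pack M a' gs') <= (phi_dom M)%:R * e.
Proof.
move=> e0 gsm gsm' aa gg; apply: vnorm_dom_le => // [|j].
  by rewrite pack_scalarB !pack_scalarE.
by rewrite pack_coefsB !pack_coefsE -coefvB -pnorm_coefv //; exact: PspaceB.
Qed.

Let D : R := 1 + \sum_j (dimP (fs_m M j))%:R.
Let F : R := 1 + \sum_j pnorm (fs j).

Let D1 : 1 <= D. Proof. by rewrite lerDl sumr_ge0. Qed.
Let F1 : 1 <= F. Proof. by rewrite lerDl sumr_ge0 // => j _; exact: pnorm_ge0. Qed.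

Let Dj j : (dimP (fs_m M j))%:R <= D.
Proof.
rewrite /D (bigD1 j) //=.
have : 0 <= \sum_(i < fs_r M | i != j) (dimP (fs_m M i))%:R :> R by rewrite sumr_ge0.
lra.
Qed.

Let Fj j : pnorm (fs j) <= F.
Proof.
rewrite /F (bigD1 j) //=.
have : 0 <= \sum_(i < fs_r M | i != j) pnorm (fs i).
  by rewrite sumr_ge0 // => i _; exact: pnorm_ge0.
lra.
Qed.

(** The product with b_j is 1 for [fs j], hence close to 1 for p. *)
Lemma renormalize j (p : T) (rho : R) : Pspace (fs_m M j) p -> D * rho <= 2^-1 ->
  pnorm (p - fs j) <= rho -> exists t : C, [/\ t != 0,
    vdot (b j) (coefv (fs_m M j) (t *: p)) = 1 &
    pnorm (t *: p - fs j) <= 2 * (1 + D * F) * rho].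
Proof.
move=> pm Drho prho.
have rho0 : 0 <= rho by apply: le_trans prho; exact: pnorm_ge0.
pose v := vdot (b j) (coefv (fs_m M j) p).
have v1 : cmod (v - 1) <= D * rho.
  rewrite -(fs_b j) /v -vdotB -coefvB; apply: le_trans (vdot_bound _ (b1 j)) _.
  rewrite -pnorm_coefv; last exact: PspaceB.
  by apply: ler_pM => //; exact: pnorm_ge0.
have v2 : 2^-1 <= cmod v.
  have := cmod_triangle v 1 0; rewrite !subr0 cmod1 cmodB; lra.
have v0 : v != 0 by rewrite -cmod_gt0; lra.
exists v^-1; split; first by rewrite invr_eq0.
  by rewrite coefvZ vdotZr -/v mulVf.
have -> : v^-1 *: p - fs j = v^-1 *: ((p - fs j) + (1 - v) *: fs j).
  by rewrite scalerDr scalerA mulrBr mulr1 mulVf // scalerBr scalerBl scale1r addrA subrK.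
rewrite pnormZ cmodV.
have H : pnorm (p - fs j + (1 - v) *: fs j) <= (1 + D * F) * rho.
  apply: le_trans (pnormD _ _) _; rewrite pnormZ cmodB.
  have : cmod (v - 1) * pnorm (fs j) <= D * rho * F.
    by apply: ler_pM => //; [exact: cmod_ge0|exact: pnorm_ge0].
  lra.
rewrite -mulrA mulrC; have := pnorm_ge0 (p - fs j + (1 - v) *: fs j).
have V2 : (cmod v)^-1 <= 2.
  by rewrite -[leRHS]invrK lef_pV2 // posrE ?invr_gt0 // cmod_gt0.
have V0 : 0 <= (cmod v)^-1 by rewrite invr_ge0 cmod_ge0.
move=> H0; have := ler_pM H0 V0 H V2; lra.
Qed.

Lemma fact_prod_reorder g gs (s : 'S_(fs_r M)) (x : 'I_(fs_r M) -> C) :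
  (forall j, fs_k M (s j) = fs_k M j) -> (forall j, x j != 0) ->
  Defs.fact_prod M g gs =
  Defs.fact_prod M (g / \prod_j x j ^+ fs_k M j) (fun j => x j *: gs (s j)).
Proof.
move=> sk x0; rewrite /Defs.fact_prod prod_scale scalerA divfK; last first.
  by apply/prodf_neq0 => j _; rewrite expf_neq0.
congr (_ *: _); rewrite [LHS](reindex_inj (@perm_inj _ s)) /=.
by apply: eq_bigr => j _; rewrite sk.
Qed.

(** By [factors_close] the factors of a nearby product can be reordered and scaled
    into the neighbourhood where [local_estimate] holds. There phi differs only by
    the difference of the products, as both factorizations satisfy the
    normalization. The scalar is controlled by comparing one nonzero coefficient
    of the products. *)
Lemma factors_lipschitz : exists2 K : R, 0 < K & exists2 delta : R, 0 < delta &
  forall g gs, prime_factors M gs -> pnorm (Defs.fact_prod M g gs - fhat) < delta ->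
    exists (s : 'S_(fs_r M)) (c : 'I_(fs_r M) -> C), forall j,
      [/\ fs_k M (s j) = fs_k M j, c j != 0 &
        pnorm (c j *: gs (s j) - fs j) <= K * pnorm (Defs.fact_prod M g gs - fhat)].
Proof.
have [K K0 [r1 r10 locP]] := local_estimate alpha0 fsP fs_b.
pose N : R := (phi_dom M)%:R.
have N0 : 0 <= N by [].
pose P := \prod_j fs j ^+ fs_k M j.
have P0 : P != 0 := prime_factors_prod_neq0 fsP.
have [mu mu0] : exists mu, mcoeff mu P != 0.
  apply: contrapT => nE; move/eqP: P0; apply; apply/mpolyP => mu; rewrite mcoeff0.
  by apply/eqP; apply: contrapT => /negP mu0; apply: nE; exists mu.
pose nu := cmod (mcoeff mu P); have nu0 : 0 < nu by rewrite cmod_gt0.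
pose e0 := r1 / (2 * (N + 1)).
have N1 : 0 < 2 * (N + 1) by lra.
have e00 : 0 < e0 by rewrite divr_gt0.
have Ne0 : N * e0 < r1.
  have : e0 * (2 * (N + 1)) = r1 by rewrite /e0 divfK // gt_eqF.
  have := mulr_ge0 N0 (ltW e00); lra.
pose A := cmod alpha + 1.
have A0 : 0 < A by have := cmod_ge0 alpha; rewrite /A; lra.
(* keeps the coefficient mu of the product away from 0 and the scalar within e0 *)
pose e2 := Num.min (nu / 2) (e0 * nu / (4 * A)).
have e20 : 0 < e2.
  rewrite lt_min; apply/andP; split; first by rewrite divr_gt0.
  by apply: divr_gt0; exact: mulr_gt0.
have [r2 r20 prodP] := fact_prod_continuous b (phi_pack M 1 fs) e20.
(* accuracy required of the normalized factors *)
pose e3 := Num.min e0 (r2 / (2 * (N + 1))).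
have e30 : 0 < e3 by rewrite lt_min e00 divr_gt0.
have Ne3 : N * e3 < r2.
  have : e3 <= r2 / (2 * (N + 1)) by rewrite /e3 ge_min lexx orbT.
  rewrite ler_pdivlMr //; have := mulr_ge0 N0 (ltW e30); lra.
have DF0 : 0 < 2 * (1 + D * F) by have := mulr_ge0 (le_trans ler01 D1) (le_trans ler01 F1); lra.
have D0 : 0 < D := lt_le_trans ltr01 D1.
(* accuracy that renormalization turns into e3 *)
pose rho := Num.min (2^-1 / D) (e3 / (2 * (1 + D * F))).
have rho0 : 0 < rho by rewrite lt_min !divr_gt0.
have Drho : D * rho <= 2^-1.
  have : rho <= 2^-1 / D by rewrite /rho ge_min lexx.
  by rewrite ler_pdivlMr // mulrC.
have DFrho : 2 * (1 + D * F) * rho <= e3.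
  have : rho <= e3 / (2 * (1 + D * F)) by rewrite /rho ge_min lexx orbT.
  by rewrite ler_pdivlMr // mulrC.
have [delta delta0 closeP] := factors_close alpha0 fsP fhat_deg rho0.
exists (D * K); first exact: mulr_gt0.
exists (Num.min delta (e0 * nu / 4)).
  by rewrite lt_min delta0 divr_gt0 // mulr_gt0.
move=> g gs gsP; rewrite lt_min => /andP[/(closeP g gs gsP)[s [c scP]] ghat].
have gsm j : Pspace (fs_m M j) (gs (s j)).
  by have [_ <- _ _] := scP j; exact: prime_factors_Pspace.
have /choice[t tP] : forall j, exists t : C, [/\ t != 0,
    vdot (b j) (coefv (fs_m M j) (t *: (c j *: gs (s j)))) = 1 &
    pnorm (t *: (c j *: gs (s j)) - fs j) <= e3].
  move=> j; have [_ _ _ /ltW cr] := scP j.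
  have [t [t0 tb tr]] := renormalize (PspaceZ (c j) (gsm j)) Drho cr.
  by exists t; split=> //; exact: le_trans DFrho.
pose x j := t j * c j.
have x0 j : x j != 0 by have [? _ _] := tP j; have [_ _ ? _] := scP j; rewrite mulf_neq0.
pose q j := x j *: gs (s j).
have qm j : Pspace (fs_m M j) (q j) by exact: PspaceZ.
have qb j : vdot (b j) (coefv (fs_m M j) (q j)) = 1.
  by have [_ + _] := tP j; rewrite scalerA.
have qe3 j : pnorm (q j - fs j) <= e3 by have [_ _] := tP j; rewrite scalerA.
have qe0 j : pnorm (q j - fs j) <= e0.
  by apply: le_trans (qe3 j) _; rewrite /e3 ge_min lexx.
have sk j : fs_k M (s j) = fs_k M j by have [] := scP j.
pose g' := g / \prod_j x j ^+ fs_k M j.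
have gE : Defs.fact_prod M g gs = Defs.fact_prod M g' q := fact_prod_reorder g gs sk x0.
pose Q := \prod_j q j ^+ fs_k M j.
have QP : pnorm (Q - P) < e2.
  have := @prodP (phi_pack M 1 q); rewrite !pack_scalarE.
  have -> : pack_factor (phi_pack M 1 q) = q by apply/funext => j; exact: pack_factorE.
  have -> : pack_factor (phi_pack M 1 fs) = fs by apply/funext => j; exact: pack_factorE.
  rewrite /Defs.fact_prod !scale1r; apply; apply: le_lt_trans Ne3.
  by apply: pack_dist => //; [exact: ltW|rewrite subrr cmod0 ltW].
have g'a : cmod (g' - alpha) <= e0.
  have Qmu : nu / 2 <= cmod (mcoeff mu Q).
    have := pnorm_coef mu (Q - P); rewrite mcoeffB.
    have := cmod_triangle (mcoeff mu P) 0 (mcoeff mu Q).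
    rewrite !sub0r !cmodN (cmodB (mcoeff mu P)).
    have : e2 <= nu / 2 by rewrite /e2 ge_min lexx.
    have := cmod_triangle (mcoeff mu Q) (mcoeff mu P) 0; rewrite !subr0 -/nu.
    rewrite (cmodB (mcoeff mu P)); lra.
  have E : (g' - alpha) * mcoeff mu Q =
      mcoeff mu (Defs.fact_prod M g gs - fhat) + alpha * mcoeff mu (P - Q).
    rewrite !mcoeffB gE /fhat /Defs.fact_prod !mcoeffZ -/Q -/P; ring.
  have : cmod (g' - alpha) * cmod (mcoeff mu Q) <= e0 * nu / 4 + e0 * nu / 4.
    rewrite -cmodM E; apply: le_trans (cmodD _ _) (lerD _ _).
      exact: le_trans (pnorm_coef _ _) (ltW ghat).
    rewrite cmodM; have := pnorm_coef mu (P - Q); rewrite pnormB => PQ.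
    have : e2 <= e0 * nu / (4 * A) by rewrite /e2 ge_min lexx orbT.
    rewrite ler_pdivlMr ?mulr_gt0 // => e2A.
    have : cmod alpha * cmod (mcoeff mu (P - Q)) <= A * e2.
      apply: ler_pM; rewrite ?cmod_ge0 //; first by rewrite /A lerDl.
      exact: le_trans PQ (ltW QP).
    lra.
  move=> H; rewrite -(ler_pM2r (_ : 0 < nu / 2)); last by rewrite divr_gt0.
  have := ler_wpM2l (cmod_ge0 (g' - alpha)) Qmu; lra.
have hr : vnorm (phi_pack M g' q - phi_pack M alpha fs) < r1.
  by apply: le_lt_trans Ne0; apply: pack_dist => //; exact: ltW.
have := locP _ hr; rewrite addrCA subrr addr0.
set dz := vnorm (phi_pack M g' q - _); rewrite !phi_fact !pack_scalarE.
have -> : pack_factor (phi_pack M g' q) = q by apply/funext => j; exact: pack_factorE.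
have -> : pack_factor (phi_pack M alpha fs) = fs by apply/funext => j; exact: pack_factorE.
rewrite -gE opp_row_mx add_row_mx -coefvB => est.
have phiB : vnorm (row_mx (coefv (fs_deg M) (Defs.fact_prod M g gs - fhat))
    ((\row_j vdot (b j) (pack_coefs (phi_pack M g' q) j)) -
     \row_j vdot (b j) (pack_coefs (phi_pack M alpha fs) j))) <=
    pnorm (Defs.fact_prod M g gs - fhat).
  apply: le_trans (vnorm_row_le _ _) _; rewrite -pnorm_coefv.
    rewrite -[leRHS]addr0 lerD2l [X in vnorm X](_ : _ = 0) ?vnorm0 //.
    by apply/rowP => j; rewrite !mxE !pack_coefsE qb fs_b subrr.
  by apply: PspaceB; apply: fact_prod_Pspace => // j; exact: prime_factors_Pspace.
exists s, x => j; split=> //.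
rewrite (@pnorm_coefv _ _ (fs_m M j)); last exact: PspaceB.
rewrite coefvB -(pack_coefsE g' q) -(pack_coefsE alpha fs) -pack_coefsB.
apply: le_trans (vnorm_pack_coefs _ _) _; rewrite -mulrA.
apply: ler_pM => //; first exact: vnorm_ge0.
by apply: le_trans est _; rewrite ler_pM2l.
Qed.

End Lipschitz.

(** * Sines and the distance of factorizations *)

Section Sine.
Variables (R : realType) (l : nat).
Notation C := R[i].
Notation T := (cpoly R l).

(** The sine is the distance from p / |p| to the line spanned by q. *)
Lemma psin_le (p q : T) c : p != 0 -> q != 0 ->
  psin p q <= pnorm (c *: q - p) / pnorm p.
Proof.
move=> p0 q0; have [n [pn qn]] := Pspace_common p q.
have pP : 0 < pnorm p by rewrite pnorm_gt0.
have qP : 0 < pnorm q by rewrite pnorm_gt0.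
pose u := (pnorm p)^-1%:C%C *: p; pose v := (pnorm q)^-1%:C%C *: q.
have un : Pspace n u by exact: PspaceZ.
have vn : Pspace n v by exact: PspaceZ.
have v1 : vnorm (coefv n v) = 1.
  by rewrite -pnorm_coefv // pnormZ cmod_real gtr0_norm ?invr_gt0 // mulVf // gt_eqF.
have dotE : pdot q p / (pnorm q * pnorm p)%:C%C = vdot (coefv n v) (coefv n u).
  have uE : coefv n u = (pnorm p)^-1%:C%C *: coefv n p by exact: coefvZ.
  have vE : coefv n v = (pnorm q)^-1%:C%C *: coefv n q by exact: coefvZ.
  have conj_real (t : R) : (t%:C%C : C)^* = t%:C%C by exact: conjc_real.
  rewrite (pdot_coefv _ qn) uE vE vdotZr (vdotC (coefv n p) (_ *: _)) vdotZr.
  have conjZ (t : R) (x : C) : (t%:C%C * x)^* = t%:C%C * x^*.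
    by rewrite [LHS]rmorphM /= conj_real.
  rewrite conjZ -vdotC mulrA mulrC; congr (_ * _).
  by rewrite -fmorphV -rmorphM /= invfM mulrC.
have -> : psin p q = vnorm (coefv n u - vdot (coefv n v) (coefv n u) *: coefv n v).
  rewrite /psin dotE -/u -/v (@pnorm_coefv _ _ n) ?coefvB ?coefvZ //.
  by apply: PspaceB => //; exact: PspaceZ.
pose d := c * (pnorm q / pnorm p)%:C%C.
apply: le_trans (vnorm_projection _ d v1) _.
rewrite -coefvZ -coefvB -pnorm_coefv; last by apply: PspaceB => //; exact: PspaceZ.
suff -> : u - d *: v = - (pnorm p)^-1%:C%C *: (c *: q - p).
  by rewrite pnormZ cmodN cmod_real gtr0_norm ?invr_gt0 // mulrC.
rewrite /u /v /d scalerA -mulrA -rmorphM /= mulrAC divff ?gt_eqF // mul1r.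
by rewrite scalerBr !scaleNr opprK addrC scalerA mulrC.
Qed.

End Sine.

Section DistanceOfFactorizations.
Variables (R : realType) (l : nat) (M : fstruct l).
Notation T := (cpoly R l).
Implicit Types (fs gs : 'I_(fs_r M) -> T).

(** Indices repeated with their multiplicities, so that both lists of factors
    are images of the same list. *)
Definition factor_index : seq 'I_(fs_r M) :=
  flatten [seq nseq (fs_k M j) j | j <- enum 'I_(fs_r M)].

Lemma factor_seqE fs : factor_seq M fs = map fs factor_index.
Proof.
rewrite /factor_seq /factor_index map_flatten -map_comp; congr flatten.
by apply: eq_map => j /=; rewrite map_nseq.
Qed.

Lemma perm_factor_index (s : 'S_(fs_r M)) : (forall j, fs_k M (s j) = fs_k M j) ->
  perm_eq (map s factor_index) factor_index.
Proof.
move=> sk; rewrite /factor_index map_flatten -map_comp.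
have -> : [seq (map s \o (fun j => nseq (fs_k M j) j)) j | j <- enum 'I_(fs_r M)] =
    [seq nseq (fs_k M j) j | j <- map s (enum 'I_(fs_r M))].
  by rewrite -[RHS]map_comp; apply: eq_map => j /=; rewrite map_nseq sk.
apply/perm_flatten/perm_map/uniq_perm.
- by rewrite map_inj_uniq; [exact: enum_uniq|exact: perm_inj].
- exact: enum_uniq.
move=> j; rewrite mem_enum; apply/mapP; exists ((s^-1)%g j); rewrite ?mem_enum //.
by rewrite permKV.
Qed.

(** A permutation of the distinct factors that preserves multiplicities induces a
    permutation of the repeated factors. *)
Lemma dist_fact_le fs gs (s : 'S_(fs_r M)) (B : R) : 0 <= B ->
  (forall j, fs_k M (s j) = fs_k M j) ->
  (forall j, psin (fs j) (gs (s j)) <= B) ->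
  dist_fact (factor_seq M fs) (factor_seq M gs) <= B.
Proof.
move=> B0 sk sB; rewrite /dist_fact.
have sizeE : size (factor_seq M gs) == size (factor_seq M fs).
  by rewrite !factor_seqE !size_map.
rewrite [_ == _]eq_sym sizeE.
pose t : (size (factor_seq M fs)).-tuple T := Tuple sizeE.
have pE : perm_eq (map (fun j => gs (s j)) factor_index) t.
  by rewrite /= factor_seqE map_comp perm_map // perm_factor_index.
have /tuple_permP[sigma sigmaE] := pE.
apply: (@le_trans _ _ (max_sin (factor_seq M gs) sigma)).
  exact: bigmin_le.
apply: bigmax_le => // j _.
have -> : (factor_seq M gs)`_(sigma j) = (map (fun j => gs (s j)) factor_index)`_j.
  by rewrite sigmaE -tnth_nth tnth_mktuple (tnth_nth 0).
have ji : (j < size factor_index)%N by have := ltn_ord j; rewrite [X in (_ < size X)%N]factor_seqE size_map.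
move: (nat_of_ord j) ji => k ji.
rewrite factor_seqE; case: factor_index ji => // i0 r ji.
by rewrite !(nth_map i0).
Qed.

End DistanceOfFactorizations.

(** * Nearest points of the factorization manifold *)

Section NearestFactorization.
Variables (R : realType) (l : nat) (M : fstruct l).
Notation C := R[i].
Notation T := (cpoly R l).
Implicit Types (f g h : T) (fs gs : 'I_(fs_r M) -> T).

Definition nearest_fact g h :=
  Fman M h /\ forall h', Fman M h' -> pnorm (g - h) <= pnorm (g - h').

Lemma Fman_Pspace h : Fman M h -> Pspace (fs_deg M) h.
Proof. by case=> /Pexact_Pspace. Qed.

Lemma PexactZ n c h : c != 0 -> Pexact n h -> Pexact n (c *: h).
Proof.
move=> c0 [h0 hn]; split; first by rewrite scaler_eq0 negb_or c0.
have hP : Pspace n h by rewrite -hn => i.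
apply/mnmP => i; apply/eqP; rewrite eqn_leq; apply/andP; split.
  exact: PspaceZ hP i.
rewrite -{1}hn.
have : Pspace (pdeg (c *: h)) (c^-1 *: (c *: h)) by exact: PspaceZ.
by rewrite scalerA mulVf // scale1r => /(_ i).
Qed.

Lemma FmanZ c h : c != 0 -> Fman M h -> Fman M (c *: h).
Proof.
move=> c0 [hd [a [fs [fsP hE]]]]; split; first exact: PexactZ.
by exists (c * a), fs; split=> //; rewrite hE /Defs.fact_prod scalerA.
Qed.

Lemma Fman_neq0 h : Fman M h -> h != 0.
Proof. by case=> -[]. Qed.

(** The manifold is a cone, and halving h would bring it closer to g if 0 were
    at least as close as h. *)
Lemma nearest_lt_norm g h : Pspace (fs_deg M) g -> nearest_fact g h ->
  pnorm (g - h) < pnorm g.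
Proof.
move=> gm [hF hmin]; rewrite ltNge; apply/negP => gh.
have hm := Fman_Pspace hF.
have half0 : (2^-1%:C%C : C) != 0 by rewrite -cmod_eq0 cmod_real normr_eq0 invr_eq0.
have := hmin _ (FmanZ half0 hF) => H.
have uE (c : R) : pnorm (g - c%:C%C *: h) ^+ 2 = dot (pvec (fs_deg M) g) (pvec (fs_deg M) g)
    - 2 * c * dot (pvec (fs_deg M) g) (pvec (fs_deg M) h)
    + c ^+ 2 * pnorm h ^+ 2.
  rewrite -(enorm_pvec hm) sqr_enorm -(enorm_pvec (PspaceB gm (PspaceZ _ hm))) sqr_enorm.
  rewrite pvecB pvecZ !dotE [dot (pvec _ h) (pvec _ g)]dotC; ring.
have h0 : 0 < pnorm h by rewrite pnorm_gt0 Fman_neq0.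
have E1 := uE 1; rewrite scale1r in E1.
have E0 := uE 0; rewrite scale0r subr0 in E0.
have E2 := uE 2^-1.
have gh2 : pnorm g ^+ 2 <= pnorm (g - h) ^+ 2.
  by rewrite ler_pXn2r ?nnegrE ?pnorm_ge0.
have H2 : pnorm (g - h) ^+ 2 <= pnorm (g - 2^-1%:C%C *: h) ^+ 2.
  by rewrite ler_pXn2r ?nnegrE ?pnorm_ge0.
have h2 : 0 < pnorm h ^+ 2 by rewrite exprn_gt0.
have V : (2^-1 : R) ^+ 2 = 4^-1 by field.
rewrite E1 E0 in gh2; rewrite E1 E2 V in H2; lra.
Qed.

(** The midpoint of h and c h lies in the manifold or is 0, so it is not closer to g
    than h. *)
Lemma nearest_uniq_line g h c : Pspace (fs_deg M) g -> nearest_fact g h ->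
  nearest_fact g (c *: h) -> c *: h = h.
Proof.
move=> gm hN cN; have hm := Fman_Pspace hN.1; have cm := Fman_Pspace cN.1.
pose m := (2^-1 * (1 + c)) *: h.
have d_eq : pnorm (g - c *: h) = pnorm (g - h).
  by apply/le_anti; rewrite (cN.2 _ hN.1) (hN.2 _ cN.1).
have mid : pnorm (g - h) <= pnorm (g - m).
  have [c0|c0] := eqVneq (2^-1 * (1 + c)) 0.
    by rewrite /m c0 scale0r subr0 ltW // nearest_lt_norm.
  by apply: hN.2; exact: FmanZ hN.1.
have mm : Pspace (fs_deg M) m by exact: PspaceZ.
have mE : g - m = 2^-1%:C%C *: ((g - h) + (g - c *: h)).
  have E2 : (2^-1%:C%C : C) = 2^-1 by rewrite fmorphV rmorph_nat.
  have gE : g = 2^-1 *: (g + g) :> T.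
    by rewrite -mulr2n -[g *+ 2]scaler_nat scalerA mulVf ?scale1r // pnatr_eq0.
  rewrite E2 addrACA -opprD scalerBr -gE; congr (_ - _).
  by rewrite /m -scalerA scalerDl scale1r.
have [x xE] : exists x, x = pvec (fs_deg M) (g - h) by eexists.
have [y yE] : exists y, y = pvec (fs_deg M) (g - c *: h) by eexists.
have xd : dot x x = pnorm (g - h) ^+ 2.
  by rewrite xE -sqr_enorm enorm_pvec //; exact: PspaceB.
have yd : dot y y = pnorm (g - h) ^+ 2.
  by rewrite yE -sqr_enorm enorm_pvec ?d_eq //; exact: PspaceB.
have xy : x = y.
  apply: (midpoint_strict_convexity xd yd).
  rewrite xE yE -pvecD -pvecZ -mE -sqr_enorm enorm_pvec; last exact: PspaceB.
  by rewrite ler_pXn2r ?nnegrE ?pnorm_ge0.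
rewrite xE yE in xy.
have := pvec_inj (PspaceB gm hm) (PspaceB gm cm) xy.
by move/addrI/oppr_inj.
Qed.

(** The scalar a of a numerical factorization is arbitrary; the nearest point is
    obtained with the scalar that minimizes the distance. *)
Lemma numfact_nearest g e a gs : is_numfact g e M a gs ->
  exists2 a', a' != 0 & prime_factors M gs /\ nearest_fact g (Defs.fact_prod M a' gs).
Proof.
case=> gd _ [a0 gsP] aF [d [[[a' _ a'd] _] [[h hF hd] dmin] _ _]].
have gm := Pexact_Pspace gd.
have hN : nearest_fact g h.
  by split=> // h' h'F; rewrite hd; apply: dmin; exists h'.
have a'0 : a' != 0.
  apply: contraTneq (nearest_lt_norm gm hN) => a'0.
  by rewrite hd -a'd a'0 /Defs.fact_prod scale0r subr0 ltxx.
exists a' => //; split=> //; split.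
  have -> : Defs.fact_prod M a' gs = (a' / a) *: Defs.fact_prod M a gs.
    by rewrite /Defs.fact_prod scalerA divfK.
  by apply: FmanZ => //; rewrite mulf_neq0 ?invr_eq0.
by move=> h' h'F; rewrite a'd -hd; exact: hN.2.
Qed.

Lemma nearest_numfact g e a gs h b hs : is_numfact g e M a gs ->
  nearest_fact g h -> prime_factors M hs -> h = Defs.fact_prod M b hs ->
  is_numfact g e M b hs.
Proof.
move=> gN hN hsP hE; have [a' a'0 [_ a'N]] := numfact_nearest gN.
have [gd cod _ _ [d [_ [[h' h'F h'd] dmin] distE de]]] := gN.
have gm := Pexact_Pspace gd.
have hd : pnorm (g - h) = d.
  apply/le_anti/andP; split; first by rewrite -h'd; exact: hN.2.
  by apply: (dmin (pnorm (g - h))); exists h => //; exact: hN.1.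
have b0 : b != 0.
  by apply: contraNneq (Fman_neq0 hN.1) => b0; rewrite hE b0 /Defs.fact_prod scale0r.
split=> //; first by rewrite -hE; exact: hN.1.
exists d; split=> //; last by split=> //; exists h'.
split; first by exists b => //; rewrite -hE.
  move=> _ [t _ <-]; have [->|t0] := eqVneq t 0.
    by rewrite /Defs.fact_prod scale0r subr0 -hd ltW // nearest_lt_norm.
  apply: dmin; exists (Defs.fact_prod M t hs) => //.
  have -> : Defs.fact_prod M t hs = (t / b) *: h.
    by rewrite hE /Defs.fact_prod scalerA divfK.
  by apply: FmanZ hN.1; rewrite mulf_neq0 ?invr_eq0.
Qed.

(** Uniqueness of the factors puts the two nearest points on a common line. *)
Lemma nearest_unique g e : (exists a gs, is_numfact g e M a gs) ->
  (forall a gs a' gs', is_numfact g e M a gs -> is_numfact g e M a' gs' ->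
     same_factors M gs gs') ->
  forall h h', nearest_fact g h -> nearest_fact g h' -> h = h'.
Proof.
move=> [a [gs gN]] uniq h h' hN h'N.
have gm : Pspace (fs_deg M) g by case: gN => /Pexact_Pspace.
have [_ [b [hs [hsP hE]]]] := hN.1; have [_ [b' [hs' [hsP' hE']]]] := h'N.1.
have [s sP] := uniq _ _ _ _ (nearest_numfact gN hN hsP hE) (nearest_numfact gN h'N hsP' hE').
have /choice[c cP] : forall j, exists c : C, c != 0 /\ hs' j = c *: hs (s j).
  by move=> j; have [_ [c]] := sP j; exists c.
have b0 : b != 0.
  by apply: contraNneq (Fman_neq0 hN.1) => b0; rewrite hE b0 /Defs.fact_prod scale0r.
have h'h : h' = (b' * \prod_j c j ^+ fs_k M j / b) *: h.
  rewrite hE' hE /Defs.fact_prod scalerA divfK // -scalerA; congr (_ *: _).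
  have -> : \prod_j hs' j ^+ fs_k M j = \prod_j (c j *: hs (s j)) ^+ fs_k M j.
    by apply: eq_bigr => j _; have [_ ->] := cP j.
  rewrite prod_scale; congr (_ *: _); rewrite [RHS](reindex_inj (@perm_inj _ s)) /=.
  by apply: eq_bigr => j _; have [-> _] := sP j.
by rewrite h'h; apply/esym/(nearest_uniq_line gm hN); rewrite -h'h.
Qed.

(** The manifold has unique nearest points on a neighbourhood of f. The constants
    found here serve for every tolerance, since being nearest does not refer to
    it. *)
Lemma nearest_lipschitz f eps : Pspace (fs_deg M) f ->
  numfact_well_defined_near f eps M ->
  exists2 K : R, 0 < K & exists2 r : R, 0 < r &
  forall g h h', Pspace (fs_deg M) g -> pnorm (f - g) < r ->
    nearest_fact f h -> nearest_fact g h' -> pnorm (h' - h) <= K * pnorm (f - g).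
Proof.
move=> fm [d d0 dP]; set m := fs_deg M in fm *.
pose S := [set pvec m h | h in (Fman M : set T)].
have SN g h : Pspace m g -> nearest_fact g h -> nearest S (pvec m g) (pvec m h).
  move=> gm [hF hmin]; split; first by exists h.
  move=> _ [h' h'F <-]; rewrite -!pvecB !enorm_pvec; first exact: hmin.
    exact: PspaceB (Fman_Pspace h'F).
  exact: PspaceB (Fman_Pspace hF).
have NS g b : Pspace m g -> nearest S (pvec m g) b ->
    exists2 h, nearest_fact g h & b = pvec m h.
  move=> gm [[h hF <-] hmin]; exists h => //; split=> // h' h'F.
  have := hmin _ (ex_intro2 _ _ h' h'F erefl); rewrite -!pvecB !enorm_pvec //.
    exact: PspaceB (Fman_Pspace h'F).
  exact: PspaceB (Fman_Pspace hF).
have near_f x : enorm (x - pvec m f) < d -> exists g, [/\ Pspace m g, x = pvec m g &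
    pnorm (f - g) < d].
  have [g gm <-] := pvec_surj x; rewrite -pvecB enorm_pvec; last exact: PspaceB.
  by rewrite pnormB => gd; exists g.
have ex x : enorm (x - pvec m f) < d -> exists a, nearest S x a.
  case/near_f => g [gm -> gd]; have [[a [gs gN]] _] := dP g gm gd.
  have [a' _ [_ aN]] := numfact_nearest gN.
  by exists (pvec m (Defs.fact_prod M a' gs)); exact: SN.
have uniq x a b : enorm (x - pvec m f) < d -> nearest S x a -> nearest S x b -> a = b.
  case/near_f => g [gm -> gd] /(NS _ _ gm)[h hN ->] /(NS _ _ gm)[h' h'N ->].
  have [gex guniq] := dP g gm gd.
  by congr pvec; exact: (nearest_unique gex guniq).
have [K K0 KP] := projection_lipschitz_near ex uniq d0.
exists K => //; exists (d / 2); first by rewrite divr_gt0.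
move=> g h h' gm gd hN h'N.
have hm := Fman_Pspace hN.1; have h'm := Fman_Pspace h'N.1.
rewrite pnormB -(enorm_pvec (PspaceB fm gm)) -(enorm_pvec (PspaceB hm h'm)) !pvecB.
rewrite enormB [leRHS](_ : _ = K * enorm (pvec m g - pvec m f)); last by rewrite enormB.
apply: KP; try exact: SN.
- by rewrite enormB -pvecB enorm_pvec //; exact: PspaceB.
- by rewrite subrr enorm0 divr_gt0.
Qed.

End NearestFactorization.

(** * The condition number of numerical factorization *)

Section ConditionNumber.
Variables (R : realType) (l : nat) (M : fstruct l) (f : cpoly R l).
Variable b : forall j : 'I_(fs_r M), 'rV[R[i]]_(dimP (fs_m M j)).
Hypothesis b1 : forall j, vnorm (b j) = 1.
Notation C := R[i].
Notation T := (cpoly R l).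
Implicit Types fs gs : 'I_(fs_r M) -> T.

Definition normalized fs := forall j, vdot (b j) (coefv (fs_m M j) (fs j)) = 1.

(** Composition of the two Lipschitz estimates. *)
Lemma dist_fact_lipschitz K r h a fs : 0 < K -> 0 < r -> Pspace (fs_deg M) f ->
  (forall g h', Pspace (fs_deg M) g -> pnorm (f - g) < r ->
    nearest_fact M g h' -> pnorm (h' - h) <= K * pnorm (f - g)) ->
  Fman M h -> a != 0 -> h = Defs.fact_prod M a fs ->
  prime_factors M fs -> normalized fs ->
  exists2 L : R, 0 < L & exists2 delta : R, 0 < delta &
    forall eps g c gs, pnorm (f - g) < delta -> is_numfact g eps M c gs ->
      dist_fact (factor_seq M fs) (factor_seq M gs) <= L * pnorm (f - g).
Proof.
move=> K0 r0 fm hK hF a0 hE fsP fsN.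
have hd : Pexact (fs_deg M) (Defs.fact_prod M a fs) by rewrite -hE; case: hF.
have [K' K'0 [d d0 lip]] := factors_lipschitz b1 a0 fsP fsN hd.
have fs0 j : fs j != 0 := fs_neq0 (prime_factors_irr fsP) j.
have fsN0 j : 0 < pnorm (fs j) by rewrite pnorm_gt0.
pose G : R := 1 + \sum_j (pnorm (fs j))^-1.
have Gj j : (pnorm (fs j))^-1 <= G.
  rewrite /G (bigD1 j) //=.
  have : 0 <= \sum_(i < fs_r M | i != j) (pnorm (fs i))^-1.
    by rewrite sumr_ge0 // => i _; rewrite invr_ge0 pnorm_ge0.
  lra.
have G0 : 0 < G.
  by rewrite ltr_pwDl // sumr_ge0 // => i _; rewrite invr_ge0 pnorm_ge0.
exists (K' * K * G); first by rewrite !mulr_gt0.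
exists (Num.min r (d / K)); first by rewrite lt_min r0 divr_gt0.
move=> eps g c gs; rewrite lt_min => /andP[gr gd] gN.
have gm : Pspace (fs_deg M) g by case: gN => /Pexact_Pspace.
have [c' _ [gsP cN]] := numfact_nearest gN.
have close := hK _ _ gm gr cN.
have [|s [x sx]] := lip c' gs gsP.
  rewrite -hE; apply: le_lt_trans close _.
  by rewrite mulrC -ltr_pdivlMr.
apply: (@dist_fact_le _ _ M fs gs s).
- by rewrite !mulr_ge0 ?pnorm_ge0 ?ltW.
- by move=> j; have [] := sx j.
move=> j; have [_ x0 le] := sx j.
apply: le_trans (psin_le (x j) (fs0 j) _) _.
  by rewrite (fs_neq0 (prime_factors_irr gsP)).
have := le_trans le (ler_wpM2l (ltW K'0) _); rewrite -hE => /(_ _ close) {}le.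
have -> : K' * K * G * pnorm (f - g) = K' * (K * pnorm (f - g)) * G by ring.
by apply: ler_pM => //; rewrite ?pnorm_ge0 // invr_ge0 pnorm_ge0.
Qed.

Lemma limsup_le eps fs (L delta : R) : 0 < delta ->
  (forall g c gs, pnorm (f - g) < delta -> is_numfact g eps M c gs ->
      dist_fact (factor_seq M fs) (factor_seq M gs) <= L * pnorm (f - g)) ->
  (limsup_dist_ratio f eps M fs <= L%:E)%E.
Proof.
move=> d0 dL; apply: le_trans; first by apply: ereal_inf_lbound; exists delta => //.
apply: ge_ereal_sup => _ [g [c [gs [/andP[g0 gd] gN ->]]]].
by rewrite lee_fin ler_pdivrMr //; exact: dL gN.
Qed.

End ConditionNumber.

Theorem theorem6p3 (R : realType) (l : nat) (M : fstruct l) (f : cpoly R l)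
    (b : forall j : 'I_(fs_r M), 'rV[R[i]]_(dimP (fs_m M j)))
    (b1 : forall j, vnorm (b j) = 1) :
  exists eta : R, 0 < eta /\
    forall (eps : R) (alpha : R[i]) (fs : 'I_(fs_r M) -> cpoly R l),
      0 < eps ->
      is_numfact f eps M alpha fs ->
      numfact_well_defined_near f eps M ->
      (forall j, vdot (b j) (coefv (fs_m M j) (fs j)) = 1) ->
      (limsup_dist_ratio f eps M fs
         <= eta%:E * opnorm2 (mp_pinv (phi_jacobian M b (phi_pack M alpha fs))))%E /\
      (eta%:E * opnorm2 (mp_pinv (phi_jacobian M b (phi_pack M alpha fs))) < +oo)%E.
Proof.
have [[eps0 [a0 [fs0 [fN0 wd0 nrm0]]]]|none] := pselect (exists eps alpha fs,
    [/\ is_numfact f eps M alpha fs, numfact_well_defined_near f eps M &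
      normalized b fs]); last first.
  exists 1; split=> // eps alpha fs _ fN wd nrm.
  by case: none; exists eps, alpha, fs.
have fm : Pspace (fs_deg M) f by case: fN0 => /Pexact_Pspace.
have [K K0 [r r0 lip]] := nearest_lipschitz fm wd0.
have [a0' a0'0 [fsP0 hN0]] := numfact_nearest fN0.
set h := Defs.fact_prod M a0' fs0 in hN0.
have hd : Pexact (fs_deg M) h by case: hN0 => -[].
(* the only candidates for normalized factors of the nearest point h *)
pose Fs (s : 'S_(fs_r M)) j :=
  (vdot (b j) (coefv (fs_m M j) (fs0 (s j))))^-1 *: fs0 (s j).
have FsP eps alpha fs : is_numfact f eps M alpha fs -> normalized b fs ->
    exists s, fs = Fs s /\ exists2 a, a != 0 & h = Defs.fact_prod M a fs.
  move=> fN nrm; have [a a_0 [fsP hN]] := numfact_nearest fN.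
  have hE : h = Defs.fact_prod M a fs.
    have := lip f _ _ fm _ hN0 hN; rewrite subrr pnorm0 mulr0 => /(_ r0) le0.
    apply/esym/eqP; rewrite -subr_eq0 -pnorm_eq0; apply/eqP/le_anti.
    by rewrite le0 pnorm_ge0.
  have [||||s sP] := @limit_factorization _ _ M a0' fs0 a0'0 fsP0 hd a 1 fs.
  - by move=> j; exact: fs_neq0 (prime_factors_irr fsP) j.
  - by move=> j; exact: prime_factors_Pspace.
  - by left.
  - by rewrite scale1r -/h hE.
  exists s; split; last by exists a.
  apply/funext => j; rewrite /Fs; have [_ _ [d d_0 fsE]] := sP j.
  have := nrm j; rewrite fsE coefvZ vdotZr => dv.
  congr (_ *: _); rewrite -[RHS]mul1r -dv mulfK //.
  by apply: contra_eq_neq dv => ->; rewrite mulr0 eq_sym oner_neq0.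
have /choice[L LP] : forall s, exists L : R, 0 < L /\
    (prime_factors M (Fs s) -> normalized b (Fs s) ->
     (exists2 a, a != 0 & h = Defs.fact_prod M a (Fs s)) ->
     exists2 delta : R, 0 < delta & forall eps g c gs, pnorm (f - g) < delta ->
       is_numfact g eps M c gs ->
       dist_fact (factor_seq M (Fs s)) (factor_seq M gs) <= L * pnorm (f - g)).
  move=> s; have [[FsPr Fsn [a a_0 hE]]|none] := pselect
      [/\ prime_factors M (Fs s), normalized b (Fs s) &
        exists2 a, a != 0 & h = Defs.fact_prod M a (Fs s)]; last first.
    by exists 1; split=> // ? ? ?; case: none.
  have lip' g h' : Pspace (fs_deg M) g -> pnorm (f - g) < r ->
      nearest_fact M g h' -> pnorm (h' - h) <= K * pnorm (f - g).
    by move=> gm gr; exact: lip gm gr hN0.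
  have [L L0 LP] := dist_fact_lipschitz b1 K0 r0 fm lip' hN0.1 a_0 hE FsPr Fsn.
  by exists L.
pose P s := pnorm (\prod_j Fs s j ^+ fs_k M j).
have LP0 s : 0 <= L s * P s.
  by rewrite mulr_ge0 ?pnorm_ge0 // ltW //; have [] := LP s.
pose eta := 1 + \sum_s L s * P s.
have etaP s : L s * P s <= eta.
  rewrite /eta (bigD1 s) //=.
  have : 0 <= \sum_(t | t != s) L t * P t by rewrite sumr_ge0.
  lra.
have eta0 : 0 < eta by rewrite ltr_pwDl // sumr_ge0.
exists eta; split=> // eps alpha fs _ fN _ nrm.
have [_ _ [alpha0 fsP] _ _] := fN.
have [s [fsE hE]] := FsP _ _ _ fN nrm.
split; last first.
  have := opnorm2_lt_pinfty (mp_pinv (phi_jacobian M b (phi_pack M alpha fs))).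
  case: (opnorm2 _) => [x||] // _; first by rewrite -EFinM ltry.
  by rewrite gt0_muleNy ?lte_fin.
have PE : pnorm (\prod_j fs j ^+ fs_k M j) = P s by rewrite fsE.
have low := opnorm2_pinv_lower alpha0 fsP nrm; rewrite PE in low.
have P0 : 0 < P s by rewrite -PE pnorm_gt0; exact: prime_factors_prod_neq0.
apply: (@le_trans _ _ (L s)%:E); last first.
  apply: (@le_trans _ _ (eta%:E * ((P s)^-1)%:E)%E).
    by rewrite -EFinM lee_fin ler_pdivlMr.
  by rewrite lee_pmul2l.
have [_ LPs] := LP s; rewrite fsE in fsP nrm hE *.
have [delta delta0 {}LPs] := LPs fsP nrm hE.
by apply: (limsup_le delta0) => g c gs; exact: LPs.
Qed.
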